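(* Let $n\geqslant 1$ and let $G$ be a simple graph on $n$ vertices. Write $n-1=9q+r$ with integers $q\geqslant 0$ and $0\leqslant r\leqslant 8$. If \[ e(G)>15q+\left\lfloor\frac{3r}{2}\right\rfloor, \] then $G$ contains a cycle whose length is congruent to $1$ modulo $3$.
   Context: All graphs are finite and simple (no loops, no multiple edges). $e(G)$ denotes the number of edges of $G$. *)

(* Defs.v *)
(* A simple graph on a finite vertex type T is a symmetric,
   irreflexive boolean relation e : rel T. *)
From mathcomp Require Import all_boot.
Set Implicit Arguments. Unset Strict Implicit. Unset Printing Implicit Defensive.

Definition edges (T : finType) (e : rel T) : {set {set T}} :=
  [set [set x; y] | x in T, y in T & e x y].

Definition num_edges (T : finType) (e : rel T) : nat := #|edges e|.

Definition has_cycle_of_length (T : finType) (e : rel T) (k : nat) : Prop :=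
  exists s : seq T, [/\ uniq s, size s = k, 3 <= k & cycle e s].

(* Main.v *)
Require Import Defs.
From mathcomp Require Import all_boot.
From mathcomp Require Import zify.
Set Implicit Arguments. Unset Strict Implicit. Unset Printing Implicit Defensive.

(** Take a counterexample supported on a set [S] of vertices that is as small as possible.
Deleting or identifying a few vertices shows that it has no cut vertex, minimum degree 2, no two
adjacent vertices of degree 2, no vertex of degree 3 all of whose neighbours have degree 2, and that
a path [b - v - a - z] with [deg v = 2] and [deg a = 3] forces [b] and [z] to have a further common
neighbour (otherwise delete [v], [a] and identify [b] with [z]: cycles of length 1 mod 3 lift).

The main tool is [branch_single]: under mild conditions a connected set that is attached to the rest
of the graph through [X] and [Y], and all of whose paths from [X] to [Y] have the same length mod 3,
is a single vertex. If all cycles had length 2 mod 3, it would apply to the components of [S]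
minus a vertex, so there is a cycle of length 0 mod 3; let [C] be a shortest one, with its vertices
coloured by index mod 3. A path off [C] that joins two colours has length 2 mod 3 (not counting the
two edges to [C]), and one that joins distinct vertices of the same colour does not. So a component
off [C] that sees several colours is a path with 3 vertices or a star with 3 leaves, and then [C] has
length 6. If every component sees a single colour, two that cross on [C] are single vertices, and a
shortest arc spanned by a component again yields length 6. Around a 6-cycle there is room for at most
10 vertices in total, and adding up the degrees gives too few edges. *)

(** The constant comes from the Petersen graph: it has 10 vertices, 15 edges and no cycle of length
    4, 7 or 10, and copies of it glued at cut vertices gain 15 edges per 9 new vertices. The proof
    works with degree sums: the bound becomes [bound (n - 1)] with [bound m = 3 * m + 3 * (m %/ 9)].
    This function is superadditive, so gluing at a cut vertex is harmless, and removing [k] vertices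
    is a reduction as soon as it costs at most [3 * k] of the degree sum. For 10 vertices the bound
    is 30, which maximum degree 3 cannot exceed. The obstacle to collapsing a connected piece is a
    vertex with several neighbours in an attachment set, or two arms of degree 2 that meet in a hub.
    [branch_single] excludes both by hypothesis ([onenb], [hubfree]). Towards a colour class of the
    cycle the first can fail; the exceptions are then listed ([dead_shape]) or refuted by the
    minimality of the cycle ([no_two_arms]). *)

Ltac nq := repeat match goal with
  | H : is_true (?x != ?y) |- context [?x == ?y] => rewrite (negbTE H)
  | H : is_true (?x != ?y) |- context [?y == ?x] => rewrite (eq_sym y x) (negbTE H)
  | H : is_true (?x \in ?A) |- context [?x \in ?A] => rewrite H
  | H : is_true (?x \notin ?A) |- context [?x \in ?A] => rewrite (negbTE H)
  | |- context [?x == ?x] => rewrite eqxx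
  end.
Ltac memg := rewrite ?inE; nq; rewrite /= ?(andbT, andbF, orbT, orbF) //=.
(** The last clause saturates the context with the memberships that inclusion hypotheses yield, so
    that [memg] can decide the goal by rewriting. *)
Ltac splith := repeat match goal with
  | H : is_true (_ || _) |- _ => case/orP: H => H
  | H : is_true (_ && _) |- _ => let H' := fresh H in case/andP: H => H H'
  | H : is_true (~~ (_ || _)) |- _ => rewrite negb_or in H
  | H : is_true (~~ ~~ _) |- _ => rewrite negbK in H
  | H : is_true (?x == ?y) |- _ => move/eqP: H => H; try first [subst x | subst y]
  | H : ?x \in ?A = true |- _ => change (is_true (x \in A)) in H
  | H : is_true (?w \in ?Z), s : {subset ?Z <= ?K} |- _ =>
      lazymatch goal with
      | _ : is_true (w \in K) |- _ => fail
      | _ => let H' := fresh "m" in have H' : w \in K := s _ H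
      end
  end.
Ltac sets := let w := fresh "w" in let H := fresh "H" in
  intros w H; rewrite ?inE in H; splith; memg.

(** * Paths and components *)

Section Paths.
Variables (T : finType) (e : rel T).
Hypothesis eC : symmetric e.
Implicit Types (K L A Z : {set T}).

(** [K] merely contains the vertices of the path, so joining two paths needs no more than
    disjointness of two sets; [n] counts edges. *)
Definition lpath (K : {set T}) (x y : T) (n : nat) : Prop :=
  exists p, [/\ path e x p, last x p = y, uniq (x :: p), size p = n
              & {subset x :: p <= K}].

Lemma lp0 K x : x \in K -> lpath K x x 0.
Proof. by move=> xK; exists [::]; split=> // z; rewrite inE => /eqP->. Qed.

Lemma lp_sub K L x y n : lpath K x y n -> {subset K <= L} -> lpath L x y n.
Proof. by case=> p [? ? ? ? sK] sKL; exists p; split=> // z /sK /sKL. Qed.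

Lemma lp_fst K x y n : lpath K x y n -> x \in K.
Proof. by case=> p [_ _ _ _ sK]; apply: sK; rewrite mem_head. Qed.

Lemma lp_lst K x y n : lpath K x y n -> y \in K.
Proof. by case=> p [_ <- _ _ sK]; apply: sK; rewrite mem_last. Qed.

Lemma lp_eq0 K x y n : lpath K x y n -> (n == 0) = (x == y).
Proof.
case=> [] [|z p] [_ /= <- U <- _]; first by rewrite !eqxx.
apply/esym/negbTE/eqP => xl; move: U; rewrite {1}xl.
by rewrite mem_last.
Qed.

Lemma lp_cons K x y z n :
  e x y -> x \notin K -> lpath K y z n -> lpath (x |: K) x z n.+1.
Proof.
move=> exy xK [p [pp lp up sp sK]]; exists (y :: p); split=> //=.
- by rewrite exy.
- rewrite -/(uniq (y :: p)) up andbT.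
  by apply: contra xK; apply: sK.
- by rewrite sp.
by move=> w; rewrite inE in_setU1 => /orP[->//|/sK->]; rewrite orbT.
Qed.

Lemma lp_cat K L x y x' z n m :
  lpath K x y n -> e y x' -> lpath L x' z m ->
  (forall w, w \in K -> w \in L -> False) ->
  lpath (K :|: L) x z (n + m).+1.
Proof.
case=> p [pp lp up sp sK] eyx [p' [pp' lp' up' sp' sL]] dis.
exists (p ++ x' :: p'); split.
- by rewrite cat_path pp lp /= eyx.
- by rewrite last_cat.
- rewrite -cat_cons cat_uniq up up' andbT; apply/hasPn => w wL.
  by apply/negP => wK; apply: (dis w); [apply: sK|apply: sL].
- by rewrite size_cat /= sp sp' addnS.
by move=> w; rewrite -cat_cons mem_cat !inE -!in_cons => /orP[/sK->|/sL->]; rewrite ?orbT.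
Qed.

Lemma lp_step K x y n : lpath K x y n.+1 ->
  exists x', [/\ e x x', x' \in K, x' != x & lpath (K :\ x) x' y n].
Proof.
case=> [] [|x' p] [//= /andP[exx' pp] lp /andP[xp up] [sp] sK].
exists x'; split=> //.
- by apply: sK; rewrite !inE eqxx orbT.
- by apply: contraNneq xp => <-; rewrite mem_head.
exists p; split=> // w wp; rewrite in_setD1 sK; last by rewrite inE wp orbT.
by rewrite andbT; apply: contraNneq xp => <-.
Qed.

Lemma lp_join K L x y z n m :
  lpath K x y n -> lpath L y z m ->
  (forall w, w \in K -> w \in L -> w = y) ->
  lpath (K :|: L) x z (n + m).
Proof.
move=> xy; case: m => [|m] yz dis.
  move/lp_eq0: (yz) => /esym; rewrite eqxx => /eqP <-; rewrite addn0.
  by apply: lp_sub xy _ => w; rewrite inE => ->.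
case/lp_step: yz => y' [eyy' _ _ y'z]; rewrite addnS.
apply: lp_sub (lp_cat xy eyy' y'z _) _.
- by move=> w wK; rewrite in_setD1 => /andP[/eqP wy /(dis _ wK)].
by move=> w; rewrite !inE => /orP[->//|/andP[_ ->]]; rewrite orbT.
Qed.

Lemma lp_sym K x y n : lpath K x y n -> lpath K y x n.
Proof.
elim: n K x => [|n IH] K x.
  move=> P; move/lp_eq0: (P) => /esym; rewrite eqxx => /eqP <-.
  by apply: lp0; apply: lp_fst P.
move=> P; have xK := lp_fst P; case/lp_step: P => x' [exx' _ _ /IH P].
rewrite eC in exx'.
rewrite -(addn0 n); apply: lp_sub (lp_cat P exx' (@lp0 [set x] x _) _) _.
- by rewrite inE.
- by move=> w; rewrite !inE => /andP[/negP].
by move=> w; rewrite !inE => /orP[/andP[]//|/eqP->].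
Qed.

Lemma lp_snoc K x y z n :
  lpath K x y n -> e y z -> z \notin K -> lpath (z |: K) x z n.+1.
Proof.
by move=> P eyz zK; apply: lp_sym; apply: lp_cons (lp_sym P) => //; rewrite eC.
Qed.

(** Cut the path at its first vertex in [A]: the initial piece meets [A] only in its end [a].
    [lp_exit] is the mirror image, starting from the last such vertex. *)
Lemma lp_hit A K y x n : lpath K y x n -> x \in A ->
  exists a m, [/\ a \in A, a \in K, m <= n & lpath (a |: (K :\: A)) y a m].
Proof.
elim: n K y => [|n IH] K y P xA; case: (boolP (y \in A)) => yA.
- by exists y, 0; split=> //; [apply: lp_fst P|apply: lp0; rewrite !inE eqxx].
- move/lp_eq0: (P) => /esym; rewrite eqxx => /eqP yx.
  by rewrite yx xA in yA.
- by exists y, 0; split=> //; [apply: lp_fst P|apply: lp0; rewrite !inE eqxx].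
have yK := lp_fst P; case/lp_step: P => y' [eyy' _ _ P].
case: (IH _ _ P xA) => a [m [aA aK mn Pa]]; exists a, m.+1; split=> //.
  by move: aK; rewrite inE => /andP[].
apply: lp_sub (lp_cons eyy' _ Pa) _.
  rewrite !inE eqxx /= andbF orbF; apply: contraNneq yA => ->; exact: aA.
move=> w; rewrite !inE => /or3P[/eqP->|->//|/and3P[-> _ ->]]; last by rewrite orbT.
by rewrite yA yK orbT.
Qed.

Lemma lp_exit A K x y n : lpath K x y n -> x \in A ->
  exists a m, [/\ a \in A, a \in K, m <= n & lpath (a |: (K :\: A)) a y m].
Proof.
move=> /lp_sym P /(lp_hit P)[a [m [aA aK mn Pa]]].
by exists a, m; split=> //; apply: lp_sym.
Qed.

Lemma lp_cycle K x y n : lpath K x y n -> e y x -> 1 < n ->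
  exists s, [/\ uniq s, size s = n.+1 & cycle e s].
Proof.
case=> p [pp lp up sp _] eyx n1; exists (x :: p); split=> //=; first by rewrite sp.
by rewrite rcons_path pp lp.
Qed.

Definition conn K := forall x y, x \in K -> y \in K -> exists n, lpath K x y n.

(** Locked so that rewriting with [inE] does not open the set; only the lemmas below unlock it. *)
Definition component K x : {set T} :=
  locked [set y in K | connect [rel u v | [&& u \in K, v \in K & e u v]] x y].

Lemma component_sub K x y : y \in component K x -> y \in K.
Proof. by rewrite /component -lock inE => /andP[]. Qed.

Lemma component_id K x : x \in K -> x \in component K x.
Proof. by move=> xK; rewrite /component -lock inE xK connect0. Qed.

Lemma component_closed K x y z : y \in component K x -> z \in K -> e y z -> z \in component K x.
Proof.
rewrite /component -lock !inE => /andP[yK xy] zK eyz; rewrite zK /=.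
by apply: connect_trans xy (connect1 _); rewrite /= yK zK.
Qed.

Lemma component_conn K x : conn (component K x).
Proof.
set r := [rel u v | [&& u \in K, v \in K & e u v]].
have rs : connect_sym r.
  by apply: sym_connect_sym => u v /=; rewrite eC; case: (u \in K); case: (v \in K).
move=> y z yK zK.
have: connect r y z.
  move: yK zK; rewrite /component -lock !inE -/r => /andP[_ xy] /andP[_ xz].
  by apply: connect_trans xz; rewrite rs.
case/connectP => p0 pp0 lz; case: (shortenP pp0) lz => p pp up _ lz.
exists (size p), p; split=> //.
- by apply: sub_path pp => u v /= /and3P[].
elim: p y yK pp {up lz pp0} => [|u p IH] y yK /=.
  by move=> _ w; rewrite inE => /eqP->.
case/andP=> /and3P[_ uK eyu] pp w; rewrite inE => /orP[/eqP->//|].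
by apply: IH pp w; apply: component_closed yK uK eyu.
Qed.

Lemma conn_closed K Z z : conn K -> z \in Z -> {subset Z <= K} ->
  (forall y w, y \in Z -> w \in K -> e y w -> w \in Z) -> Z = K.
Proof.
move=> cK zZ ZK cl; apply/setP => w; apply/idP/idP => [/ZK//|wK].
case: (cK w z wK (ZK _ zZ)) => n P.
case: (lp_exit (lp_sym P) zZ) => a [m [aZ aK _ Pa]].
case: m Pa => [|m] Pa; first by move/lp_eq0: (Pa) => /esym; rewrite eqxx => /eqP <-.
case/lp_step: Pa => b [eab]; rewrite !inE => /orP[/eqP->|/andP[bZ bK] _ _]; first by rewrite eqxx.
by rewrite (cl _ _ aZ bK eab) in bZ.
Qed.

(** The vertex at which a path leaves [A] for good is not known in advance; callers treat the
    possible [a] one by one or by symmetry. *)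
Lemma conn_exit K A a0 y : conn K -> a0 \in A -> a0 \in K -> y \in K ->
  exists a m, [/\ a \in A, a \in K & lpath (a |: (K :\: A)) a y m].
Proof.
move=> cK aA aK yK; case: (cK _ _ aK yK) => n P.
by case: (lp_exit P aA) => a [m [? ? _ ?]]; exists a, m.
Qed.

End Paths.

(** * Branches *)

Section Critical.
Variables (T : finType) (e : rel T).
Hypothesis eC : symmetric e.
Hypothesis eI : irreflexive e.
Implicit Types (K L M A Z X Y N Q : {set T}).
Local Notation lpath := (lpath e).
Local Notation conn := (conn e).
Local Notation component := (component e).

Definition deg x := #|[set y | e x y]|.
Definition nb X u := [exists x in X, e u x].

Lemma nbP X u : reflect (exists2 x, x \in X & e u x) (nb X u).
Proof.
by apply: (iffP existsP) => [[x /andP[]]|[x xX eux]]; exists x => //; rewrite xX.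
Qed.

Lemma adj_neq x y : e x y -> x != y.
Proof. by apply: contraTneq => ->; rewrite eI. Qed.

Lemma deg2_nb u a b c : deg u = 2 -> e u a -> e u b -> a != b -> e u c ->
  c = a \/ c = b.
Proof.
move=> d2 ua ub ab uc.
suff: c \in [set a; b] by rewrite !inE => /orP[]/eqP; [left|right].
suff -> : [set a; b] = [set y | e u y] by rewrite inE.
apply/eqP; rewrite eqEcard -/(deg u) d2 cards2 ab andbT.
by apply/subsetP => w; rewrite !inE => /orP[]/eqP->.
Qed.

Lemma deg2_only u a b : e u a -> e u b -> a != b ->
  (forall c, e u c -> c = a \/ c = b) -> deg u = 2.
Proof.
move=> ua ub ab H; rewrite /deg; suff -> : [set y | e u y] = [set a; b] by rewrite cards2 ab.
apply/setP => w; rewrite !inE; apply/idP/idP; first by case/H => ->; rewrite eqxx ?orbT.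
by case/orP => /eqP->.
Qed.

Lemma deg_gt1 u a : 1 < deg u -> exists2 b, e u b & b != a.
Proof.
case/card_gt1P => x [y]; rewrite !inE => -[ux uy xy].
by case: (eqVneq x a) => [xa|]; [exists y; rewrite // -xa eq_sym|exists x].
Qed.

Lemma deg_gt2 u a b : 2 < deg u -> exists c, [/\ e u c, c != a & c != b].
Proof.
case/card_gt2P => x [y [z [[]]]]; rewrite !inE => ux uy uz [xy yz zx].
case: (eqVneq x a) (eqVneq x b) => [xa|xa] [xb|xb]; last by exists x.
- by exists y; rewrite -xa -xb eq_sym xy.
- case: (eqVneq y b) => [yb|yb]; last by exists y; rewrite uy yb -xa eq_sym xy.
  by exists z; rewrite uz -yb -xa zx eq_sym yz.
case: (eqVneq y a) => [ya|ya]; last by exists y; rewrite uy ya -xb eq_sym xy.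
by exists z; rewrite uz -ya -xb zx eq_sym yz.
Qed.

Definition onenb K X := forall u x x',
  u \in K -> x \in X -> x' \in X -> e u x -> e u x' -> x = x'.

(** Rules out the path [x - u - s - u' - x'] with [u], [u'] of degree 2. The two approaches
    [x - u - s] and [x' - u' - s] have the same length, so comparing lengths alone cannot exclude
    it. *)
Definition hubfree K X := forall u u' s x x',
  u \in K -> u' \in K -> s \in K -> u != u' -> deg u = 2 -> deg u' = 2 ->
  e u s -> e u' s -> x \in X -> x' \in X -> e u x -> e u' x' -> x != x' -> False.

Definition const K X Y := forall u v n u' v' n',
  nb X u -> nb Y v -> lpath K u v n ->
  nb X u' -> nb Y v' -> lpath K u' v' n' -> n = n' %[mod 3].

Variable S : {set T}.
Hypothesis supp : forall x y, e x y -> x \in S.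
Hypothesis good : forall s, uniq s -> 2 < size s -> cycle e s -> size s %% 3 <> 1.
Hypothesis deg_ge2 : forall x, x \in S -> 1 < deg x.
Hypothesis nadj2 : forall x y, e x y -> deg x = 2 -> deg y = 2 -> False.
(** Absence of cut vertices as an absorption statement: a nonempty part of [S] that hangs on [z]
    alone is already everything but [z]. *)
Hypothesis cut : forall K z u, u \in K -> {subset K <= S} -> z \notin K ->
  (forall u v, u \in K -> e u v -> v \notin K -> v = z) -> {subset S <= z |: K}.

Lemma lp_good K x y n : lpath K x y n -> e y x -> 1 < n -> n.+1 %% 3 <> 1.
Proof.
move=> P yx n1; case: (lp_cycle P yx n1) => s [us ss cs].
by rewrite -ss; apply: good => //; rewrite ss.
Qed.

Lemma noC4 a b c d : e a b -> e b c -> e c d -> e d a -> a != c -> b != d -> False.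
Proof.
move=> ab bc cd da ac bd; apply: (@good [:: a; b; c; d]) => //=; last by rewrite ab bc cd da.
rewrite !inE !negb_or ac bd (adj_neq ab) (adj_neq bc) (adj_neq cd) /=.
by rewrite eq_sym (adj_neq da).
Qed.

(** Leave the component together with [s] for the last time: the exit is [s], because the component
    contains all neighbours in [K] of its vertices other than [s]. *)
Lemma around K s u v0 : conn K -> s \in K -> v0 \in K ->
  v0 \notin component (K :\ s) u -> exists m, lpath (K :\: component (K :\ s) u) s v0 m.
Proof.
set Z := component _ _ => cK sK vK vZ.
have sZ : s \notin Z by apply/negP => /component_sub; rewrite !inE eqxx.
case: (@conn_exit _ e eC K (s |: Z) s v0) => // [|a [m []]]; first by rewrite !inE eqxx.
rewrite in_setU1 => /orP[/eqP->|aZ] aK P.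
  exists m; apply: lp_sub P _ => w; rewrite !inE negb_or => /orP[/eqP->|/andP[/andP[_ ->] ->//]].
  by rewrite sK sZ.
case: m P => [|m] P.
  by move/lp_eq0: P => /esym; rewrite eqxx => /eqP av; rewrite -av aZ in vZ.
case/lp_step: P => b [eab]; rewrite in_setU1 => /orP[->//|].
rewrite !inE negb_or => /andP[/andP[bs bZ] bK] _ _.
by case/negP: bZ; apply: component_closed aZ _ eab; rewrite !inE bs.
Qed.

(** A path to [v0] from one of the two that avoids the other can be prolonged by the edge between
    them, and [m], [m + 1] differ modulo 3. *)
Lemma indep K X Y u1 u2 v0 : conn K -> const K X Y -> v0 \in K -> nb Y v0 ->
  u1 \in K -> u2 \in K -> nb X u1 -> nb X u2 -> e u1 u2 -> False.
Proof.
move=> cK cst vK vY u1K u2K u1X u2X e12.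
wlog: u1 u2 u1K u2K u1X u2X e12 / exists m, lpath (u1 |: (K :\: [set u1; u2])) u1 v0 m.
  move=> H; case: (@conn_exit _ e eC K [set u1; u2] u1 v0) => //.
    by rewrite !inE eqxx.
  move=> a [m []]; rewrite in_set2 => /orP[]/eqP-> _ P.
    by apply: (H u1 u2 _ _ _ _ _ (ex_intro _ m P)).
  have e21 : e u2 u1 by rewrite eC.
  by rewrite (setUC [set u1]) in P; apply: (H u2 u1 _ _ _ _ _ (ex_intro _ m P)).
case=> m P; rewrite eC in e12; have n12 := adj_neq e12.
have P2 := lp_cons e12 _ P.
have {}P2 : lpath K u2 v0 m.+1.
  apply: lp_sub (P2 _) _; first by rewrite !inE (negbTE n12) eqxx orbT.
  by move=> w; rewrite !inE => /or3P[/eqP->|/eqP->|/andP[]].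
have {}P : lpath K u1 v0 m.
  by apply: lp_sub P _ => w; rewrite !inE => /orP[/eqP->|/andP[]].
have := cst _ _ _ _ _ _ u1X vY P u2X vY P2; clear; lia.
Qed.

(* The two arms [u1], [u2] of [s] give [X]-paths to [u1] whose lengths differ by 2. *)
Lemma two_arms K X Y s u1 u2 v0 : const K X Y -> s \in K ->
  u1 \in K -> u2 \in K -> nb X u1 -> nb X u2 -> e u1 s -> e u2 s -> u1 != u2 ->
  v0 \in component (K :\ s) u1 -> nb Y v0 -> False.
Proof.
move=> cst sK u1K u2K u1X u2X e1 e2 n12 v0Z v0Y.
set Z := component _ _ in v0Z.
have ZK : {subset Z <= K} by move=> w /component_sub; rewrite !inE => /andP[].
have sZ : s \notin Z by apply/negP => /component_sub; rewrite !inE eqxx.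
have key a b : a \in K -> b \in K -> nb X a -> nb X b -> e a s -> e b s -> a != b ->
    forall m, lpath (a |: (Z :\: [set a; b])) a v0 m -> False.
  move=> aK bK aX bX ea eb ab m P.
  have sa := adj_neq ea; have sb := adj_neq eb.
  have esa : e s a by rewrite eC.
  have P2 := lp_cons esa _ P.
  have {}P2 := lp_cons eb _ (P2 _).
  have {}P2 : lpath K b v0 m.+2.
    apply: lp_sub (P2 _ _) _.
    - by memg.
    - by memg.
    by sets.
  have {}P : lpath K a v0 m.
    by apply: lp_sub P _; sets.
  have := cst _ _ _ _ _ _ aX v0Y P bX v0Y P2; clear; lia.
case: (@conn_exit _ e eC Z [set u1; u2] u1 v0) => //.
- exact: component_conn.
- by rewrite !inE eqxx.
- by apply: component_id; rewrite !inE u1K (adj_neq e1).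
move=> a [m []]; rewrite in_set2 => /orP[]/eqP-> _ P; first exact: (key u1 u2 _ _ _ _ _ _ _ m).
rewrite eq_sym in n12; rewrite (setUC [set u1]) in P.
exact: (key u2 u1 _ _ _ _ _ _ _ m).
Qed.

(* Along [n - u - s - u' - n'] the two [X]-paths ending in [n] differ by 4 in length. *)
Lemma long_arms K X Y n u s u' n' v0 : const K X Y ->
  (forall w, w \in K -> w \in Y -> False) ->
  {subset [:: n; u; s; u'; n'] <= K} -> uniq [:: n; u; s; u'; n'] ->
  nb X n -> nb X n' -> e n u -> e u s -> e s u' -> e u' n' ->
  deg u = 2 -> deg u' = 2 ->
  v0 \in component (K :\ s) n -> nb Y v0 -> False.
Proof.
move=> cst dKY sub un nX n'X nu us su' u'n' du du' v0Z v0Y.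
set Z := component _ _ in v0Z.
have ZK : {subset Z <= K} by move=> w /component_sub; rewrite !inE => /andP[].
have sZ : s \notin Z by apply/negP => /component_sub; rewrite !inE eqxx.
have nK : n \in K by apply: sub; rewrite !inE eqxx.
have uK : u \in K by apply: sub; rewrite !inE eqxx ?orbT.
have sK : s \in K by apply: sub; rewrite !inE eqxx ?orbT.
have u'K : u' \in K by apply: sub; rewrite !inE eqxx ?orbT.
have n'K : n' \in K by apply: sub; rewrite !inE eqxx ?orbT.
move: un; rewrite /= !inE !negb_or => /and5P[/and4P[h1 h2 h3 h4] /and3P[h5 h6 h7] /andP[h8 h9] h10 _].
have key a b c d : a \in K -> b \in K -> c \in K -> d \in K -> nb X a -> nb X d ->
    e a b -> e b s -> e s c -> e c d -> a != b -> a != s -> a != c -> a != d -> b != s ->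
    b != c -> b != d -> c != s -> d != s -> c != d ->
    forall m, lpath (a |: (Z :\: [set a; b; c; d])) a v0 m -> False.
  move=> aK bK cK dK aX dX ab bs sc cd n1 n2 n3 n4 n5 n6 n7 n8 n9 n10 m P.
  have ba : e b a by rewrite eC.
  have sb : e s b by rewrite eC.
  have cs : e c s by rewrite eC.
  have dc : e d c by rewrite eC.
  have P1 := lp_cons ba _ P; have {}P1 := lp_cons sb _ (P1 _).
  have {}P1 := lp_cons cs _ (P1 _ _); have {}P1 := lp_cons dc _ (P1 _ _ _).
  have {}P1 : lpath K d v0 m.+4 by apply: lp_sub (P1 _ _ _ _) _; [memg|memg|memg|memg|sets].
  have {}P : lpath K a v0 m by apply: lp_sub P _; sets.
  have := cst _ _ _ _ _ _ aX v0Y P dX v0Y P1; clear; lia.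
(* A path cannot start at the degree 2 vertex [b]: its neighbours [a] and [s] are both barred, and
   neither lies in [Y]. *)
have dead a b c d m : e b a -> e b s -> deg b = 2 -> a != s -> a \in K ->
    lpath (b |: (Z :\: [set a; b; c; d])) b v0 m -> False.
  move=> ba bs db as_ aK P; case: m P => [|m] P.
    move/lp_eq0: P => /esym; rewrite eqxx => /eqP bv.
    case/nbP: v0Y => y yY; rewrite -bv => by_.
    by case: (deg2_nb db ba bs as_ by_) => yE; apply: (dKY y) => //; rewrite yE.
  have ba_ := adj_neq ba; have bs_ := adj_neq bs.
  case/lp_step: P => w [bw wA wb _]; move: wA.
  by case: (deg2_nb db ba bs as_ bw) => ->; memg.
have A2 : [set n'; u'; u; n] = [set n; u; u'; n'].
  by apply/setP => w; rewrite !inE; case: (w == n); case: (w == u); case: (w == u'); case: (w == n').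
case: (@conn_exit _ e eC Z [set n; u; u'; n'] n v0) => //.
- exact: component_conn.
- by rewrite !inE eqxx.
- by apply: component_id; rewrite !inE nK h2.
have un : e u n by rewrite eC.
have s'u : e u' s by rewrite eC.
have n'u' : e n' u' by rewrite eC.
move=> a [m []]; rewrite !inE -!orbA => /or4P[]/eqP-> _ P.
- by apply: (key n u u' n' _ _ _ _ _ _ _ _ _ _ _ _ _ _ _ _ _ _ _ _ m) => //; rewrite eq_sym.
- by apply: (dead n u u' n' m).
- by rewrite -A2 in P; apply: (dead n' u' u n m) => //; rewrite eq_sym.
rewrite -A2 in P.
by apply: (key n' u' u n _ _ _ _ _ _ _ _ _ _ _ _ _ _ _ _ _ _ _ _ m) => //; rewrite ?(eC s) // eq_sym.
Qed.

Record branch K X Y : Prop := Branch {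
  br_conn : conn K;
  br_sub : {subset K <= S};
  br_dX : forall w, w \in K -> w \in X -> False;
  br_dY : forall w, w \in K -> w \in Y -> False;
  br_closed : forall u w, u \in K -> e u w -> w \notin K -> w \in X \/ w \in Y;
  br_attX : exists2 u, u \in K & nb X u;
  br_attY : exists2 u, u \in K & nb Y u;
  br_const : const K X Y }.

(** By [around], all paths through this component to [s] continue along one fixed path to a vertex
    that sees [Y], so constancy is inherited from [K]. *)
Lemma dead_branch K X Y s u : branch K X Y -> s \in K -> u \in K -> u != s ->
  (forall v, v \in component (K :\ s) u -> ~~ nb Y v) ->
  (exists2 v, v \in component (K :\ s) u & nb X v) ->
  (exists2 v, v \in component (K :\ s) u & e v s) ->
  branch (component (K :\ s) u) X [set s].
Proof.
move=> B sK uK us dead [n nZ nX] [v vZ vs].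
set Z := component _ _ in dead nZ vZ *.
have ZK : {subset Z <= K} by move=> w /component_sub; rewrite !inE => /andP[].
have sZ : s \notin Z by apply/negP => /component_sub; rewrite !inE eqxx.
split.
- exact: component_conn.
- by move=> w /ZK /(br_sub B).
- by move=> w /ZK /(br_dX B).
- by move=> w wZ; rewrite inE => /eqP ws; rewrite ws (negbTE sZ) in wZ.
- move=> a w aZ aw wZ; case: (eqVneq w s) => [->|ws]; first by right; rewrite inE.
  case: (boolP (w \in K)) => wK.
    by case/negP: wZ; apply: component_closed aZ _ aw; rewrite !inE ws.
  case: (br_closed B (ZK _ aZ) aw wK) => [|wY]; first by left.
  by have := dead a aZ; case/negP; apply/nbP; exists w.
- by exists n.
- by exists v => //; apply/nbP; exists s; rewrite ?inE.
case: (br_attY B) => v0 v0K v0Y.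
have v0Z : v0 \notin Z by apply: contraL v0Y => /dead.
case: (around (br_conn B) sK v0K v0Z) => k Pk.
have ext a b i : nb X a -> nb [set s] b -> lpath Z a b i -> lpath K a v0 (i + k).+1.
  move=> aX /nbP[s']; rewrite inE => /eqP-> bs P.
  by apply: lp_sub (lp_cat P bs Pk _) _; [move=> w wZ; memg|sets].
move=> a b i a' b' i' aX bs P a'X b's P'.
have := br_const B aX v0Y (ext _ _ _ aX bs P) a'X v0Y (ext _ _ _ a'X b's P'); clear; lia.
Qed.

Lemma onenb_sub K L X : {subset L <= K} -> onenb K X -> onenb L X.
Proof. by move=> LK o u x x' /LK; apply: o. Qed.

Lemma hubfree_sub K L X : {subset L <= K} -> hubfree K X -> hubfree L X.
Proof. by move=> LK h u u' s x x' /LK uK /LK u'K /LK sK; apply: h. Qed.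

Lemma onenb1 K s : onenb K [set s].
Proof. by move=> u x x' _; rewrite !inE => /eqP-> /eqP->. Qed.

Lemma hubfree1 K s : hubfree K [set s].
Proof.
move=> u u' t x x' _ _ _ _ _ _ _ _; rewrite !inE => /eqP-> /eqP-> _ _.
by rewrite eqxx.
Qed.

Lemma card_lt m K L w : #|K| <= m.+1 -> {subset L <= K} -> w \in K -> w \notin L -> #|L| <= m.
Proof.
move=> Km LK wK wL; rewrite -ltnS; apply: leq_trans Km; apply: proper_card.
by apply/properP; split; [apply/subsetP|exists w].
Qed.

(* A component [Q] of [K :\: N] that meets [Y] is a branch between [N] and [Y]; otherwise it is a
   branch between one vertex of [N] that leads on to [Y] and its other neighbours in [N]. *)
Lemma layer_single K X Y N q :
  (forall Q X' Y', #|Q| < #|K| -> branch Q X' Y' -> onenb Q X' -> onenb Q Y' ->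
    hubfree Q X' -> hubfree Q Y' -> exists v, Q = [set v]) ->
  branch K X Y -> (forall w, (w \in N) = (w \in K) && nb X w) ->
  onenb (K :\: N) N -> hubfree (K :\: N) N -> onenb K Y -> hubfree K Y ->
  q \in K -> q \notin N -> component (K :\: N) q = [set q] /\ nb Y q.
Proof.
move=> IH B NE oN claim4 oY hY.
have cnK := br_conn B; case: (br_attY B) => v0 v0K v0Y.
have NK : {subset N <= K} by move=> w; rewrite NE => /andP[].
have NX w : w \in N -> nb X w by rewrite NE => /andP[].
have claim3 s u1 u2 : s \in K -> s \notin N -> u1 \in N -> u2 \in N ->
    e u1 s -> e u2 s -> u1 != u2 -> False.
  move=> sK sN u1N u2N e1 e2 /eqP[]; apply: (oN s) => //; rewrite 1?eC // in_setD sN.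
  exact: sK.
move=> qK qN; set Q := component _ _.
have qQ : q \in Q by apply: component_id; rewrite in_setD qN.
have QK : {subset Q <= K} by move=> w /component_sub; rewrite in_setD => /andP[].
have QN w : w \in Q -> w \notin N by move/component_sub; rewrite in_setD => /andP[].
have Qcl a w : a \in Q -> e a w -> w \notin Q -> w \in N \/ w \in Y.
  move=> aQ aw wQ; case: (boolP (w \in K)) => wK.
    left; apply: contraR wQ => wN; apply: component_closed aQ _ aw.
    by rewrite in_setD wN.
  case: (br_closed B (QK _ aQ) aw wK) => [wX|]; last by right.
  have /negP[] := QN _ aQ; rewrite NE (QK _ aQ); apply/nbP; by exists w.
have [n0 n0N] : exists n0, n0 \in N.
  by case: (br_attX B) => u uK uX; exists u; rewrite NE uK.
have n0Q : n0 \notin Q by apply/negP => /QN; rewrite n0N.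
have Qm : #|Q| < #|K| by apply: proper_card; apply/properP; split; [apply/subsetP|exists n0; rewrite ?NK].
case: (boolP [exists v in Q, nb Y v]) => [/existsP[y /andP[yQ yY]]|dead].
  have BQ : branch Q N Y.
    split.
    - exact: component_conn.
    - by move=> w /QK /(br_sub B).
    - by move=> w /QN /negbTE->.
    - by move=> w /QK /(br_dY B).
    - exact: Qcl.
    - case: (@conn_exit _ e eC K Q q n0) => //; first exact: NK.
      move=> a [[|k] [aQ _ P]].
        by move/lp_eq0: P => /esym; rewrite eqxx => /eqP an; rewrite -an aQ in n0Q.
      case/lp_step: P => b [ab]; rewrite in_setU1 in_setD => bA bna _.
      rewrite (negbTE bna) /= in bA; case/andP: bA => bQ bK.
      exists a => //; apply/nbP; exists b => //.
      by case: (Qcl _ _ aQ ab bQ) => // /(br_dY B bK).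
    - by exists y.
    have ext a b i : nb N a -> lpath Q a b i -> exists2 n, nb X n & lpath K n b i.+1.
      case/nbP => n nN an P; exists n; first exact: NX.
      have nQ : n \notin Q by apply/negP => /QN; rewrite nN.
      have nK := NK _ nN; rewrite eC in an.
      by apply: lp_sub (lp_cons an nQ P) _; sets.
    move=> a b i a' b' i' aN bY P a'N b'Y P'.
    case: (ext _ _ _ aN P) => n nX nP; case: (ext _ _ _ a'N P') => n' n'X n'P.
    have := br_const B nX bY nP n'X b'Y n'P; clear; lia.
  case: (IH _ _ _ Qm BQ).
  - move=> u x x' uQ xN x'N ux ux'; apply/eqP; apply: contraT => xx'.
    by case: (claim3 u x x') => //; rewrite 1?eC ?QK ?QN.
  - exact: onenb_sub oY.
  - by apply: hubfree_sub claim4 => w wQ; rewrite in_setD QN ?QK.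
  - exact: hubfree_sub hY.
  move=> t Qt; move: qQ yQ; rewrite Qt !inE => /eqP-> /eqP E.
  by rewrite -E.
have {}dead w : w \in Q -> ~~ nb Y w.
  by move=> wQ; apply: contra dead => wY; apply/existsP; exists w; rewrite wQ.
have {}Qcl a w : a \in Q -> e a w -> w \notin Q -> w \in N.
  move=> aQ aw /(Qcl _ _ aQ aw)[//|wY].
  by have /negP[] := dead _ aQ; apply/nbP; exists w.
pose B0 := [set n in N | nb Q n].
have B0E w : (w \in B0) = (w \in N) && nb Q w by rewrite inE.
clearbody B0.
have B0N : {subset B0 <= N} by move=> w; rewrite B0E => /andP[].
have QB0 a w : a \in Q -> e a w -> w \notin Q -> w \in B0.
  move=> aQ aw wQ; rewrite B0E (Qcl a w) //; apply/nbP; exists a => //; by rewrite eC.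
case: (@conn_exit _ e eC K (Q :|: B0) q v0) => //; first by rewrite !inE qQ.
move=> n1 [k0 [n1A n1K P0]].
have n1B : n1 \in B0.
  move: n1A; rewrite in_setU => /orP[aQ|//]; case: k0 P0 => [|k0] P0.
    by move/lp_eq0: P0 => /esym; rewrite eqxx => /eqP an; have := dead _ aQ; rewrite an v0Y.
  case/lp_step: P0 => b [ab]; rewrite in_setU1 in_setD in_setU negb_or => bA bna _.
  rewrite (negbTE bna) /= in bA; case/andP: bA => /andP[bQ bB] bK.
  by rewrite (QB0 n1 b) in bB.
(* If [n1] were the only attachment of [Q], it would separate [Q] from [X], against [cut]. *)
have [n2 n2B n21] : exists2 n2, n2 \in B0 & n2 != n1.
  apply/exists_inP; apply: contraT => no.
  have n1Q : n1 \notin Q by apply/negP => /QN; rewrite B0N.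
  have /cut : {subset Q <= S} by move=> w /QK /(br_sub B).
  move=> /(_ n1 q qQ n1Q) SQ.
  case: (br_attX B) => u uK /nbP[x xX ux].
  have xS : x \in S by rewrite eC in ux; apply: supp ux.
  have: x \in n1 |: Q.
    apply: SQ xS => a w aQ aw wQ; apply/eqP; apply: contraNT no => wn.
    by apply/exists_inP; exists w => //; apply: QB0 aQ aw wQ.
  rewrite in_setU1 => /orP[/eqP xn|/QK xK]; last by case: (br_dX B xK).
  by case: (br_dX B _ xX); rewrite xn.
have BQ : branch Q (B0 :\ n1) [set n1].
  split.
  - exact: component_conn.
  - by move=> w /QK /(br_sub B).
  - by move=> w /QN /negP wN; rewrite in_setD1 => /andP[_ /B0N].
  - by move=> w /QN /negP wN; rewrite inE => /eqP wn; apply: wN; rewrite wn B0N.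
  - move=> a w aQ aw wQ; have wB := QB0 _ _ aQ aw wQ.
    by case: (eqVneq w n1) => [->|wn]; [right; rewrite inE|left; rewrite in_setD1 wn].
  - move: (n2B); rewrite B0E => /andP[_ /nbP[a aQ n2a]]; exists a => //.
    by apply/nbP; exists n2; rewrite ?in_setD1 ?n21 // eC.
  - move: (n1B); rewrite B0E => /andP[_ /nbP[a aQ n1a]]; exists a => //.
    by apply/nbP; exists n1; rewrite ?inE // eC.
  (* Paths in [Q] towards [n1] all continue along [P0] to the same [v0], where [br_const] of [K]
     compares them. *)
  have ext a b i : nb (B0 :\ n1) a -> nb [set n1] b -> lpath Q a b i ->
      exists2 n, nb X n & lpath K n v0 (i.+1 + k0).+1.
    case/nbP => n; rewrite in_setD1 => /andP[nn1 nB] an /nbP[t]; rewrite inE => /eqP-> bn1 P.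
    have nN := B0N _ nB; exists n; first exact: NX.
    have nQ : n \notin Q by apply/negP => /QN; rewrite nN.
    have nK := NK _ nN; rewrite eC in an.
    apply: lp_sub (lp_cat (lp_cons an nQ P) bn1 P0 _) _.
      have n1Q : n1 \notin Q by apply/negP => /QN; rewrite B0N.
      move=> w; rewrite in_setU1 in_setU1 in_setD in_setU => /orP[/eqP->|wQ].
        by rewrite (negbTE nn1) nB orbT.
      by rewrite wQ /= orbF => /eqP wn; rewrite -wn wQ in n1Q.
    move=> w; rewrite in_setU !in_setU1 in_setD => H; splith; memg.
  move=> a b i a' b' i' aN bY P a'N b'Y P'.
  case: (ext _ _ _ aN bY P) => n nX nP; case: (ext _ _ _ a'N b'Y P') => n' n'X n'P.
  have := br_const B nX v0Y nP n'X v0Y n'P; clear; lia.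
case: (IH _ _ _ Qm BQ).
- move=> u x x' uQ; rewrite !in_setD1 => /andP[_ /B0N xN] /andP[_ /B0N x'N] ux ux'.
  apply/eqP; apply: contraT => xx'.
  by case: (claim3 u x x') => //; rewrite 1?eC ?QK ?QN.
- exact: onenb1.
- move=> a b c x x' aQ bQ cQ; rewrite !in_setD1 => ab da db ac bc /andP[_ /B0N xN] /andP[_ /B0N x'N].
  by apply: (claim4 a b c) => //; rewrite in_setD QK ?QN.
- exact: hubfree1.
move=> t Qt.
move: n1B n2B; rewrite !B0E => /andP[n1N /nbP[a aQ n1a]] /andP[n2N /nbP[b bQ n2b]].
move: aQ bQ n1a n2b qQ; rewrite Qt !inE => /eqP-> /eqP-> n1t n2t /eqP qt.
by case: (claim3 t n1 n2); rewrite -?qt // 1?eq_sym // qt.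
Qed.

(** Induction on the size of [K]. The layer [N] next to [X] is independent, and the rest of [K]
    consists of single vertices of degree 2 between [N] and [Y]. The neighbour in [N] of such a
    vertex has degree at least 3, which forces a second one, and the two give a 4-cycle or violate
    [hubfree K Y]. So [K] is [N], connected and independent. *)
Lemma branch_single K X Y : branch K X Y -> onenb K X -> onenb K Y ->
  hubfree K X -> hubfree K Y -> exists v, K = [set v].
Proof.
move: {2}#|K| (leqnn #|K|) => m.
elim: m K X Y => [|m IH] K X Y cK B oX oY hX hY.
  by case: (br_attX B) => u uK; move: cK; rewrite leqn0 cards_eq0 => /eqP K0; rewrite K0 inE in uK.
have cnK := br_conn B; case: (br_attY B) => v0 v0K v0Y.
pose N := [set u in K | nb X u].
have NE w : (w \in N) = (w \in K) && nb X w by rewrite inE.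
clearbody N.
have NK : {subset N <= K} by move=> w; rewrite NE => /andP[].
have NX w : w \in N -> nb X w by rewrite NE => /andP[].
have ind u1 u2 : u1 \in N -> u2 \in N -> e u1 u2 -> False.
  move=> u1N u2N; exact: (indep cnK (br_const B) v0K v0Y (NK _ u1N) (NK _ u2N) (NX _ u1N) (NX _ u2N)).
have claim3 s u1 u2 : s \in K -> s \notin N -> u1 \in N -> u2 \in N ->
    e u1 s -> e u2 s -> u1 != u2 -> False.
  move=> sK sN u1N u2N e1 e2 n12.
  (* If the part of [K] behind [a] meets [Y], [two_arms] applies; otherwise it is a smaller branch
     between [X] and [s], hence just [a], which then has degree 2. *)
  have arm a b : a \in N -> b \in N -> e a s -> e b s -> a != b ->
      deg a = 2 /\ exists2 x, x \in X & e a x.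
    move=> aN bN ea eb ab.
    have aK := NK _ aN; have bK := NK _ bN; have as_ := adj_neq ea.
    have aZ : a \in component (K :\ s) a by apply: component_id; rewrite !inE as_.
    case: (boolP [exists v in component (K :\ s) a, nb Y v]) => [/existsP[v /andP[vZ vY]]|dead].
      by case: (two_arms (br_const B) sK aK bK (NX _ aN) (NX _ bN) ea eb ab vZ vY).
    have {}dead v : v \in component (K :\ s) a -> ~~ nb Y v.
      by move=> vZ; apply: contra dead => vY; apply/existsP; exists v; rewrite vZ.
    have BZ : branch (component (K :\ s) a) X [set s].
      by apply: dead_branch B sK aK as_ dead _ _; exists a; rewrite ?NX.
    have ZK : {subset component (K :\ s) a <= K}.
      by move=> w /component_sub; rewrite !inE => /andP[].
    case: (IH _ _ _ _ BZ).
    - apply: card_lt cK ZK sK _; by apply/negP => /component_sub; rewrite !inE eqxx.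
    - exact: onenb_sub oX.
    - exact: onenb1.
    - exact: hubfree_sub hX.
    - exact: hubfree1.
    move=> v Zv; have va : v = a by move: aZ; rewrite Zv inE => /eqP.
    case/nbP: (NX _ aN) => x xX ax; split; last by exists x.
    apply: (deg2_only ax ea).
      by apply: contraTneq xX => ->; apply/negP => /(br_dX B sK).
    move=> c ac; case: (eqVneq c s) => [->|cs]; first by right.
    left; case: (boolP (c \in K)) => cK'.
      have: c \in component (K :\ s) a by apply: component_closed aZ _ ac; rewrite !inE cs.
      by rewrite Zv va inE => /eqP ca; rewrite ca eI in ac.
    case: (br_closed B aK ac cK') => [cX|cY]; first exact: (oX a).
    by have := dead _ aZ; case/negP; apply/nbP; exists c.
  case: (arm u1 u2) => // d1 [x1 x1X ux1].
  case: (arm u2 u1) => [||||| d2 [x2 x2X ux2]] //; first by rewrite eq_sym.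
  case: (eqVneq x1 x2) => [x12|x12].
    subst x2; apply: (@noC4 u1 s u2 x1) => //; rewrite 1?eC //.
    by apply: contraTneq x1X => <-; apply/negP => /(br_dX B sK).
  by apply: (hX u1 u2 s x1 x2) => //; apply: NK.
(* Either [long_arms] applies, or a smaller branch contains both [n] and [u] although it must be a
   single vertex. *)
have claim4 : hubfree (K :\: N) N.
  move=> u u' s n n'; rewrite !in_setD => /andP[uN uK] /andP[u'N u'K] /andP[sN sK].
  move=> uu' du du' us u's nN n'N un u'n' nn'.
  have nK := NK _ nN; have n'K := NK _ n'N.
  have neq a b : a \in N -> b \notin N -> a != b by move=> aN; apply: contraNneq => <-.
  have nu := neq _ _ nN uN; have nu' := neq _ _ nN u'N; have ns := neq _ _ nN sN.
  have n'u := neq _ _ n'N uN; have n'u' := neq _ _ n'N u'N; have n's := neq _ _ n'N sN.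
  have us_ := adj_neq us; have u's_ := adj_neq u's.
  have nZ : n \in component (K :\ s) n by apply: component_id; rewrite !inE ns.
  have uZ : u \in component (K :\ s) n.
    by apply: component_closed nZ _ _; rewrite ?inE ?us_ // eC.
  case: (boolP [exists v in component (K :\ s) n, nb Y v]) => [/existsP[v /andP[vZ vY]]|dead].
    apply: (long_arms (br_const B) (br_dY B) _ _ (NX _ nN) (NX _ n'N) _ us _ u'n' du du' vZ vY).
    - by sets.
    - by rewrite /= !inE; nq.
    - by rewrite eC.
    - by rewrite eC.
  have {}dead v : v \in component (K :\ s) n -> ~~ nb Y v.
    by move=> vZ; apply: contra dead => vY; apply/existsP; exists v; rewrite vZ.
  have BZ : branch (component (K :\ s) n) X [set s].
    by apply: dead_branch B sK nK ns dead _ _; [exists n; rewrite ?NX|exists u].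
  have ZK : {subset component (K :\ s) n <= K}.
    by move=> w /component_sub; rewrite !inE => /andP[].
  case: (IH _ _ _ _ BZ).
  - apply: card_lt cK ZK sK _; by apply/negP => /component_sub; rewrite !inE eqxx.
  - exact: onenb_sub oX.
  - exact: onenb1.
  - exact: hubfree_sub hX.
  - exact: hubfree1.
  by move=> v Zv; move: nZ uZ nu; rewrite Zv !inE => /eqP-> /eqP->; rewrite eqxx.
case: (boolP [exists v in K, v \notin N]) => [/existsP[v /andP[vK vN]]|all_N]; last first.
  have {}all_N w : w \in K -> w \in N.
    by move=> wK; apply: contraR all_N => wN; apply/existsP; exists w; rewrite wK.
  exists v0; apply/esym; apply: (conn_closed eC (z := v0) cnK); first by rewrite inE.
    by move=> w; rewrite inE => /eqP->.
  move=> y w; rewrite inE => /eqP-> wK yw.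
  by case: (ind v0 w) => //; apply: all_N.
have single q : q \in K -> q \notin N ->
    component (K :\: N) q = [set q] /\ nb Y q.
  apply: (layer_single _ B NE _ claim4 oY hY) => [Q X' Y' Qm|].
    by apply: IH; rewrite -ltnS; apply: leq_trans Qm cK.
  move=> u x x'; rewrite in_setD => /andP[uN uK] xN x'N ux ux'.
  apply/eqP; apply: contraT => xx'.
  by case: (claim3 u x x') => //; rewrite 1?eC.
have dg q : q \in K -> q \notin N -> exists n y, [/\ n \in N, y \in Y, e q n, e q y & deg q = 2].
  move=> qK qN; case: (single q qK qN) => Qq /nbP[y yY qy].
  have cl c : e q c -> c \in N \/ c \in Y.
    move=> qc; case: (boolP (c \in K)) => cK'.
      left; apply: contraT => cN.
      have: c \in component (K :\: N) q.
        by apply: component_closed (component_id _ _) _ qc; rewrite in_setD ?qN ?cN.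
      by rewrite Qq inE => /eqP cq; rewrite cq eI in qc.
    case: (br_closed B qK qc cK') => [cX|]; last by right.
    by case/negP: qN; rewrite NE qK; apply/nbP; exists c.
  case: (@deg_gt1 q y (deg_ge2 (br_sub B qK))) => n qn ny.
  have nN : n \in N.
    by case: (cl _ qn) => // nY; rewrite (oY q n y) ?eqxx in ny.
  exists n, y; split=> //; apply: (deg2_only qn qy ny) => c qc.
  case: (cl _ qc) => [cN|cY]; last by right; apply: (oY q).
  left; apply/eqP; apply: contraT => cn.
  by case: (claim3 q c n) => //; rewrite eC.
case: (dg v vK vN) => n [y [nN yY vn vy dv]].
have nK := NK _ nN; case/nbP: (NX _ nN) => x xX nx.
have nv : e n v by rewrite eC.
have dn : 2 < deg n.
  rewrite ltn_neqAle deg_ge2 ?andbT; last exact: br_sub B _ nK.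
  by apply/eqP => dn; apply: (nadj2 vn dv).
case: (@deg_gt2 n x v dn) => c [nc cx cv].
case: (boolP (c \in K)) => cK'; last first.
  case: (br_closed B nK nc cK') => [cX|cY]; first by rewrite (oX n c x) ?eqxx in cx.
  have P0 : lpath K n n 0 by apply: lp0.
  have nYb : nb Y n by apply/nbP; exists c.
  have vYb : nb Y v by apply/nbP; exists y.
  have P1 : lpath K n v 1.
    have P1 : lpath [set v] v v 0 by apply: lp0; rewrite inE.
    have nv_ := adj_neq nv.
    by apply: lp_sub (lp_cons nv _ P1) _; [memg|sets].
  have := br_const B (NX _ nN) nYb P0 (NX _ nN) vYb P1; clear; lia.
case: (boolP (c \in N)) => cN; first by case: (ind n c).
case: (dg c cK' cN) => n' [y' [n'N y'Y cn' cy' dc]].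
have cn : e c n by rewrite eC.
case: (eqVneq y y') => [yy|yy]; last by case: (hY v c n y y') => //; rewrite eq_sym.
subst y'; case: (@noC4 n v y c) => //; rewrite 1?eC //; last by rewrite eq_sym.
by apply: contraTneq yY => <-; apply/negP => /(br_dY B nK).
Qed.


(** * A shortest cycle of length divisible by 3 *)

Variable s : seq T.
Hypotheses (us : uniq s) (s3 : 2 < size s) (cs : cycle e s) (s0 : size s %% 3 = 0).
Hypothesis smin : forall t, uniq t -> 2 < size t -> cycle e t -> size t %% 3 = 0 ->
  size s <= size t.
Local Notation ell := (size s).

(** The admissible cycle lengths: minimality of [s] forbids the multiples of 3 below [ell]. *)
Definition okl m := m %% 3 <> 1 /\ (m %% 3 = 0 -> ell <= m).

Lemma lp_ok K x y n : lpath K x y n -> e y x -> 1 < n -> okl n.+1.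
Proof.
move=> P yx n1; case: (lp_cycle P yx n1) => t [ut st ct]; rewrite -st; split.
  by apply: good; rewrite ?st.
by move=> t0; apply: smin; rewrite ?st // -st.
Qed.

Variable x0 : T.
Definition cyc i := nth x0 s i.
Local Notation c := cyc.
Definition arc i j : {set T} := [set x in s | i <= index x s <= j].
Definition coarc i j : {set T} := [set x in s | (index x s <= i) || (j <= index x s)].

Lemma cyc_in i : i < ell -> c i \in s.
Proof. exact: mem_nth. Qed.

Lemma index_cyc i : i < ell -> index (c i) s = i.
Proof. by move=> il; rewrite index_uniq. Qed.

Lemma cyc_index x : x \in s -> c (index x s) = x.
Proof. exact: nth_index. Qed.

Lemma cyc_inj i j : i < ell -> j < ell -> c i = c j -> i = j.
Proof. by move=> il jl /eqP; rewrite nth_uniq // => /eqP. Qed.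

Lemma cyc_step i : i.+1 < ell -> e (c i) (c i.+1).
Proof.
rewrite /c; case: s cs => //= x p /(pathP x0) H il.
have := H i; rewrite size_rcons -rcons_cons !nth_rcons /= => /(_ (ltnW il)).
by rewrite !ltnS in il *; rewrite il (ltnW il).
Qed.

Lemma cyc_wrap : e (c ell.-1) (c 0).
Proof.
rewrite /c; case: s cs s3 => //= x p.
by rewrite rcons_path (last_nth x0) => /andP[_].
Qed.

Lemma arc_path i d : i + d < ell -> lpath (arc i (i + d)) (c i) (c (i + d)) d.
Proof.
elim: d => [|d IH] H.
  rewrite addn0 in H *; apply: lp0; by rewrite inE cyc_in //= index_cyc // !leqnn.
rewrite addnS in H *; have {}IH := IH (ltnW H).
apply: lp_sub (lp_snoc eC IH (cyc_step H) _) _.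
  by rewrite inE index_cyc // cyc_in //= ltnn andbF.
move=> w; rewrite !inE => /orP[/eqP->|/and3P[-> -> wd]]; last exact: leqW.
by rewrite cyc_in // index_cyc //; lia.
Qed.

Lemma arcP i j : i <= j -> j < ell -> lpath (arc i j) (c i) (c j) (j - i).
Proof. by move=> ij jl; have := @arc_path i (j - i); rewrite subnKC //; apply. Qed.

Lemma coarcP i j : i < j -> j < ell -> lpath (coarc i j) (c j) (c i) (ell - (j - i)).
Proof.
move=> ij jl.
have l1 : ell.-1 < ell by lia.
have P1 := arcP (i := j) (j := ell.-1) ltac:(lia) l1.
have P2 := arcP (i := 0) (j := i) ltac:(lia) ltac:(lia).
have := lp_cat P1 cyc_wrap P2.
have -> : (ell.-1 - j + (i - 0)).+1 = ell - (j - i) by clear - ij jl; lia.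
move=> H; apply: lp_sub (H _) _.
  by move=> w; rewrite !inE => /and3P[_ ? ?] /and3P[_ _ ?]; lia.
move=> w; rewrite !inE => /orP[/and3P[-> -> _]|/andP[-> /= ->]//].
by rewrite orbT.
Qed.

Definition off K := forall w, w \in K -> w \notin s.

Lemma off_arc K i j w : off K -> w \in arc i j -> w \in K -> False.
Proof. by move=> oK; rewrite inE => /andP[ws _] /oK; rewrite ws. Qed.

Lemma off_coarc K i j w : off K -> w \in coarc i j -> w \in K -> False.
Proof. by move=> oK; rewrite inE => /andP[ws _] /oK; rewrite ws. Qed.

(** The path closes up with either arc between [c i] and [c j]; the 2 counts its edges to the
    cycle. *)
Lemma link_ok K n n' k i j : off K -> lpath K n n' k ->
  e n (c i) -> e n' (c j) -> i < j -> j < ell ->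
  okl (j - i + k + 2) /\ okl (ell - (j - i) + k + 2).
Proof.
move=> oK P ni n'j ij jl; have Pr := lp_sym eC P.
have jn' : e (c j) n' by rewrite eC.
have in_ : e (c i) n by rewrite eC.
split.
  have := lp_cat (arcP (ltnW ij) jl) jn' Pr (fun w => @off_arc K i j w oK).
  by move/lp_ok => /(_ ni); rewrite !addnS addn0; apply; lia.
have := lp_cat (coarcP ij jl) in_ P (fun w => @off_coarc K i j w oK).
by move/lp_ok => /(_ n'j); rewrite !addnS addn0; apply; lia.
Qed.

(** The ends of two disjoint paths alternate on the cycle, so both paths close up with either pair
    of opposite arcs; the 4 counts the edges to the cycle. *)
Lemma cross_ok K K' n1 n2 n3 n4 k k' i1 i2 i3 i4 : off K -> off K' ->
  (forall w, w \in K -> w \in K' -> False) ->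
  lpath K n1 n3 k -> lpath K' n2 n4 k' ->
  e n1 (c i1) -> e n2 (c i2) -> e n3 (c i3) -> e n4 (c i4) ->
  i1 < i2 -> i2 < i3 -> i3 < i4 -> i4 < ell ->
  okl ((i2 - i1) + (i4 - i3) + k + k' + 4) /\
  okl ((i3 - i2) + (ell - (i4 - i1)) + k + k' + 4).
Proof.
move=> oK oK' dis P P' e1 e2 e3 e4 h1 h2 h3 h4.
have Pr := lp_sym eC P; have P'r := lp_sym eC P'.
have f1 : e (c i1) n1 by rewrite eC.
have f2 : e (c i2) n2 by rewrite eC.
have f3 : e (c i3) n3 by rewrite eC.
have f4 : e (c i4) n4 by rewrite eC.
have dis' w : w \in K' -> w \in K -> False by move=> a b; apply: dis b a.
split.
  have A12 := arcP (ltnW h1) (ltn_trans h2 (ltn_trans h3 h4)).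
  have A34 := lp_sym eC (arcP (ltnW h3) h4).
  have Q1 := lp_cat A12 f2 P' (fun w => @off_arc K' i1 i2 w oK').
  have Q2 := lp_cat Q1 e4 A34.
  have Q3 := fun d1 => lp_cat (Q2 d1) f3 Pr.
  have Q4 := fun d1 d2 => lp_ok (Q3 d1 d2) e1.
  have -> : i2 - i1 + (i4 - i3) + k + k' + 4 =
    (((i2 - i1 + k').+1 + (i4 - i3)).+1 + k).+2 by clear; lia.
  apply: Q4; [| |by clear; lia].
  - move=> w; rewrite in_setU => /orP[]; last by move=> wK' /(off_arc oK')/(_ wK').
    by rewrite !inE => /and3P[_ _ a] /and3P[_ b _]; move: a b h2; clear; lia.
  move=> w; rewrite !in_setU => /orP[/orP[]|]; [exact: off_arc|exact: dis'|exact: off_arc].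
have A23 := arcP (ltnW h2) (ltn_trans h3 h4).
have h14 : i1 < i4 := ltn_trans h1 (ltn_trans h2 h3).
have A41 := lp_sym eC (coarcP h14 h4).
have Q1 := lp_cat A23 f3 Pr (fun w => @off_arc K i2 i3 w oK).
have Q2 := lp_cat Q1 e1 A41.
have Q3 := fun d1 => lp_cat (Q2 d1) f4 P'r.
have Q4 := fun d1 d2 => lp_ok (Q3 d1 d2) e2.
have -> : i3 - i2 + (ell - (i4 - i1)) + k + k' + 4 =
   (((i3 - i2 + k).+1 + (ell - (i4 - i1))).+1 + k').+2 by clear; lia.
apply: Q4; [| |by clear; lia].
- move=> w; rewrite in_setU => /orP[]; last by move=> wK /(off_coarc oK)/(_ wK).
  by rewrite !inE => /and3P[_ a b] /andP[_]; move: a b h1 h3; clear; lia.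
move=> w; rewrite !in_setU => /orP[/orP[]|]; [exact: off_arc|exact: dis|exact: off_coarc].
Qed.

Definition col x := index x s %% 3.

(** With [d] the difference of the positions, the two cycles have lengths [k + 2 + d] and
    [k + 2 - d] modulo 3. If 3 does not divide [d], they exclude two residues of [k] and leave 2; if
    it does, they exclude 2. For [x = y] the path closes up at [x] itself. *)
Lemma link_col K n n' k x y : off K -> lpath K n n' k -> x \in s -> y \in s ->
  e n x -> e n' y ->
  [/\ col x != col y -> k %% 3 = 2,
      col x = col y -> x != y -> k %% 3 <> 2
    & x = y -> 0 < k -> k %% 3 <> 2].
Proof.
move=> oK P xs ys nx n'y; rewrite /col.
have il : index x s < ell by rewrite index_mem.
have jl : index y s < ell by rewrite index_mem.
have nx' : e n (c (index x s)) by rewrite cyc_index.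
have n'y' : e n' (c (index y s)) by rewrite cyc_index.
have arith a b k' l : (b - a + k' + 2) %% 3 <> 1 -> (l - (b - a) + k' + 2) %% 3 <> 1 ->
    a < b -> b < l -> l %% 3 = 0 ->
    (a %% 3 != b %% 3 -> k' %% 3 = 2) /\ (a %% 3 = b %% 3 -> k' %% 3 <> 2) by clear; lia.
case: (ltngtP (index x s) (index y s)) => [lt|gt|eq].
- case: (link_ok oK P nx' n'y' lt jl) => -[o1 _] [o2 _].
  have [a1 a2] := arith _ _ _ _ o1 o2 lt jl s0.
  by split=> [|E _|E]; [exact: a1|exact: a2|move: lt; rewrite E ltnn].
- case: (link_ok oK (lp_sym eC P) n'y' nx' gt il) => -[o1 _] [o2 _].
  have [a1 a2] := arith _ _ _ _ o1 o2 gt il s0.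
  split=> [?|/esym ? _|E]; [by apply: a1; rewrite eq_sym|exact: a2|by move: gt; rewrite E ltnn].
have xy : x = y by rewrite -(cyc_index xs) eq cyc_index.
subst y; split; rewrite ?eqxx //; move=> _ k0.
have xK : x \notin K by apply/negP => /oK; rewrite xs.
have xn : e x n by rewrite eC.
have [o1 _] := lp_ok (lp_cons xn xK P) n'y k0.
move: o1; clear; lia.
Qed.

(** A chord makes cycles of lengths [d + 1] and [ell - d + 1] with [d = j - i]. If neither is 1
    modulo 3, one is a multiple of 3, and shorter than [ell] unless the chord is an edge of the
    cycle. *)
Lemma chord_free i j : i < j -> j < ell -> e (c i) (c j) ->
  j = i.+1 \/ (i = 0 /\ j = ell.-1).
Proof.
move=> ij jl eij; have eji : e (c j) (c i) by rewrite eC.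
case: (ltnP 1 (j - i)) => [d1|]; last by move=> H; left; move: ij H; clear; lia.
have [o1 o1'] := lp_ok (arcP (ltnW ij) jl) eji d1.
case: (ltnP 1 (ell - (j - i))) => [d2|]; last by move=> H; right; move: ij jl d1 H; clear; lia.
have [o2 o2'] := lp_ok (coarcP ij jl) eij d2.
move: o1 o1' o2 o2' d1 d2 ij jl s0; clear; lia.
Qed.


Definition class i : {set T} := [set x in s | col x == i].

(** The way in which [onenb] fails towards a colour class. *)
Definition digon i n :=
  exists x x', [/\ x \in class i, x' \in class i, x != x', e n x & e n x'].

Lemma classP i x : x \in class i -> x \in s /\ col x = i.
Proof. by rewrite inE => /andP[-> /eqP]. Qed.

Lemma link_same K n n' k i : off K -> lpath K n n' k ->
  nb (class i) n -> nb (class i) n' -> n != n' -> k %% 3 <> 2.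
Proof.
move=> oK P /nbP[x /classP[xs xi] nx] /nbP[y /classP[ys yi] n'y] nn'.
case: (link_col oK P xs ys nx n'y) => _ H1 H2.
case: (eqVneq x y) => [xy|xy]; last by apply: H1; rewrite // xi yi.
by apply: H2 => //; rewrite lt0n (lp_eq0 P).
Qed.

Lemma link_diff K n n' k i j : off K -> lpath K n n' k ->
  nb (class i) n -> nb (class j) n' -> i != j -> k %% 3 = 2.
Proof.
move=> oK P /nbP[x /classP[xs xi] nx] /nbP[y /classP[ys yi] n'y] ij.
by case: (link_col oK P xs ys nx n'y) => H _ _; apply: H; rewrite xi yi.
Qed.

Lemma sub_off K L : off K -> {subset L <= K} -> off L.
Proof. by move=> oK LK w /LK /oK. Qed.

Lemma path5 a b m c' d : e a b -> e b m -> e m c' -> e c' d ->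
  uniq [:: a; b; m; c'; d] -> lpath [set x in [:: a; b; m; c'; d]] a d 4.
Proof.
move=> ab bm mc cd U; exists [:: b; m; c'; d]; split=> //=; first by rewrite ab bm mc cd.
by move=> w; rewrite inE.
Qed.

(** Positions, divided by 3, of the neighbours of two digons, with [L] for [ell %/ 3]. For [L <= 2]
    there are only two positions. For [L = 3] the four would have to be distinct, for [L = 4] all
    distances between the digons would be 2, and no larger [L] satisfies the bounds. *)
Lemma far_apart (A A' B B' L : nat) :
 (A = B -> L <= 2) -> (A = B' -> L <= 2) -> (A' = B -> L <= 2) -> (A' = B' -> L <= 2) ->
 (A < B -> L <= B - A + 2 /\ B - A <= 2) -> (B < A -> L <= A - B + 2 /\ A - B <= 2) ->
 (A < B' -> L <= B' - A + 2 /\ B' - A <= 2) -> (B' < A -> L <= A - B' + 2 /\ A - B' <= 2) ->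
 (A' < B -> L <= B - A' + 2 /\ B - A' <= 2) -> (B < A' -> L <= A' - B + 2 /\ A' - B <= 2) ->
 (A' < B' -> L <= B' - A' + 2 /\ B' - A' <= 2) -> (B' < A' -> L <= A' - B' + 2 /\ A' - B' <= 2) ->
 A < L -> A' < L -> B < L -> B' < L -> A != A' -> B != B' -> 
  A = B /\ A' = B' \/ A = B' /\ A' = B.
Proof.
move=> h1 h2 h3 h4 h5 h6 h7 h8 h9 h10 h11 h12 l1 l2 l3 l4 n1 n2.
case: (leqP L 2) => HL.
  clear h1 h2 h3 h4 h5 h6 h7 h8 h9 h10 h11 h12. lia.
case: (ltngtP A B) => [/h5|/h6|/h1]; case: (ltngtP A B') => [/h7|/h8|/h2];
case: (ltngtP A' B) => [/h9|/h10|/h3]; case: (ltngtP A' B') => [/h11|/h12|/h4];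
clear h1 h2 h3 h4 h5 h6 h7 h8 h9 h10 h11 h12; lia.
Qed.

(** The path from [n1] to [n2] has length 4, so with an arc between vertices of equal colour it
    closes to a multiple of 3, which must be at least [ell]. By [far_apart] both ends then have the
    same two neighbours on the cycle: a 4-cycle. *)
Lemma no_two_arms i n1 v1 m v2 n2 :
  {in [:: n1; v1; m; v2; n2], forall w, w \notin s} -> uniq [:: n1; v1; m; v2; n2] ->
  e n1 v1 -> e v1 m -> e m v2 -> e v2 n2 -> digon i n1 -> digon i n2 -> False.
Proof.
move=> out U e1 e2 e3 e4 [x [x' [xi x'i xx' n1x n1x']]] [y [y' [yi y'i yy' n2y n2y']]].
have P := path5 e1 e2 e3 e4 U.
have oP : off [set w in [:: n1; v1; m; v2; n2]] by move=> w; rewrite inE => /out.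
have n12 : n1 != n2 by move: U; rewrite /= !inE !negb_or => /andP[/and4P[]].
have key a b : a \in class i -> b \in class i -> e n1 a -> e n2 b ->
  let p := index a s %/ 3 in let q := index b s %/ 3 in let l := ell %/ 3 in
  [/\ p < l, q < l, p = q -> l <= 2, p < q -> l <= q - p + 2 /\ q - p <= 2
    & q < p -> l <= p - q + 2 /\ p - q <= 2].
  case/classP => as_ ai /classP[bs bi] n1a n2b; rewrite /col in ai bi; cbv zeta.
  have pl : index a s < ell by rewrite index_mem.
  have ql : index b s < ell by rewrite index_mem.
  have ca : c (index a s) = a by apply: cyc_index.
  have cb : c (index b s) = b by apply: cyc_index.
  have E : index a s = index b s -> ell <= 6.
    move=> pq; have ab : a = b by rewrite -ca -cb pq.
    have aP : a \notin [set w in [:: n1; v1; m; v2; n2]] by apply/negP => /oP; rewrite as_.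
    have an1 : e a n1 by rewrite eC.
    have n2a : e n2 a by rewrite ab.
    by case: (lp_ok (lp_cons an1 aP P) n2a isT) => _ /(_ erefl).
  rewrite -ca in n1a; rewrite -cb in n2b.
  have L1 pq := link_ok oP P n1a n2b pq ql.
  have L2 pq := link_ok oP (lp_sym eC P) n2b n1a pq pl.
  move: (index a s) (index b s) pl ql ai bi s0 E L1 L2; rewrite /okl; clear => p q pl ql ai bi s0 E L1 L2.
  split; [lia|lia|clear L1 L2; lia| |].
  - move=> pq; have /L1[[_ o1] [_ o2]] : p < q by clear L1 L2 E; lia.
    by clear L1 L2 E; lia.
  move=> pq; have /L2[[_ o1] [_ o2]] : q < p by clear L1 L2 E; lia.
  by clear L1 L2 E; lia.
have back a b : a \in class i -> b \in class i -> index a s %/ 3 = index b s %/ 3 -> a = b.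
  move=> /classP[as_ ai] /classP[bs bi] E; rewrite -(cyc_index as_) -(cyc_index bs).
  by rewrite (divn_eq (index a s) 3) E -/(col a) ai -bi -divn_eq.
have neq a b : a \in class i -> b \in class i -> a != b -> index a s %/ 3 != index b s %/ 3.
  by move=> ai bi; apply: contra => /eqP /(back _ _ ai bi)/eqP.
have : (x = y /\ x' = y') \/ (x = y' /\ x' = y).
  case: (key _ _ xi yi n1x n2y) => p1 p2 p3 p4 p5.
  case: (key _ _ xi y'i n1x n2y') => _ q2 q3 q4 q5.
  case: (key _ _ x'i yi n1x' n2y) => r1 _ r3 r4 r5.
  case: (key _ _ x'i y'i n1x' n2y') => _ _ t3 t4 t5.
  by case: (far_apart p3 q3 r3 t3 p4 p5 q4 q5 r4 r5 t4 t5 p1 r1 p2 q2 (neq _ _ xi x'i xx') (neq _ _ yi y'i yy'));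
    case=> E1 E2; [left|right]; split; apply: back.
have xn2 : e x n1 by rewrite eC.
have x'n2 : e n2 y' -> e y' n2 by rewrite eC.
case=> -[E1 E2]; subst.
  by apply: (@noC4 n1 y n2 y') => //; rewrite 1?eC.
by apply: (@noC4 n1 y n2 y') => //; rewrite 1?eC.
Qed.

Lemma path3 a b d : e a b -> e b d -> a != d -> lpath [set a; b; d] a d 2.
Proof.
move=> ab bd ad; exists [:: b; d]; split=> //=; first by rewrite ab bd.
  by rewrite !inE negb_or ad (adj_neq ab) (adj_neq bd).
by move=> w; rewrite !inE orbA.
Qed.

Lemma edge_path K a b : e a b -> a \in K -> b \in K -> lpath K a b 1.
Proof.
move=> ab aK bK; exists [:: b]; split=> //=; first by rewrite ab.
  by rewrite inE (adj_neq ab).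
by move=> w; rewrite !inE => /orP[]/eqP->.
Qed.

(** The counterpart of [branch_single] towards a colour class, where [onenb] may fail; the price is
    the second shape. For the layer beyond [N], [onenb] comes from [link_same] and [hubfree] from
    [no_two_arms]. *)
Lemma dead_shape Z i w : branch Z (class i) [set w] -> off Z ->
  exists2 n, nb (class i) n & Z = [set n] \/
    exists v, [/\ Z = [set n; v], n != v, e n v /\ e v w, deg v = 2 & digon i n].
Proof.
move: {2}#|Z| (leqnn #|Z|) => m; elim: m Z w => [|m IH] Z w cZ B oZ.
  by case: (br_attX B) => u uK; move: cZ; rewrite leqn0 cards_eq0 => /eqP K0; rewrite K0 inE in uK.
have cnZ := br_conn B; case: (br_attY B) => v0 v0Z v0Y.
pose N := [set u in Z | nb (class i) u].
have NE t : (t \in N) = (t \in Z) && nb (class i) t by rewrite inE.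
clearbody N.
have NZ : {subset N <= Z} by move=> t; rewrite NE => /andP[].
have NX t : t \in N -> nb (class i) t by rewrite NE => /andP[].
have ind u1 u2 : u1 \in N -> u2 \in N -> e u1 u2 -> False.
  move=> u1N u2N; exact: (indep cnZ (br_const B) v0Z v0Y (NZ _ u1N) (NZ _ u2N) (NX _ u1N) (NX _ u2N)).
have oN : onenb (Z :\: N) N.
  move=> u x x'; rewrite in_setD => /andP[uN uZ] xN x'N ux ux'.
  apply/eqP; apply: contraT => xx'.
  have xu : e x u by rewrite eC.
  have xZ := NZ _ xN; have x'Z := NZ _ x'N.
  have P : lpath Z x x' 2 by apply: lp_sub (path3 xu ux' xx') _; sets.
  by case: (link_same oZ P (NX _ xN) (NX _ x'N) xx').
(* Unless [long_arms] applies, the part with [n] and [u] behind [m'] is a smaller branch of the same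
   kind; since [u] is not in [N], it has the second shape with [n] as its digon. *)
have arm n u m' u' n' : n \in N -> u \in Z -> u \notin N -> m' \in Z -> m' \notin N ->
    u' \in Z -> u' \notin N -> n' \in N -> u != u' -> deg u = 2 -> deg u' = 2 ->
    e n u -> e u m' -> e m' u' -> e u' n' -> n != n' -> digon i n.
  move=> nN uZ uN mZ mN u'Z u'N n'N uu' du du' nu um mu' u'n' nn'.
  have nZ := NZ _ nN; have n'Z := NZ _ n'N.
  have neq a b : a \in N -> b \notin N -> a != b by move=> aN; apply: contraNneq => <-.
  have nm := neq _ _ nN mN.
  have nC : n \in component (Z :\ m') n by apply: component_id; rewrite !inE nm.
  have uC : u \in component (Z :\ m') n.
    by apply: component_closed nC _ nu; rewrite !inE (adj_neq um).
  case: (boolP [exists v in component (Z :\ m') n, nb [set w] v]) => [/existsP[v /andP[vC vY]]|dead].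
    case: (long_arms (br_const B) (br_dY B) _ _ (NX _ nN) (NX _ n'N) nu um mu' u'n' du du' vC vY).
    - by sets.
    have h1 := neq _ _ nN uN; have h2 := neq _ _ nN u'N.
    have h3 := neq _ _ n'N uN; have h4 := neq _ _ n'N u'N; have h5 := neq _ _ n'N mN.
    by have h6 := adj_neq um; have h7 := adj_neq mu'; rewrite /= !inE; nq.
  have {}dead v : v \in component (Z :\ m') n -> ~~ nb [set w] v.
    by move=> vC; apply: contra dead => vY; apply/existsP; exists v; rewrite vC.
  have BZ : branch (component (Z :\ m') n) (class i) [set m'].
    by apply: dead_branch B mZ nZ nm dead _ _; [exists n; rewrite ?NX|exists u].
  have CZ : {subset component (Z :\ m') n <= Z}.
    by move=> t /component_sub; rewrite !inE => /andP[].
  case: (IH _ _ _ BZ).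
  - apply: card_lt cZ CZ mZ _; by apply/negP => /component_sub; rewrite !inE eqxx.
  - exact: sub_off CZ.
  move=> t tX [Ct|[v [Ct _ _ _ dt]]].
    by move: nC uC (adj_neq nu); rewrite Ct !inE => /eqP-> /eqP->; rewrite eqxx.
  have tZ : t \in Z by apply: CZ; rewrite Ct !inE eqxx.
  have ut : u != t by apply: contraNneq uN => ->; rewrite NE tX tZ.
  move: nC uC (adj_neq nu); rewrite Ct !inE (negbTE ut) /= => H /eqP uv.
  by rewrite uv; case/orP: H => /eqP->; rewrite ?eqxx.
have hN : hubfree (Z :\: N) N.
  move=> u u' m' n n'; rewrite !in_setD => /andP[uN uZ] /andP[u'N u'Z] /andP[mN mZ].
  move=> uu' du du' um u'm nN n'N un u'n' nn'.
  have neq a b : a \in N -> b \notin N -> a != b by move=> aN; apply: contraNneq => <-.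
  have nZ := NZ _ nN; have n'Z := NZ _ n'N.
  have nu : e n u by rewrite eC.
  have mu : e m' u by rewrite eC.
  have mu' : e m' u' by rewrite eC.
  have n'u' : e n' u' by rewrite eC.
  apply: (@no_two_arms i n u m' u' n') => //.
  - by move=> t; rewrite !inE => H; apply: oZ; splith.
  - have h1 := neq _ _ nN uN; have h2 := neq _ _ nN u'N; have h0 := neq _ _ nN mN.
    have h3 := neq _ _ n'N uN; have h4 := neq _ _ n'N u'N; have h5 := neq _ _ n'N mN.
    by have h6 := adj_neq um; have h7 := adj_neq mu'; rewrite /= !inE; nq.
  - exact: (arm n u m' u' n').
  by apply: (arm n' u' m' u n) => //; rewrite eq_sym.
case: (boolP [exists v in Z, v \notin N]) => [/existsP[q /andP[qZ qN]]|all_N]; last first.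
  have {}all_N t : t \in Z -> t \in N.
    by move=> tZ; apply: contraR all_N => tN; apply/existsP; exists t; rewrite tZ.
  exists v0; first by apply: NX; apply: all_N.
  left; apply/esym; apply: (conn_closed eC (z := v0) cnZ); first by rewrite inE.
    by move=> t; rewrite inE => /eqP->.
  move=> y t; rewrite inE => /eqP-> tZ yt.
  by case: (ind v0 t) => //; apply: all_N.
have oY : onenb Z [set w] by apply: onenb1.
have hY : hubfree Z [set w] by apply: hubfree1.
have single t : t \in Z -> t \notin N ->
    component (Z :\: N) t = [set t] /\ nb [set w] t.
  apply: (layer_single _ B NE oN hN oY hY) => Q X' Y' _; exact: branch_single.
have cl t a : t \in Z -> t \notin N -> e t a -> a \in N \/ a = w.
  move=> tZ tN ta; case: (single t tZ tN) => Ct _; case: (boolP (a \in Z)) => aZ.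
    left; apply: contraT => aN.
    have: a \in component (Z :\: N) t.
      by apply: component_closed (component_id _ _) _ ta; rewrite in_setD ?tN ?aN.
    by rewrite Ct inE => /eqP at_; rewrite at_ eI in ta.
  case: (br_closed B tZ ta aZ) => [aX|]; last by rewrite inE => /eqP; right.
  by case/negP: tN; rewrite NE tZ; apply/nbP; exists a.
have tw t : t \in Z -> t \notin N -> e t w.
  by move=> tZ tN; case: (single t tZ tN) => _ /nbP[w']; rewrite inE => /eqP->.
have wZ : w \notin Z by apply/negP => wZ; apply: (br_dY B wZ); rewrite inE.
have qw := tw _ qZ qN.
case: (@deg_gt1 q w (deg_ge2 (br_sub B qZ))) => n qn nw.
have nN : n \in N by case: (cl _ _ qZ qN qn) => // E; rewrite E eqxx in nw.
have nZ := NZ _ nN.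
have dq : deg q = 2.
  apply: (deg2_only qn qw nw) => a qa.
  case: (cl _ _ qZ qN qa) => [aN|]; last by right.
  by left; apply: (oN q) => //; rewrite in_setD qN.
have nq_ : e n q by rewrite eC.
have Zn : Z = [set n; q].
  apply/esym; apply: (conn_closed eC (z := n) cnZ); first by rewrite !inE eqxx.
    by sets.
  move=> y t; rewrite !inE => /orP[]/eqP-> tZ yt.
    case: (boolP (t \in N)) => tN; first by case: (ind n t).
    case: (eqVneq t q) => [->|tq]; first by rewrite orbT.
    case: (@noC4 n q w t) => //; [by rewrite eC tw|by rewrite eC|by rewrite eq_sym].
  case: (cl _ _ qZ qN yt) => [tN|tw_]; last by rewrite tw_ (negbTE wZ) in tZ.
  by rewrite (oN q t n) ?eqxx // in_setD qN.
exists n; first exact: NX.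
right; exists q; split=> //; first exact: adj_neq.
case/nbP: (NX _ nN) => x xX nx.
have dn : 2 < deg n.
  rewrite ltn_neqAle deg_ge2 ?andbT; last exact: br_sub B _ nZ.
  by apply/eqP => dn; apply: (nadj2 qn dq).
case: (@deg_gt2 n x q dn) => a [na ax aq].
exists x, a; split=> //; last by rewrite eq_sym.
have aZ : a \notin Z.
  by rewrite Zn !inE negb_or aq andbT eq_sym; apply: adj_neq.
(* If the third neighbour of [n] were [w], paths of lengths 0 and 1 would lead from [n] to
   neighbours of [w]. *)
case: (br_closed B nZ na aZ) => // aw.
have nY : nb [set w] n by apply/nbP; exists a.
have qY : nb [set w] q by apply/nbP; exists w; rewrite ?inE.
have := br_const B (NX _ nN) nY (lp0 e nZ) (NX _ nN) qY (edge_path nq_ nZ qZ).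
by [].
Qed.

(** Either [long_arms] applies, or the part of [K] with [n] behind [m] never sees [Y]. There, seeing
    [class i] means seeing [X], and [dead_shape] puts the digon at [n]. *)
Lemma arm_digon K X Y i n u m u' n' : branch K X Y -> off K ->
  {subset X <= class i} -> (forall t, t \in K -> nb (class i) t -> nb X t \/ nb Y t) ->
  {subset [:: n; u; m; u'; n'] <= K} -> uniq [:: n; u; m; u'; n'] ->
  nb X n -> nb X n' -> ~~ nb (class i) u -> deg u = 2 -> deg u' = 2 ->
  e n u -> e u m -> e m u' -> e u' n' -> digon i n.
Proof.
move=> B oK Xi XY sub U nX n'X uX du du' nu um mu' u'n'.
have nK : n \in K by apply: sub; rewrite !inE eqxx.
have uK : u \in K by apply: sub; rewrite !inE eqxx ?orbT.
have mK : m \in K by apply: sub; rewrite !inE eqxx ?orbT.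
have nm : n != m by move: U; rewrite /= !inE !negb_or => /andP[/and4P[]].
have nC : n \in component (K :\ m) n by apply: component_id; rewrite !inE nm.
have uC : u \in component (K :\ m) n.
  by apply: component_closed nC _ nu; rewrite !inE (adj_neq um).
case: (boolP [exists v in component (K :\ m) n, nb Y v]) => [/existsP[v /andP[vC vY]]|dead].
  by case: (long_arms (br_const B) (br_dY B) sub U nX n'X nu um mu' u'n' du du' vC vY).
have {}dead v : v \in component (K :\ m) n -> ~~ nb Y v.
  by move=> vC; apply: contra dead => vY; apply/existsP; exists v; rewrite vC.
have CK : {subset component (K :\ m) n <= K}.
  by move=> t /component_sub; rewrite !inE => /andP[].
have BZ : branch (component (K :\ m) n) X [set m].
  by apply: dead_branch B mK nK nm dead _ _; [exists n|exists u].
have toX t : t \in component (K :\ m) n -> nb (class i) t -> nb X t.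
  by move=> tC /(XY _ (CK _ tC))[//|tY]; have := dead _ tC; rewrite tY.
have toi t : nb X t -> nb (class i) t.
  by case/nbP => x /Xi xi tx; apply/nbP; exists x.
have BZ' : branch (component (K :\ m) n) (class i) [set m].
  split.
  - exact: br_conn BZ.
  - exact: br_sub BZ.
  - by move=> w /CK /oK ws /classP[]; rewrite (negbTE ws).
  - exact: br_dY BZ.
  - by move=> a w aC aw wC; case: (br_closed BZ aC aw wC); [move/Xi; left|right].
  - by exists n => //; apply: toi.
  - exact: br_attY BZ.
  move=> a b k a' b' k' /toX aX bY P /toX a'X b'Y P'.
  apply: (br_const BZ (aX _) bY P (a'X _) b'Y P'); [exact: lp_fst P|exact: lp_fst P'].
case: (dead_shape BZ' (sub_off oK CK)) => t tX [Ct|[v [Ct _ _ _ dt]]].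
  by move: nC uC (adj_neq nu); rewrite Ct !inE => /eqP-> /eqP->; rewrite eqxx.
have ut : u != t by apply: contraNneq uX => ->.
move: nC uC (adj_neq nu); rewrite Ct !inE (negbTE ut) /= => H /eqP uv.
by rewrite uv; case/orP: H => /eqP->; rewrite ?eqxx.
Qed.

Lemma hub_arms K X Y i n u m u' n' : branch K X Y -> off K ->
  {subset X <= class i} -> (forall t, t \in K -> nb (class i) t -> nb X t \/ nb Y t) ->
  {subset [:: n; u; m; u'; n'] <= K} -> uniq [:: n; u; m; u'; n'] ->
  nb X n -> nb X n' -> ~~ nb (class i) u -> ~~ nb (class i) u' -> deg u = 2 -> deg u' = 2 ->
  e n u -> e u m -> e m u' -> e u' n' -> False.
Proof.
move=> B oK Xi XY sub U nX n'X uX u'X du du' nu um mu' u'n'.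
apply: (@no_two_arms i n u m u' n') => //; first by move=> t /sub /oK.
  exact: (arm_digon B oK Xi XY sub U nX n'X uX du du').
have e1 : e n' u' by rewrite eC.
have e2 : e u' m by rewrite eC.
have e3 : e m u by rewrite eC.
have e4 : e u n by rewrite eC.
apply: (arm_digon B oK Xi XY _ _ n'X nX u'X du' du e1 e2 e3 e4).
  by move=> t; rewrite -(mem_rev [:: n'; u'; m; u; n]); apply: sub.
by rewrite -(rev_uniq [:: n'; u'; m; u; n]).
Qed.

(** * Components off the cycle *)

(** Closure conditions in place of a [component] term: they carry over to a rotation of [s] and
    apply directly to explicit sets. *)
Record outer K : Prop := Outer {
  ou_conn : conn K;
  ou_sub : {subset K <= S};
  ou_off : off K;
  ou_closed : forall u w, u \in K -> e u w -> w \notin K -> w \in s }.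

Definition coclass i : {set T} := [set x in s | col x != i].
Definition onC u := nb [set x in s] u.

(** The path of length 0 at [u] would join two colours, and 0 is not 2 modulo 3. *)
Lemma class_excl u i j : u \notin s -> nb (class i) u -> nb (class j) u -> i = j.
Proof.
move=> us_ ui uj; apply/eqP; apply: contraT => ij.
have o1 : off [set u] by move=> w; rewrite inE => /eqP->.
have P : lpath [set u] u u 0 by apply: lp0; rewrite inE.
by have := link_diff o1 P ui uj ij.
Qed.

Lemma onCP u : onC u -> exists2 i, i < 3 & nb (class i) u.
Proof.
case/nbP => x; rewrite inE => xs ux; exists (col x); first by rewrite ltn_pmod.
by apply/nbP; exists x; rewrite // inE xs /=.
Qed.

Lemma class_onC u i : nb (class i) u -> onC u.
Proof. by case/nbP => x /classP[xs _] ux; apply/nbP; exists x; rewrite // inE. Qed.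

Lemma class_lt3 u i : nb (class i) u -> i < 3.
Proof. by case/nbP => x /classP[_ <-] _; rewrite ltn_pmod. Qed.

Lemma coclassP u i : nb (coclass i) u -> exists2 j, j != i & nb (class j) u.
Proof.
case/nbP => x; rewrite inE => /andP[xs xi] ux; exists (col x) => //.
by apply/nbP; exists x; rewrite // inE xs /=.
Qed.

Lemma class_co u i j : nb (class j) u -> j != i -> nb (coclass i) u.
Proof.
case/nbP => x /classP[xs xj] ux ji; apply/nbP; exists x => //.
by rewrite inE xs xj.
Qed.

(** * Components that see several colours *)

Section MultiColour.
Variable K : {set T}.
Hypothesis oK : outer K.
Variables (a0 b0 : T) (ia ib : nat).
Hypotheses (a0K : a0 \in K) (b0K : b0 \in K) (iab : ia != ib).
Hypotheses (a0i : nb (class ia) a0) (b0i : nb (class ib) b0).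
Let off_ := ou_off oK.
Let cnK := ou_conn oK.

(** Paths between different colours all have length 2 modulo 3, so one colour against the others
    gives [const]. *)
Lemma outer_branch i : (exists2 n, n \in K & nb (class i) n) -> branch K (class i) (coclass i).
Proof.
move=> att; split=> //.
- exact: ou_sub oK.
- by move=> w /off_ ws /classP[]; rewrite (negbTE ws).
- by move=> w /off_ ws; rewrite inE (negbTE ws).
- move=> u w uK uw /(ou_closed oK uK uw) ws; rewrite !inE ws /=.
  by case: eqP; [left|right].
- case: (eqVneq ia i) => [E|ne]; last by exists a0 => //; apply: class_co a0i ne.
  by exists b0 => //; apply: class_co b0i _; rewrite -E eq_sym.
move=> u v n u' v' n' ui /coclassP[j ji vj] P u'i /coclassP[j' j'i v'j'] P'.
rewrite eq_sym in ji; rewrite eq_sym in j'i.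
by rewrite (link_diff off_ P ui vj ji) (link_diff off_ P' u'i v'j' j'i).
Qed.

Lemma on_indep u u' : u \in K -> u' \in K -> onC u -> onC u' -> e u u' -> False.
Proof.
move=> uK u'K /onCP[i _ ui] /onCP[j _ u'j] uu'.
case: (eqVneq i j) => [ij|ij]; last first.
  by have := link_diff off_ (edge_path uu' uK u'K) ui u'j ij.
have B : branch K (class i) (coclass i) by apply: outer_branch; exists u.
case: (br_attY B) => v0 v0K v0Y; rewrite -ij in u'j.
exact: (indep cnK (br_const B) v0K v0Y uK u'K ui u'j uu').
Qed.

Lemma on_one i w n n' : w \in K -> n \in K -> n' \in K ->
  nb (class i) n -> nb (class i) n' -> e w n -> e w n' -> n = n'.
Proof.
move=> wK nK n'K ni n'i wn wn'; apply/eqP; apply: contraT => nn'.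
have nw : e n w by rewrite eC.
have P : lpath K n n' 2 by apply: lp_sub (path3 nw wn' nn') _; sets.
by case: (link_same off_ P ni n'i nn').
Qed.

Lemma class_neq i j n n' : i != j -> n \in K -> nb (class i) n -> nb (class j) n' -> n != n'.
Proof.
move=> ij nK ni n'j; apply: contraNneq ij => E; rewrite -E in n'j.
by apply/eqP; apply: class_excl (off_ nK) ni n'j.
Qed.

Lemma on_neq x y : onC x -> ~~ onC y -> x != y.
Proof. by move=> xN; apply: contraNneq => <-. Qed.

Lemma on_hub i u u' m n n' : u \in K -> u' \in K -> m \in K -> n \in K -> n' \in K ->
  ~~ onC u -> ~~ onC u' -> ~~ onC m -> u != u' -> deg u = 2 -> deg u' = 2 ->
  e u m -> e u' m -> nb (class i) n -> nb (class i) n' -> e u n -> e u' n' -> n != n' -> False.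
Proof.
move=> uK u'K mK nK n'K uN u'N mN uu' du du' um u'm ni n'i un u'n' nn'.
have B : branch K (class i) (coclass i) by apply: outer_branch; exists n.
have nN := class_onC ni; have n'N := class_onC n'i.
have nu : e n u by rewrite eC.
have mu' : e m u' by rewrite eC.
have noi t : ~~ onC t -> ~~ nb (class i) t by apply: contra; apply: class_onC.
apply: (hub_arms B off_ _ _ _ _ ni n'i (noi _ uN) (noi _ u'N) du du' nu um mu' u'n') => //.
- by move=> t _; left.
- by sets.
have h1 := on_neq nN uN; have h2 := on_neq nN u'N; have h0 := on_neq nN mN.
have h3 := on_neq n'N uN; have h4 := on_neq n'N u'N; have h5 := on_neq n'N mN.
by have h6 := adj_neq um; have h7 := adj_neq mu'; rewrite /= !inE; nq.
Qed.

Definition inner : {set T} := [set u in K | ~~ onC u].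
Definition onclass i : {set T} := [set u in K | nb (class i) u].

Lemma lp_component L M x y k : lpath L x y k -> {subset L <= M} -> y \in component M x.
Proof.
elim: k y L => [|k IH] y L P LM.
  move/lp_eq0: (P) => /esym; rewrite eqxx => /eqP <-.
  by apply: component_id; apply: LM; apply: lp_fst P.
have Py := lp_sym eC P; have yM := LM _ (lp_fst Py).
case/lp_step: Py => y' [yy' y'L _ Py].
have y'C : y' \in component M x.
  apply: IH (lp_sym eC Py) _ => w; rewrite in_setD1 => /andP[_ /LM]; exact: id.
by apply: component_closed y'C yM _; rewrite eC.
Qed.

(** By [on_indep] the path has inner vertices, and these lie in one component of [inner]. *)
Lemma inner_link L n b k : lpath L n b k -> {subset L <= n |: (b |: inner)} ->
  n != b -> n \in K -> b \in K -> onC n -> onC b ->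
  exists q1 q2, [/\ q1 \in inner, q2 \in component inner q1, e n q1, e b q2 & q1 \in L].
Proof.
move=> P LI nb_ nK bK nN bN.
case: k P => [|k] P; first by move/lp_eq0: P; rewrite (negbTE nb_).
case/lp_step: P => q1 [nq1 q1L q1n P].
have q1b : q1 != b by apply/eqP => E; subst q1; apply: (on_indep nK bK nN bN nq1).
have q1I : q1 \in inner.
  by have := LI _ q1L; rewrite !in_setU1 (negbTE q1n) (negbTE q1b).
case: k P => [|k] /(lp_sym eC) P; first by move/lp_eq0: P; rewrite eq_sym (negbTE q1b).
case/lp_step: P => q2 [bq2 _ _ P].
exists q1, q2; split=> //; apply: lp_component (lp_sym eC P) _ => w.
by rewrite !in_setD1 => /and3P[wb wn /LI]; rewrite !in_setU1 (negbTE wb) (negbTE wn).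
Qed.

Lemma innerP u : u \in inner -> u \in K /\ ~~ onC u.
Proof. by rewrite inE => /andP[]. Qed.

Lemma onclassP i u : u \in onclass i -> u \in K /\ nb (class i) u.
Proof. by rewrite inE => /andP[]. Qed.

Section InnerComponent.
Variables (q : T) (Q : {set T}).
Hypothesis QE : Q = component inner q.

Lemma inner_in u : u \in Q -> u \in K /\ ~~ onC u.
Proof. by rewrite QE => /component_sub /innerP. Qed.

Lemma inner_closed u w : u \in Q -> e u w -> w \notin Q -> w \in K /\ onC w.
Proof.
move=> uQ uw wQ; case: (inner_in uQ) => uK uN.
have wK : w \in K.
  apply: contraT => wK; case/negP: uN; apply/nbP; exists w => //.
  by rewrite inE (ou_closed oK uK uw wK).
split=> //; apply: contraNT wQ => wN; rewrite QE in uQ *.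
by apply: component_closed uQ _ uw; rewrite inE wK.
Qed.

Lemma inner_ext n n' u v k : n \in K -> n' \in K -> onC n -> onC n' -> n != n' ->
  e n u -> e v n' -> lpath Q u v k -> lpath K n n' k.+2.
Proof.
move=> nK n'K nN n'N nn' nu vn' P.
have nQ : n \notin Q by apply/negP => /inner_in[_]; rewrite nN.
have n'Q : n' \notin Q by apply/negP => /inner_in[_]; rewrite n'N.
have QK : {subset Q <= K} by move=> w /inner_in[].
by apply: lp_sub (lp_snoc eC (lp_cons nu nQ P) vn' _) _; [memg|sets].
Qed.

Lemma inner_single X Y r : {subset X <= [set u in K | onC u]} ->
  {subset Y <= [set u in K | onC u]} ->
  (forall u w, u \in Q -> e u w -> w \in K -> onC w -> w \in X \/ w \in Y) ->
  (exists2 u, u \in Q & nb X u) -> (exists2 u, u \in Q & nb Y u) ->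
  (forall n n' u v k, n \in X -> n' \in Y -> e n u -> e v n' -> lpath Q u v k -> k %% 3 = r) ->
  onenb Q X -> onenb Q Y -> hubfree Q X -> hubfree Q Y -> exists v, Q = [set v].
Proof.
move=> XN YN cl attX attY cst; apply: branch_single; split=> //.
- by rewrite QE; apply: component_conn.
- by move=> w /inner_in[/(ou_sub oK)].
- by move=> w /inner_in[_ /negP wN] /XN; rewrite inE => /andP[].
- by move=> w /inner_in[_ /negP wN] /YN; rewrite inE => /andP[].
- by move=> u w uQ uw wQ; case: (inner_closed uQ uw wQ) => wK wN; apply: cl uw wK wN.
move=> u v k u' v' k' /nbP[n nX un] /nbP[n' n'Y vn'] P /nbP[m mX um] /nbP[m' m'Y vm'] P'.
rewrite eC in un; rewrite eC in um.
by rewrite (cst _ _ _ _ _ nX n'Y un vn' P) (cst _ _ _ _ _ mX m'Y um vm' P').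
Qed.

Lemma onenb_class i : onenb Q (onclass i).
Proof.
move=> u x x' /inner_in[uK uN] /onclassP[xK xi] /onclassP[x'K x'i] ux ux'.
exact: (on_one uK xK x'K xi x'i).
Qed.

Lemma hubfree_class i : hubfree Q (onclass i).
Proof.
move=> u u' m n n' /inner_in[uK uN] /inner_in[u'K u'N] /inner_in[mK mN] uu' du du' um u'm.
move=> /onclassP[nK ni] /onclassP[n'K n'i].
exact: (on_hub uK u'K mK nK n'K uN u'N mN uu' du du' um u'm ni n'i).
Qed.

(** A path in [Q] between neighbours of different colours extends by two edges to one of length 2
    modulo 3, so its own length is 0 modulo 3. *)
Lemma two_class i j : i != j ->
  (exists2 u, u \in Q & nb (onclass i) u) -> (exists2 u, u \in Q & nb (onclass j) u) ->
  (forall u w, u \in Q -> e u w -> w \in K -> onC w -> w \in onclass i \/ w \in onclass j) ->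
  exists v, Q = [set v].
Proof.
move=> ij atti attj cl; apply: (@inner_single (onclass i) (onclass j) 0) => //.
- by move=> w /onclassP[wK wi]; rewrite inE wK (class_onC wi).
- by move=> w /onclassP[wK wi]; rewrite inE wK (class_onC wi).
- move=> n n' u v k /onclassP[nK ni] /onclassP[n'K n'j] nu vn' P.
  have nn' : n != n'.
    by apply: contraNneq ij => E; rewrite -E in n'j; apply/eqP; apply: class_excl (off_ nK) ni n'j.
  have := link_diff off_ (inner_ext nK n'K (class_onC ni) (class_onC n'j) nn' nu vn' P) ni n'j ij.
  by clear; lia.
- exact: onenb_class.
- exact: onenb_class.
- exact: hubfree_class.
exact: hubfree_class.
Qed.

(** Otherwise colours [j] and [l] can be merged into one side: no vertex of [Q] is next to both, so
    [onenb] holds, and [Q] becomes a single vertex, which is next to both. *)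
Lemma two_at_once i j l : i != j -> j != l -> i != l ->
  (exists2 u, u \in Q & nb (onclass i) u) -> (exists2 u, u \in Q & nb (onclass j) u) ->
  (exists2 u, u \in Q & nb (onclass l) u) -> i < 3 -> j < 3 -> l < 3 ->
  exists z, [/\ z \in Q, nb (onclass j) z & nb (onclass l) z].
Proof.
move=> ij jl il atti attj attl i3 j3 l3.
case: (boolP [exists z in Q, nb (onclass j) z && nb (onclass l) z]) => [/existsP[z /and3P[]]|no].
  by exists z.
have {}no z : z \in Q -> nb (onclass j) z -> nb (onclass l) z -> False.
  by move=> zQ zj zl; case/existsP: no; exists z; rewrite zQ zj.
case: (@inner_single (onclass i) (onclass j :|: onclass l) 0) => //.
- by move=> w /onclassP[wK wi]; rewrite inE wK (class_onC wi).
- by move=> w; rewrite in_setU => /orP[]/onclassP[wK wi]; rewrite inE wK (class_onC wi).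
- move=> u w uQ uw wK /onCP[k k3 wk]; rewrite in_setU.
  have : [|| k == i, k == j | k == l] by move: k3 i3 j3 l3 ij jl il; clear; lia.
  by case/or3P => /eqP E; subst k; [left|right|right]; rewrite !inE wK wk ?orbT.
- by case: attj => u uQ /nbP[x xj ux]; exists u => //; apply/nbP; exists x; rewrite // in_setU xj.
- move=> n n' u v k /onclassP[nK ni]; rewrite in_setU => n'jl nu vn' P.
  have [d id_ [n'K n'd]] : exists2 d, i != d & n' \in K /\ nb (class d) n'.
    by case/orP: n'jl => /onclassP[? ?]; [exists j|exists l].
  have := link_diff off_ (inner_ext nK n'K (class_onC ni) (class_onC n'd) (class_neq id_ nK ni n'd) nu vn' P) ni n'd id_.
  by clear; lia.
- exact: onenb_class.
- have oj : forall u x x', u \in Q -> x \in onclass j -> x' \in onclass l -> e u x -> e u x' -> False.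
    by move=> u x x' uQ xj x'l ux ux'; apply: (no u uQ); apply/nbP; [exists x|exists x'].
  move=> u x x' uQ; rewrite !in_setU => /orP[]xA /orP[]x'A ux ux'.
  + exact: (onenb_class uQ xA x'A ux ux').
  + by case: (oj u x x').
  + by case: (oj u x' x).
  exact: (onenb_class uQ xA x'A ux ux').
- exact: hubfree_class.
(* A hub between two colours would give a path of length 4 between them. *)
- have dif : forall a b u u' m n n', a != b -> u \in Q -> u' \in Q -> m \in Q -> u != u' ->
      e u m -> e u' m -> n \in onclass a -> n' \in onclass b -> e u n -> e u' n' -> False.
    move=> a b u u' m n n' ab /inner_in[uK uN] /inner_in[u'K u'N] /inner_in[mK mN] uu' um u'm.
    move=> /onclassP[nK na] /onclassP[n'K n'b] un u'n'.
    have nN := class_onC na; have n'N := class_onC n'b.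
    have h1 := on_neq nN uN; have h2 := on_neq nN u'N; have h0 := on_neq nN mN.
    have h3 := on_neq n'N uN; have h4 := on_neq n'N u'N; have h5 := on_neq n'N mN.
    have h8 := class_neq ab nK na n'b.
    have nu : e n u by rewrite eC.
    have mu' : e m u' by rewrite eC.
    have h6 := adj_neq um; have h7 := adj_neq mu'.
    have P : lpath K n n' 4.
      apply: lp_sub (path5 nu um mu' u'n' _) _; first by rewrite /= !inE; nq.
      by sets.
    by have := link_diff off_ P na n'b ab.
  move=> u u' m n n' uQ u'Q mQ uu' du du' um u'm; rewrite !in_setU => /orP[]nA /orP[]n'A un u'n' nn'.
  + exact: (hubfree_class uQ u'Q mQ uu' du du' um u'm nA n'A un u'n' nn').
  + exact: (dif j l u u' m n n').
  + by apply: (dif l j u u' m n n') => //; rewrite eq_sym.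
  exact: (hubfree_class uQ u'Q mQ uu' du du' um u'm nA n'A un u'n' nn').
move=> t Qt; case: attj attl => u uQ uj [u' u'Q u'l].
by case: (no u uQ uj); move: uQ u'Q u'l; rewrite Qt !inE => /eqP-> /eqP->.
Qed.

(** Let [z1] be next to [j] and [l], and [z2] next to [i] and [l]. If they differ, one path between
    them extends both to a path joining [j] to [i] and to one from [l] to [l], which need
    contradictory residues; if their neighbour of colour [l] is the same, there is a path of length
    4 from [j] to [i]. *)
Lemma three_at_once i j l : i != j -> j != l -> i != l ->
  (exists2 u, u \in Q & nb (onclass i) u) -> (exists2 u, u \in Q & nb (onclass j) u) ->
  (exists2 u, u \in Q & nb (onclass l) u) -> i < 3 -> j < 3 -> l < 3 ->
  exists z, [/\ z \in Q, nb (onclass i) z, nb (onclass j) z & nb (onclass l) z].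
Proof.
move=> ij jl il atti attj attl i3 j3 l3.
have [z1 [z1Q z1j z1l]] := two_at_once ij jl il atti attj attl i3 j3 l3.
have ji : j != i by rewrite eq_sym.
have [z2 [z2Q z2i z2l]] := two_at_once ji il jl attj atti attl j3 i3 l3.
case: (eqVneq z1 z2) => [E|z12]; first by subst z2; exists z1.
case/nbP: z1j => nj /onclassP[njK nj_] z1nj; case/nbP: z1l => nl /onclassP[nlK nl_] z1nl.
case/nbP: z2i => ni /onclassP[niK ni_] z2ni; case/nbP: z2l => nl' /onclassP[nl'K nl'_] z2nl'.
have [k P] : exists k, lpath Q z1 z2 k by rewrite QE in z1Q z2Q *; apply: component_conn.
have njz1 : e nj z1 by rewrite eC.
have nlz1 : e nl z1 by rewrite eC.
have h1 := link_diff off_ (inner_ext njK niK (class_onC nj_) (class_onC ni_) (class_neq ji njK nj_ ni_) njz1 z2ni P) nj_ ni_ ji.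
case: (eqVneq nl nl') => [E|nll].
  subst nl'; case: (inner_in z1Q) (inner_in z2Q) => z1K z1N [z2K z2N].
  have nlz2 : e nl z2 by rewrite eC.
  have iN := class_onC ni_; have jN := class_onC nj_; have lN := class_onC nl_.
  have g1 := on_neq iN z1N; have g2 := on_neq iN z2N; have g3 := on_neq jN z1N.
  have g4 := on_neq jN z2N; have g5 := on_neq lN z1N; have g6 := on_neq lN z2N.
  have g7 := class_neq ji njK nj_ ni_; have g8 := class_neq jl njK nj_ nl_.
  have g9 := class_neq il niK ni_ nl_.
  have P4 : lpath K nj ni 4.
    apply: lp_sub (path5 njz1 z1nl nlz2 z2ni _) _; first by rewrite /= !inE; nq.
    by sets.
  by have := link_diff off_ P4 nj_ ni_ ji.
have := link_same off_ (inner_ext nlK nl'K (class_onC nl_) (class_onC nl'_) nll nlz1 z2nl' P) nl_ nl'_ nll.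
by case; move: h1; clear; lia.
Qed.

End InnerComponent.

(** The configuration that [link2_shape] shows to be the whole component. *)
Definition link2 v n n' i j :=
  [/\ v \in K, ~~ onC v, deg v = 2, e v n & e v n'] /\
  [/\ n \in K, n' \in K, nb (class i) n & nb (class j) n'].

Lemma link2_sym v n n' i j : link2 v n n' i j -> link2 v n' n j i.
Proof. by move=> [[? ? ? ? ?] [? ? ? ?]]. Qed.

Lemma link2_inner v n n' i j : i != j -> link2 v n n' i j -> component inner v = [set v].
Proof.
move=> ij [[vK vN dv vn vn'] [nK n'K ni n'j]].
have vI : v \in inner by rewrite inE vK.
apply/esym; apply: (conn_closed eC (z := v) (@component_conn _ _ eC inner v)).
- by rewrite inE.
- by move=> w; rewrite inE => /eqP->; apply: component_id.
move=> y w; rewrite inE => /eqP-> /component_sub/innerP[_ wN] vw.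
by case: (deg2_nb dv vn vn' (class_neq ij nK ni n'j) vw) wN => ->;
  rewrite ?(class_onC ni) ?(class_onC n'j).
Qed.

Lemma link2_exit v n n' i j y L a k : i != j -> link2 v n n' i j ->
  lpath (a |: L) a y k -> y != v -> n \notin L -> n' \notin L -> a != v.
Proof.
move=> ij [[vK vN dv vn vn'] [nK n'K ni n'j]] P yv nL n'L.
apply/eqP => av; subst a; case: k P => [|k] P.
  by move/lp_eq0: P; rewrite eq_sym (negbTE yv).
case/lp_step: P => w [vw]; rewrite in_setU1 => /orP[->//|wL] _ _.
case: (deg2_nb dv vn vn' (class_neq ij nK ni n'j) vw) => E.
  by rewrite -E wL in nL.
by rewrite -E wL in n'L.
Qed.

(** A vertex of a third colour would be reached from one of [n], [n'] and, two edges longer through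
    [v], from the other, though both paths join different colours. *)
Lemma link2_two v n n' i j t : i != j -> link2 v n n' i j ->
  t \in K -> onC t -> nb (class i) t \/ nb (class j) t.
Proof.
move=> ij l2 tK /onCP[l _ tl].
case: (eqVneq l i) => [<-|li]; first by left.
case: (eqVneq l j) => [<-|lj]; first by right.
case: (l2) => [[vK vN dv vn vn'] [nK n'K ni n'j]].
have nn' := class_neq ij nK ni n'j.
have key m m' im im' k : m \in K -> m' \in K -> nb (class im) m -> nb (class im') m' -> m != m' ->
    l != im -> l != im' -> e v m -> e v m' ->
    lpath (m |: (K :\: [set n; v; n'])) m t k -> m' \in [set n; v; n'] -> False.
  move=> mK m'K mi m'i mm' lm lm' vm vm' P m'A.
  have m'v_ : e m' v by rewrite eC.
  have P1 := lp_cons vm _ P; have {}P1 := fun h => lp_cons m'v_ _ (P1 h).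
  have mv := on_neq (class_onC mi) vN; have m'v := on_neq (class_onC m'i) vN.
  have {}P1 : lpath K m' t k.+2.
    apply: lp_sub (P1 _ _) _.
    - by rewrite !in_setU1 in_setD m'A; nq.
    - by memg.
    by move=> w; rewrite !in_setU1 in_setD => H; splith; memg.
  have {}P : lpath K m t k.
    by apply: lp_sub P _ => w; rewrite in_setU1 in_setD => H; splith; memg.
  rewrite eq_sym in lm; rewrite eq_sym in lm'.
  have := link_diff off_ P mi tl lm; have := link_diff off_ P1 m'i tl lm'.
  by clear; lia.
case: (@conn_exit _ e eC K [set n; v; n'] n t) => //; first by rewrite !inE eqxx.
move=> a [k []]; rewrite !inE -!orbA => /or3P[]/eqP-> _ P.
- by case: (key n n' i j k) => //; rewrite !inE eqxx ?orbT.
- suff : v != v by rewrite eqxx.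
  apply: (link2_exit ij l2 P); last by rewrite !inE eqxx ?orbT.
    by apply: on_neq vN; apply: class_onC tl.
  by rewrite !inE eqxx ?orbT.
by case: (key n' n j i k) => //; rewrite 1?eq_sym // !inE eqxx ?orbT.
Qed.

(** On the way from [n'] to [m], let [b] be the first further vertex that sees the cycle; it is
    reached across a component [Q] of [inner]. In every case [Q] is a single vertex. It would have
    two neighbours of colour [j] if [b] had that colour, so [b] has colour [i] and [Q] is the new
    link. *)
Lemma link2_next v n n' i j m : i != j -> link2 v n n' i j ->
  m \in component (K :\ n) v -> nb (class i) m ->
  exists v' m', [/\ link2 v' m' n' i j, m' != n & v' != v].
Proof.
move=> ij l2; have two t := link2_two ij l2 (t := t).
have Cv := link2_inner ij l2.
case: (l2) => [[vK vN dv vn vn'] [nK n'K ni n'j]].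
set Z := component _ _ => mZ mi.
have ZK : {subset Z <= K} by move=> t /component_sub; rewrite !inE => /andP[].
have nZ : n \notin Z by apply/negP => /component_sub; rewrite !inE eqxx.
have nn' := class_neq ij nK ni n'j.
have nN := class_onC ni; have n'N := class_onC n'j; have mN := class_onC mi.
have vZ : v \in Z by apply: component_id; rewrite !inE vK eq_sym (on_neq nN vN).
case: (@conn_exit _ e eC Z [set v; n'] v m) => //; first exact: component_conn.
  by rewrite !inE eqxx.
move=> a [k [aA _ P]].
have an' : a = n'.
  have av : a != v.
    apply: (link2_exit ij l2 P (on_neq mN vN)); first by rewrite !inE (negbTE nZ) andbF.
    by rewrite !inE eqxx orbT.
  by move: aA; rewrite !inE (negbTE av) => /eqP.
subst a => {aA}.
have mn' : m != n' by apply: class_neq ij (ZK _ mZ) mi n'j.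
case: (@lp_hit _ e ([set t in K | onC t] :\ n') _ _ _ _ P).
  by rewrite !inE mn' (ZK _ mZ).
move=> b [k2 []]; rewrite !in_setD1 inE => /and3P[bn' bK bN] bS _ Pb.
have bn : b != n.
  by apply: contraTneq bS => ->; rewrite !inE (negbTE nZ) (negbTE nn') andbF.
have n'b : n' != b by rewrite eq_sym.
case: (inner_link Pb _ n'b n'K bK n'N bN) => [w|q1 [q2 [q1I q2Q n'q1 bq2 q1L]]].
  case: (eqVneq w n') => [->|wn'] H; first by rewrite setU11.
  case: (eqVneq w b) => [->|wb]; first by rewrite !inE eqxx orbT.
  move: H; rewrite !inE (negbTE wn') (negbTE wb) /= => /andP[h /andP[_ wZ]].
  by rewrite (ZK _ wZ) in h *.
have q1v : q1 != v.
  apply: contraTneq q1L => ->.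
  have vb : v == b = false by apply/negbTE; rewrite eq_sym; apply: on_neq bN vN.
  have vn1 : v == n' = false by apply/negbTE; rewrite eq_sym; apply: on_neq n'N vN.
  by rewrite !in_setU1 in_setD in_setU1 in_setD vb vn1 !inE eqxx /= andbF.
set Q := component inner q1 in q2Q.
have q1Q : q1 \in Q by apply: component_id.
have vQ : v \notin Q.
  apply/negP => vQ; have vI : v \in inner by rewrite inE vK.
  have q1v' : q1 \in component inner v.
    have [r R] := component_conn eC vQ q1Q; apply: lp_component R _ => w; exact: component_sub.
  by move: q1v'; rewrite Cv inE (negbTE q1v).
have q1n' : e q1 n' by rewrite eC.
have q2b : e q2 b by rewrite eC.
have adj_i : nb (class i) b -> exists v' m', [/\ link2 v' m' n' i j, m' != n & v' != v].
  move=> bi; case: (two_class (erefl Q) ij).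
  - by exists q2 => //; apply/nbP; exists b => //; rewrite inE bK.
  - by exists q1 => //; apply/nbP; exists n' => //; rewrite inE n'K.
  - by move=> u w uQ uw wK wN; rewrite !inE wK; apply: two.
  move=> t Qt; have q1t : q1 = t by move: q1Q; rewrite Qt inE => /eqP.
  have q2t : q2 = t by move: q2Q; rewrite Qt inE => /eqP.
  subst t; rewrite q2t in q2b; case/innerP: (q1I) => q1K q1N.
  exists q1, b; split=> //; split=> //; split=> //.
  apply: (deg2_only q2b q1n' bn') => w qw.
  have wQ : w \notin Q by rewrite Qt inE eq_sym; apply: adj_neq.
  case: (inner_closed (erefl Q) q1Q qw wQ) => wK wN.
  by case: (two w wK wN) => wc; [left|right];
    [apply: (on_one q1K wK bK wc bi qw q2b)|apply: (on_one q1K wK n'K wc n'j qw q1n')].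
case: (two b bK bN) => // bj.
case: (boolP [exists u in Q, nb (onclass i) u]) => [/existsP[u /andP[uQ ui]]|no].
  case: (two_class (erefl Q) ij).
  - by exists u.
  - by exists q1 => //; apply/nbP; exists n' => //; rewrite inE n'K.
  - by move=> u' w uQ' uw wK wN; rewrite !inE wK; apply: two.
  move=> t Qt; have q1t : q1 = t by move: q1Q; rewrite Qt inE => /eqP.
  have q2t : q2 = t by move: q2Q; rewrite Qt inE => /eqP.
  case/innerP: (q1I) => q1K q1N; subst t; rewrite q2t in q2b.
  by rewrite (on_one q1K bK n'K bj n'j q2b q1n') eqxx in bn'.
have vn1 : e n v by rewrite eC.
(* Here [Q] is next to colour [j] only. The prefix [n - v - n'] turns a path of length [r] in [Q]
   into one of length [r + 4] between colours [i] and [j], so [r] is 1 modulo 3. *)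
case: (@inner_single q1 Q (erefl Q) [set n'] (onclass j :\ n') 1) => //.
- by move=> w; rewrite inE => /eqP->; rewrite inE n'K.
- by move=> w; rewrite in_setD1 => /andP[_ /onclassP[wK wj]]; rewrite inE wK (class_onC wj).
- move=> u w uQ uw wK wN; case: (two w wK wN) => wc; last first.
    by rewrite !inE wK wc; case: eqP; [left|right].
  by case/existsP: no; exists u; rewrite uQ; apply/nbP; exists w; rewrite // inE wK.
- by exists q1 => //; apply/nbP; exists n'; rewrite ?inE.
- by exists q2 => //; apply/nbP; exists b; rewrite // !inE bn' bK.
- move=> n1 n2 u w r; rewrite inE => /eqP-> {n1}; rewrite in_setD1 => /andP[n2n' /onclassP[n2K n2j]] n'u wn2 R.
  rewrite eq_sym in n2n'.
  have R1 := lp_snoc eC (lp_cons n'u _ R) wn2; have {}R1 := fun h1 h2 => lp_cons vn' _ (R1 h1 h2).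
  have {}R1 := fun h1 h2 h3 => lp_cons vn1 _ (R1 h1 h2 h3).
  have n'Q : n' \notin Q by apply/negP => /(inner_in (erefl Q))[_]; rewrite n'N.
  have n2Q : n2 \notin Q by apply/negP => /(inner_in (erefl Q))[_]; rewrite (class_onC n2j).
  have nQ : n \notin Q by apply/negP => /(inner_in (erefl Q))[_]; rewrite nN.
  have nn2 := class_neq ij nK ni n2j.
  have h1 := on_neq n'N vN; have h2 := on_neq nN vN; have h3 := on_neq (class_onC n2j) vN.
  have QK : {subset Q <= K} by move=> t /(inner_in (erefl Q))[].
  have {}R1 : lpath K n n2 r.+4 by apply: lp_sub (R1 _ _ _ _) _; [memg|memg|memg|memg|sets].
  by have := link_diff off_ R1 ni n2j ij; clear; lia.
- exact: onenb1.
- move=> u x x' uQ; rewrite !in_setD1 => /andP[_ xj] /andP[_ x'j].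
  exact: (onenb_class (erefl Q) uQ xj x'j).
- exact: hubfree1.
- move=> u u' m1 n1 n2 uQ u'Q mQ uu' du du' um u'm; rewrite !in_setD1 => /andP[_ xj] /andP[_ x'j].
  exact: (hubfree_class (erefl Q) uQ u'Q mQ uu' du du' um u'm xj x'j).
move=> t Qt; have q1t : q1 = t by move: q1Q; rewrite Qt inE => /eqP.
have q2t : q2 = t by move: q2Q; rewrite Qt inE => /eqP.
case/innerP: (q1I) => q1K q1N; subst t; rewrite q2t in q2b.
by rewrite (on_one q1K bK n'K bj n'j q2b q1n') eqxx in bn'.
Qed.

(** Without colour [i] and, by [link2_two], without a third one, this component is a dead end behind
    [n]; it contains [v] and [n'], so [dead_shape] leaves only the second shape. *)
Lemma link2_dead v n n' i j : i != j -> link2 v n n' i j ->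
  (forall m, m \in component (K :\ n) v -> ~~ nb (class i) m) ->
  component (K :\ n) v = [set n'; v] /\ digon j n'.
Proof.
move=> ij l2 no; have two t := link2_two ij l2 (t := t).
case: (l2) => [[vK vN dv vn vn'] [nK n'K ni n'j]].
have nN := class_onC ni; have n'N := class_onC n'j.
have nv := on_neq nN vN; have nn' := class_neq ij nK ni n'j.
have vZ : v \in component (K :\ n) v by apply: component_id; rewrite !inE vK eq_sym nv.
have n'Z : n' \in component (K :\ n) v.
  by apply: component_closed vZ _ vn'; rewrite !inE n'K eq_sym nn'.
have ZK : {subset component (K :\ n) v <= K} by move=> t /component_sub; rewrite !inE => /andP[].
have B : branch K (class j) (coclass j) by apply: outer_branch; exists n'.
have vn_ : v != n by rewrite eq_sym.
have BZ : branch (component (K :\ n) v) (class j) [set n].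
  apply: (dead_branch B nK vK vn_); [|by exists n'|by exists v].
  move=> t tZ; apply/negP => /coclassP[l lj tl].
  case: (two t (ZK _ tZ) (class_onC tl)) => tc; first by move: (no t tZ); rewrite tc.
  by rewrite (class_excl (off_ (ZK _ tZ)) tl tc) eqxx in lj.
have n'v := on_neq n'N vN.
case: (dead_shape BZ (sub_off off_ ZK)) => t tj [Zt|[w [Zt tw _ _ dt]]].
  by move: vZ n'Z n'v; rewrite Zt !inE => /eqP-> /eqP->; rewrite eqxx.
have tN := class_onC tj; have tv := on_neq tN vN.
have vw : v = w by move: vZ; rewrite Zt !inE eq_sym (negbTE tv) => /eqP.
subst w; have n't : n' = t by move: n'Z; rewrite Zt !inE (negbTE n'v) orbF => /eqP.
by rewrite n't.
Qed.

(** Two links form [n - v - n' - v' - m']. Both ends are digons, since a further link at one of them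
    would give a path of length 6 between colours [i] and [j]. Then [no_two_arms] applies. *)
Lemma link2_shape_side v n n' i j m : i != j -> link2 v n n' i j ->
  m \in component (K :\ n) v -> nb (class i) m -> False.
Proof.
move=> ij l2 mZ mi; have [v' [m' [l2' m'n v'v]]] := link2_next ij l2 mZ mi.
have ji : j != i by rewrite eq_sym.
case: (l2) => [[vK vN dv vn vn'] [nK n'K ni n'j]].
case: (l2') => [[v'K v'N dv' v'm' v'n'] [m'K _ m'i _]].
have dead v1 n1 v2 n2 : link2 v1 n1 n' i j -> link2 v2 n2 n' i j -> n2 != n1 -> v2 != v1 ->
    digon i n1.
  move=> h1 h2 n21 v21.
  case: (@link2_dead v1 n' n1 j i ji (link2_sym h1)) => // t tZ.
  apply/negP => tj.
  have [v3 [b [h3 bn' v31]]] := link2_next ji (link2_sym h1) tZ tj.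
  case: h1 => [[v1K v1N d1 v1n1 v1n'] [n1K _ n1i _]].
  case: h2 => [[v2K v2N d2 v2n2 v2n'] [n2K _ n2i _]].
  case: h3 => [[v3K v3N d3 v3b v3n1] [bK _ bj _]].
  have n1N := class_onC n1i; have n2N := class_onC n2i; have bN := class_onC bj; have n'N := class_onC n'j.
  have g1 := class_neq ij n1K n1i n'j; have g2 := class_neq ij n2K n2i n'j.
  have g3 := class_neq ij n1K n1i bj; have g4 := class_neq ij n2K n2i bj.
  have f1 := on_neq n1N v1N; have f2 := on_neq n1N v2N; have f3 := on_neq n1N v3N.
  have f4 := on_neq n2N v1N; have f5 := on_neq n2N v2N; have f6 := on_neq n2N v3N.
  have f7 := on_neq bN v1N; have f8 := on_neq bN v2N; have f9 := on_neq bN v3N.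
  have f10 := on_neq n'N v1N; have f11 := on_neq n'N v2N; have f12 := on_neq n'N v3N.
  have v32 : v3 != v2.
    apply/eqP => E; subst v3.
    by case: (deg2_nb d2 v2n2 v2n' g2 v3n1) => E; [move: n21|move: g1]; rewrite E eqxx.
  have P : lpath K n2 b 6.
    exists [:: v2; n'; v1; n1; v3; b]; split=> //=.
    - by rewrite ![e _ v2]eC ![e _ v1]eC ![e _ v3]eC v2n2 v2n' v1n' v1n1 v3n1 v3b.
    - by rewrite !inE; nq.
    by sets.
  by have := link_diff off_ P n2i bj ij.
have nN := class_onC ni; have m'N := class_onC m'i; have n'N := class_onC n'j.
have g1 := class_neq ij nK ni n'j; have g2 := class_neq ij m'K m'i n'j.
apply: (@no_two_arms i n v n' v' m') => //; try by rewrite eC.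
- by move=> t; rewrite !inE => H; apply: off_; splith; memg.
- have f1 := on_neq nN vN; have f2 := on_neq nN v'N; have f3 := on_neq m'N vN.
  have f4 := on_neq m'N v'N; have f5 := on_neq n'N vN; have f6 := on_neq n'N v'N.
  by rewrite /= !inE; nq.
- exact: (dead v n v' m').
by apply: (dead v' m' v n) => //; rewrite eq_sym.
Qed.

Lemma link2_shape v n n' i j : i != j -> link2 v n n' i j ->
  [/\ K = [set n; v; n'], digon i n & digon j n'].
Proof.
move=> ij l2; have ji : j != i by rewrite eq_sym.
have [Z1 d1] : component (K :\ n) v = [set n'; v] /\ digon j n'.
  by apply: (link2_dead ij l2) => m mZ; apply/negP => /(link2_shape_side ij l2 mZ).
have [Z2 d2] : component (K :\ n') v = [set n; v] /\ digon i n.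
  apply: (link2_dead ji (link2_sym l2)) => m mZ; apply/negP.
  exact: (link2_shape_side ji (link2_sym l2) mZ).
case: (l2) => [[vK vN dv vn vn'] [nK n'K ni n'j]].
have nv_ : e n v by rewrite eC.
have n'v_ : e n' v by rewrite eC.
have nn' := class_neq ij nK ni n'j.
have nN := class_onC ni; have n'N := class_onC n'j.
have f1 := on_neq nN vN; have f2 := on_neq n'N vN.
have side a b w : component (K :\ a) v = [set b; v] -> b \in K -> a != b -> v != a ->
    w \in K -> e b w -> e b v -> w != a -> w = v.
  move=> Z bK ab va wK bw bv wa; have bZ : b \in component (K :\ a) v by rewrite Z !inE eqxx.
  have: w \in component (K :\ a) v by apply: component_closed bZ _ bw; rewrite !inE wa.
  by rewrite Z !inE eq_sym (negbTE (adj_neq bw)) => /eqP.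
split=> //; apply/esym; apply: (conn_closed eC (z := n) cnK); first by rewrite !inE eqxx.
  by sets.
move=> y w; rewrite !inE -!orbA => /or3P[]/eqP-> wK yw.
- case: (eqVneq w n') => [E|wn']; first by subst w; case: (on_indep nK n'K nN n'N yw).
  by rewrite (side n' n w Z2) ?eqxx ?orbT // eq_sym.
- by case: (deg2_nb dv vn vn' nn' yw) => ->; rewrite eqxx ?orbT.
case: (eqVneq w n) => //= wn.
by rewrite (side n n' w Z1) ?eqxx ?orbT // eq_sym.
Qed.

(** Where a path changes colour: after its last vertex of colour [ia], cut it at the next vertex
    that sees the cycle; the stretch between lies in one component of [inner]. *)
Lemma multi_start : exists n n' i j q1 q2,
  [/\ n \in onclass i, n' \in onclass j, i != j & q1 \in inner] /\
  [/\ q2 \in component inner q1, e n q1 & e n' q2].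
Proof.
have aA : a0 \in onclass ia by rewrite inE a0K.
case: (@conn_exit _ e eC K (onclass ia) a0 b0) => // a [k [{}aA aK P]].
have bA : b0 \in [set t in K | onC t] :\: onclass ia.
  rewrite !inE b0K (class_onC b0i) /= andbT; apply/negP => b0a.
  by move: iab; rewrite (class_excl (off_ b0K) b0a b0i) eqxx.
case: (lp_hit P bA) => b [k2 [bA' bS _ Pb]].
have [bK bN bna] : [/\ b \in K, onC b & ~~ nb (class ia) b].
  by move: bA'; rewrite !inE => /and3P[h bK bN]; rewrite bK in h.
case/onclassP: (aA) => _ aia.
have ab : a != b by apply: contraNneq bna => <-.
case: (inner_link Pb _ ab aK bK (class_onC aia) bN) => [w|q1 [q2 [q1I q2Q aq1 bq2 _]]].
  case: (eqVneq w a) => [->|wa] H; first by rewrite setU11.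
  case: (eqVneq w b) => [->|wb]; first by rewrite !inE eqxx orbT.
  move: H; rewrite !inE (negbTE wa) (negbTE wb) /= => /and3P[h1 h2 h3].
  by rewrite h3 /= in h1 h2 *; rewrite h2 /= in h1.
case/onCP: (bN) => j _ bj; exists a, b, ia, j, q1, q2; split; split=> //.
- by rewrite inE bK.
by apply: contraNneq bna => ->.
Qed.

Lemma multi_shape :
  (exists v n n' i j, i != j /\ link2 v n n' i j) \/
  (exists z, [/\ z \in K, ~~ onC z & forall k, k < 3 -> nb (onclass k) z]).
Proof.
case: multi_start => n [n' [i [j [q1 [q2 [[ni n'j ij q1I] [q2Q nq1 n'q2]]]]]]].
case/onclassP: (ni) => nK ni_; case/onclassP: (n'j) => n'K n'j_.
have i3 := class_lt3 ni_; have j3 := class_lt3 n'j_.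
set Q := component inner q1 in q2Q.
have q1Q : q1 \in Q by apply: component_id.
have atti : exists2 u, u \in Q & nb (onclass i) u.
  by exists q1 => //; apply/nbP; exists n; rewrite // eC.
have attj : exists2 u, u \in Q & nb (onclass j) u.
  by exists q2 => //; apply/nbP; exists n'; rewrite // eC.
have [l [l3 jl il]] : exists l, [/\ l < 3, j != l & i != l].
  by exists (3 - i - j); split; move: i3 j3 ij; clear; lia.
case: (boolP [exists u in Q, nb (onclass l) u]) => [/existsP[u /andP[uQ ul]]|no].
  have attl : exists2 u, u \in Q & nb (onclass l) u by exists u.
  have [z [zQ zi zj zl]] := three_at_once (erefl Q) ij jl il atti attj attl i3 j3 l3.
  case: (inner_in (erefl Q) zQ) => zK zN.
  right; exists z; split=> // k k3.
  have : [|| k == i, k == j | k == l] by move: k3 i3 j3 l3 ij jl il; clear; lia.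
  by case/or3P => /eqP->.
left; case: (two_class (erefl Q) ij atti attj).
  move=> u w uQ uw wK /onCP[k k3 wk].
  have : [|| k == i, k == j | k == l] by move: k3 i3 j3 l3 ij jl il; clear; lia.
  case/or3P => /eqP E; subst k; [by left; rewrite inE wK|by right; rewrite inE wK|].
  by case/existsP: no; exists u; rewrite uQ; apply/nbP; exists w; rewrite // inE wK.
move=> t Qt; have q1t : q1 = t by move: q1Q; rewrite Qt inE => /eqP.
have q2t : q2 = t by move: q2Q; rewrite Qt inE => /eqP.
subst t; rewrite q2t in n'q2; case/innerP: (q1I) => q1K q1N.
have q1n : e q1 n by rewrite eC.
have q1n' : e q1 n' by rewrite eC.
exists q1, n, n', i, j; split=> //; split=> //; split=> //.
apply: (deg2_only q1n q1n' (class_neq ij nK ni_ n'j_)) => w qw.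
have wQ : w \notin Q by rewrite Qt inE eq_sym; apply: adj_neq.
case: (inner_closed (erefl Q) q1Q qw wQ) => wK /onCP[k k3 wk].
have : [|| k == i, k == j | k == l] by move: k3 i3 j3 l3 ij jl il; clear; lia.
case/or3P => /eqP E; subst k.
- by left; apply: (on_one q1K wK nK wk ni_ qw q1n).
- by right; apply: (on_one q1K wK n'K wk n'j_ qw q1n').
by case/existsP: no; exists q1; rewrite q1Q; apply/nbP; exists w; rewrite // inE wK.
Qed.

(** * Components with a centre next to all three colours *)

Section YShape.
Variables (z : T) (uu : nat -> T).
Hypotheses (zK : z \in K) (zN : ~~ onC z).
Hypothesis uuP : forall k, k < 3 -> [/\ uu k \in K, nb (class k) (uu k) & e z (uu k)].
Let D4 : {set T} := [set z; uu 0; uu 1; uu 2].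

Lemma D4P t : reflect (t = z \/ exists2 k, k < 3 & t = uu k) (t \in D4).
Proof.
rewrite !inE -!orbA; apply: (iffP or4P) => [[]/eqP->|[->|[[|[|[|//]]] _ ->]]]; rewrite ?eqxx.
- by left.
- by right; exists 0.
- by right; exists 1.
- by right; exists 2.
- by constructor 1.
- by constructor 2.
- by constructor 3.
by constructor 4.
Qed.

Lemma uu_neq j k : j < 3 -> k < 3 -> j != k -> uu j != uu k.
Proof.
by move=> /uuP[jK jc _] /uuP[_ kc _] jk; apply: class_neq jk jK jc kc.
Qed.

Lemma uu_z j : j < 3 -> uu j != z.
Proof. by case/uuP => _ jc _; apply: on_neq zN; apply: class_onC jc. Qed.

(** Let [M] be a component of [K] beyond the star. If [M] sees the cycle, it does so in one colour
    [a] and touches the star only in [uu a]; both shapes of [dead_shape] then fail by [on_indep] and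
    [on_one]. If not, it has two attachments in the star, and [branch_single] makes it one vertex,
    against the lengths or the absence of 4-cycles. *)
Lemma y_shape : K = D4.
Proof.
apply/esym; apply: (conn_closed eC (z := z) cnK); first by rewrite !inE eqxx.
  by move=> w /D4P[->//|[k /uuP[kK _ _] ->]].
move=> y g yD gK yg; apply: contraT => gD.
set M := component (K :\: D4) g.
have gM : g \in M by apply: component_id; rewrite in_setD gD.
have MK : {subset M <= K} by move=> w /component_sub; rewrite in_setD => /andP[].
have MD w : w \in M -> w \notin D4 by move/component_sub; rewrite in_setD => /andP[].
have cM : conn M by apply: component_conn.
have zM : z \notin M by apply/negP => /MD/negP; apply; apply/D4P; left.
have uM k : k < 3 -> uu k \notin M.
  by move=> k3; apply/negP => /MD/negP; apply; apply/D4P; right; exists k.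
have Mcl a w : a \in M -> e a w -> w \notin M -> w \in D4 \/ w \in s.
  move=> aM aw wM; case: (boolP (w \in K)) => wK; last first.
    by right; apply: (ou_closed oK (MK _ aM) aw wK).
  left; apply: contraT => wD; case/negP: wM; apply: component_closed aM _ aw.
  by rewrite in_setD wD.
have uz k : k < 3 -> e (uu k) z by case/uuP => _ _; rewrite eC.
have third a j : exists l, [/\ l < 3, l != a & l != j].
  by case: a j => [|[|a]] [|[|j]]; first [by exists 0; split|by exists 1; split|by exists 2; split].
case: (boolP [exists m in M, onC m]) => [/existsP[m /andP[mM mN]]|no].
  (* A path entering [M] from [z] can be started at [uu a] and at another leaf with equal length;
     one entering from [uu j] with [j != a] can also be started at the third leaf, two edges
     earlier. Both pairs have incompatible residues. *)
  have att t d m' a : t \in M -> d \in D4 -> e d t -> m' \in M -> nb (class a) m' -> d = uu a.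
    move=> tM /D4P dD dt m'M m'a; have a3 := class_lt3 m'a.
    have [k P] := cM _ _ tM m'M; have m'K := MK _ m'M.
    case: dD => [dz|[j j3 dj]]; subst d.
      have ext j : j < 3 -> lpath K (uu j) m' k.+2.
        move=> j3; have ujM := uM _ j3; have ujz := uu_z j3; case: (uuP j3) => ujK _ _.
        by apply: lp_sub (lp_cons (uz _ j3) _ (lp_cons dt zM P)) _; [memg|sets].
      have [l [l3 la _]] := third a a; case: (uuP l3) => _ lc _; case: (uuP a3) => aK ac _.
      have am' : uu a != m' by apply: contraTneq m'M => <-; apply: uM.
      case: (link_same off_ (ext _ a3) ac m'a am').
      exact: link_diff off_ (ext _ l3) lc m'a la.
    case: (eqVneq j a) => [->//|ja].
    have [l [l3 la lj]] := third a j; case: (uuP l3) => lK lc zl; case: (uuP j3) => jK jc zj.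
    have P1 := lp_cons dt (uM _ j3) P.
    have P2 := lp_cons zj _ P1; have {}P2 := fun h => lp_cons (uz _ l3) _ (P2 h).
    have h1 := uu_z l3; have h2 := uu_z j3; have h3 := uM _ l3; have h4 := uM _ j3.
    have h5 := uu_neq l3 j3 lj.
    have {}P2 : lpath K (uu l) m' k.+3 by apply: lp_sub (P2 _ _) _; [memg|memg|sets].
    have {}P1 : lpath K (uu j) m' k.+1 by apply: lp_sub P1 _; sets.
    have := link_diff off_ P1 jc m'a ja; have := link_diff off_ P2 lc m'a la.
    by clear; lia.
  case/onCP: (mN) => a a3 ma; case: (uuP a3) => aK ac za.
  have ya := att _ _ _ _ gM yD yg mM ma.
  have same m' b : m' \in M -> nb (class b) m' -> b = a.
    move=> m'M m'b; have b3 := class_lt3 m'b.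
    have := att _ _ _ _ gM yD yg m'M m'b; rewrite ya => E.
    by apply/eqP; apply: contraT => ba; have := uu_neq b3 a3 ba; rewrite E eqxx.
  have [l [l3 la _]] := third a a; case: (uuP l3) => lK lc zl.
  have B : branch M (class a) [set uu a].
    split=> //.
    - by move=> w /MK /(ou_sub oK).
    - by move=> w /MK /off_ ws /classP[]; rewrite (negbTE ws).
    - by move=> w wM; rewrite inE => /eqP E; rewrite E (negbTE (uM _ a3)) in wM.
    - move=> b w bM bw /(Mcl _ _ bM bw)[wD|ws].
        by right; rewrite inE; rewrite eC in bw; rewrite (att _ _ _ _ bM wD bw mM ma).
      left; rewrite inE ws /=; apply/eqP; apply: same bM _; apply/nbP; exists w => //.
      by rewrite inE ws /=.
    - by exists m.
    - by exists g => //; apply/nbP; exists y; rewrite ?ya ?inE // eC -ya.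
    have ext u v k : nb (class a) u -> nb [set uu a] v -> lpath M u v k -> k %% 3 = 2.
      move=> ua /nbP[t]; rewrite inE => /eqP-> va P; have uK := MK _ (lp_fst P).
      have P1 := lp_snoc eC P va; have {}P1 := fun h => lp_snoc eC (P1 h) (uz _ a3).
      have {}P1 := fun h h' => lp_snoc eC (P1 h h') zl.
      have h1 := uu_z l3; have h2 := uu_z a3; have h3 := uM _ l3; have h4 := uM _ a3.
      have h5 := uu_neq l3 a3 la.
      have {}P1 : lpath K u (uu l) k.+3 by apply: lp_sub (P1 _ _ _) _; [memg|memg|memg|sets].
      rewrite eq_sym in la.
      by have := link_diff off_ P1 ua lc la; clear; lia.
    move=> u v k u' v' k' ua va P u'a v'a P'.
    by rewrite (ext _ _ _ ua va P) (ext _ _ _ u'a v'a P').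
  case: (dead_shape B (sub_off off_ MK)) => n na [Mn|[v [Mn nv [nv_ va] dv _]]].
    have gn : g = n by move: gM; rewrite Mn inE => /eqP.
    subst n; case: (on_indep aK gK (class_onC ac) (class_onC na)).
    by rewrite -ya.
  have nK : n \in K by apply: MK; rewrite Mn !inE eqxx.
  have vK : v \in K by apply: MK; rewrite Mn !inE eqxx orbT.
  have vn : e v n by rewrite eC.
  have E := on_one vK nK aK na ac vn va.
  by have := uM _ a3; rewrite -E Mn !inE eqxx.
have {}no w : w \in M -> ~~ onC w.
  by move=> wM; apply: contra no => wN; apply/existsP; exists w; rewrite wM.
have {}Mcl a w : a \in M -> e a w -> w \notin M -> w \in D4.
  move=> aM aw wM; case: (Mcl _ _ aM aw wM) => // ws.
  by case/negP: (no _ aM); apply/nbP; exists w; rewrite ?inE.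
have other d : d \in D4 -> d \notin M -> exists t d', [/\ t \in M, d' \in D4, e t d' & d' != d].
  move=> dD dM; case: (boolP [exists t in M, exists d' in D4, e t d' && (d' != d)]).
    by case/existsP => t /andP[tM /existsP[d' /and3P[? ? ?]]]; exists t, d'.
  move=> nod; have MS : {subset M <= S} by move=> w /MK /(ou_sub oK).
  have := cut gM MS dM; case/nbP: a0i => x /classP[xs _] a0x.
  have xS : x \in S by rewrite eC in a0x; apply: supp a0x.
  move=> H; have : x \in d |: M.
    apply: H xS => a w aM aw wM; apply/eqP; apply: contraNT nod => wd.
    apply/existsP; exists a; rewrite aM; apply/existsP; exists w.
    by rewrite (Mcl _ _ aM aw wM) aw.
  rewrite in_setU1 => /orP[/eqP xd|/MK/off_]; last by rewrite xs.
  have : d \in K by case/D4P: dD => [->//|[k /uuP[? _ _] ->]].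
  by rewrite -xd => /off_; rewrite xs.
pose U : {set T} := [set uu 0; uu 1; uu 2].
have UP t : reflect (exists2 k, k < 3 & t = uu k) (t \in U).
  rewrite !inE -!orbA; apply: (iffP or3P) => [[]/eqP->|[[|[|[|//]]] _ ->]]; rewrite ?eqxx.
  - by exists 0.
  - by exists 1.
  - by exists 2.
  - by constructor 1.
  - by constructor 2.
  by constructor 3.
have oneU : onenb M U.
  move=> w x x' wM /UP[k k3 ->] /UP[l l3 ->] wk wl.
  case: (eqVneq k l) => [->//|kl]; case: (uuP k3) => _ _ zk; case: (uuP l3) => _ _ zl.
  case: (@noC4 z (uu k) w (uu l)) => //; rewrite 1?eC //; last exact: uu_neq.
  by apply: contraNneq zM => ->.
have hubU : hubfree M U.
  move=> u u' m n n' uM_ u'M mM uu' du du' um u'm /UP[k k3 ->] /UP[l l3 ->] uk u'l.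
  case: (eqVneq k l) => [->|kl _]; first by rewrite eqxx.
  case: (uuP k3) => kK kc _; case: (uuP l3) => lK lc _.
  have f1 := on_neq (class_onC kc) (no _ uM_); have f2 := on_neq (class_onC kc) (no _ u'M).
  have f3 := on_neq (class_onC kc) (no _ mM); have f4 := on_neq (class_onC lc) (no _ uM_).
  have f5 := on_neq (class_onC lc) (no _ u'M); have f6 := on_neq (class_onC lc) (no _ mM).
  have f7 := uu_neq k3 l3 kl; have f8 := adj_neq um; have f9 := adj_neq u'm.
  have ku : e (uu k) u by rewrite eC.
  have mu' : e m u' by rewrite eC.
  have uK := MK _ uM_; have u'K := MK _ u'M; have mK := MK _ mM.
  have P : lpath K (uu k) (uu l) 4.
    by apply: lp_sub (path5 ku um mu' u'l _) _; [rewrite /= !inE; nq|sets].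
  by have := link_diff off_ P kc lc kl.
have UM w : w \in M -> w \in U -> False.
  by move=> wM /UP[k k3 E]; move: (uM _ k3); rewrite -E wM.
have MS : {subset M <= S} by move=> w /MK /(ou_sub oK).
case: (boolP [exists t in M, e t z]) => [/existsP[t /andP[tM tz]]|noz].
  have zD : z \in D4 by apply/D4P; left.
  have [t' [d [t'M dD t'd dz]]] := other z zD zM.
  have dU : d \in U by case/D4P: dD dz => [->|[k k3 ->]]; rewrite ?eqxx // => _; apply/UP; exists k.
  have ext u v k : nb [set z] u -> nb U v -> lpath M u v k -> k %% 3 = 2.
    case/nbP => z' ; rewrite inE => /eqP-> uz_ /nbP[x /UP[j j3 ->] vj] P.
    have [l [l3 lj _]] := third j j; case: (uuP l3) => lK lc zl; case: (uuP j3) => jK jc zj.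
    rewrite eC in uz_.
    have P1 := lp_snoc eC (lp_cons uz_ zM P) vj; have {}P1 := fun h => lp_cons (uz _ l3) _ (P1 h).
    have h1 := uu_z l3; have h2 := uu_z j3; have h3 := uM _ l3; have h4 := uM _ j3.
    have h5 := uu_neq l3 j3 lj.
    have {}P1 : lpath K (uu l) (uu j) k.+3 by apply: lp_sub (P1 _ _) _; [memg|memg|sets].
    by have := link_diff off_ P1 lc jc lj; clear; lia.
  case: (@branch_single M [set z] U) => //.
  - split=> //.
    + by move=> w wM; rewrite inE => /eqP E; rewrite E (negbTE zM) in wM.
    + move=> a w aM aw wM; case/D4P: (Mcl _ _ aM aw wM) => [->|[k k3 ->]]; first by left; rewrite inE.
      by right; apply/UP; exists k.
    + by exists t => //; apply/nbP; exists z; rewrite ?inE.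
    + by exists t' => //; apply/nbP; exists d.
    move=> u v k u' v' k' ua va P u'a v'a P'.
    by rewrite (ext _ _ _ ua va P) (ext _ _ _ u'a v'a P').
  - exact: onenb1.
  - exact: hubfree1.
  move=> v Mv; have vt : t = v by move: tM; rewrite Mv inE => /eqP.
  have vt' : t' = v by move: t'M; rewrite Mv inE => /eqP.
  subst t t'; have P : lpath M v v 0 by apply: lp0; rewrite Mv inE.
  have vz : nb [set z] v by apply/nbP; exists z; rewrite ?inE.
  have vU : nb U v by apply/nbP; exists d.
  by have := ext _ _ _ vz vU P.
have yU : y \in U.
  case/D4P: yD => [yz|[k k3 ->]]; last by apply/UP; exists k.
  by case/existsP: noz; exists g; rewrite gM eC -yz.
case/UP: (yU) => a a3 ya; case: (uuP a3) => aK ac za.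
have [t' [d [t'M dD t'd dy]]] := other (uu a) ltac:(by rewrite -ya) (uM _ a3).
have dU : d \in U :\ uu a.
  rewrite in_setD1 dy /=; case/D4P: dD => [dz|[k k3 ->]]; last by apply/UP; exists k.
  by case/existsP: noz; exists t'; rewrite t'M -dz.
have ext u v k : nb [set uu a] u -> nb (U :\ uu a) v -> lpath M u v k -> k %% 3 = 0.
  case/nbP => z' ; rewrite inE => /eqP-> ua_ /nbP[x]; rewrite in_setD1 => /andP[xa /UP[j j3 xj]] vj P.
  subst x; have ja : a != j by apply: contraNneq xa => ->.
  case: (uuP j3) => jK jc zj; rewrite eC in ua_.
  have h3 := uM _ j3; have h4 := uM _ a3.
  have P1 : lpath K (uu a) (uu j) k.+2.
    by apply: lp_sub (lp_snoc eC (lp_cons ua_ h4 P) vj _) _; [memg|sets].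
  by have := link_diff off_ P1 ac jc ja; clear; lia.
case: (@branch_single M [set uu a] (U :\ uu a)) => //.
- split=> //.
  + by move=> w wM; rewrite inE => /eqP E; rewrite E (negbTE (uM _ a3)) in wM.
  + by move=> w wM; rewrite in_setD1 => /andP[_ /(UM _ wM)].
  + move=> b w bM bw wM; case/D4P: (Mcl _ _ bM bw wM) => [wz|[k k3 wk]].
      by case/existsP: noz; exists b; rewrite bM -wz.
    rewrite in_setD1 inE; case: (eqVneq w (uu a)) => /= _; first by left.
    by right; apply/UP; exists k.
  + by exists g => //; apply/nbP; exists y; rewrite ?ya ?inE // eC -ya.
  + by exists t' => //; apply/nbP; exists d.
  move=> u v k u' v' k' ua va P u'a v'a P'.
  by rewrite (ext _ _ _ ua va P) (ext _ _ _ u'a v'a P').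
- exact: onenb1.
- by move=> u x x' uM_; rewrite !in_setD1 => /andP[_ xU] /andP[_ x'U]; apply: oneU.
- exact: hubfree1.
- move=> u u' m n n' uM_ u'M mM uu' du du' um u'm; rewrite !in_setD1 => /andP[_ xU] /andP[_ x'U].
  exact: (hubU u u' m).
move=> v Mv; have gv : g = v by move: gM; rewrite Mv inE => /eqP.
have vt' : t' = v by move: t'M; rewrite Mv inE => /eqP.
subst g t'; move: dU; rewrite in_setD1 => /andP[da dU].
have va : e v (uu a) by rewrite eC -ya.
have aU : uu a \in U by rewrite -ya.
by rewrite (oneU v d (uu a)) ?eqxx // in da.
Qed.

End YShape.

End MultiColour.

Lemma multi_cases K a0 b0 ia ib : outer K -> a0 \in K -> b0 \in K -> ia != ib ->
  nb (class ia) a0 -> nb (class ib) b0 ->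
  (exists v n n' i j, [/\ i != j, link2 K v n n' i j, K = [set n; v; n'], digon i n & digon j n'])
  \/ (exists z uu, [/\ z \in K, ~~ onC z,
       forall k, k < 3 -> [/\ uu k \in K, nb (class k) (uu k) & e z (uu k)]
     & K = [set z; uu 0; uu 1; uu 2]]).
Proof.
move=> oK a0K b0K iab a0i b0i.
case: (multi_shape oK a0K b0K iab a0i b0i) => [[v [n [n' [i [j [ij l2]]]]]]|[z [zK zN zc]]].
  left; exists v, n, n', i, j.
  by case: (link2_shape oK a0K b0K iab a0i b0i ij l2).
right; have get k : k < 3 -> exists u, [/\ u \in K, nb (class k) u & e z u].
  by move=> /zc/nbP[u]; rewrite inE => /andP[uK uk] zu; exists u.
case: (get 0 isT) => u0 P0; case: (get 1 isT) => u1 P1; case: (get 2 isT) => u2 P2.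
pose uu k := if k is 0 then u0 else if k is 1 then u1 else u2.
have uuP k : k < 3 -> [/\ uu k \in K, nb (class k) (uu k) & e z (uu k)].
  by case: k => [|[|[|//]]].
exists z, uu; split=> //.
exact: (y_shape oK a0K b0K iab a0i b0i zK zN uuP).
Qed.

(** * Shapes that force a cycle of length 6 *)

Lemma class_cyc i x : x \in class i -> exists a, [/\ a < ell, a %% 3 = i & x = c a].
Proof.
case/classP => xs xi; exists (index x s); split=> //; first by rewrite index_mem.
by rewrite cyc_index.
Qed.

Lemma cyc_class a : a < ell -> c a \in class (a %% 3).
Proof. by move=> al; rewrite inE cyc_in //= /col index_cyc. Qed.

Lemma nb_cyc i n : nb (class i) n -> exists a, [/\ a < ell, a %% 3 = i & e n (c a)].
Proof. by case/nbP => x /class_cyc[a [al ai ->]] nx; exists a. Qed.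

Lemma digonP i n : digon i n ->
  exists a a', [/\ a < a', a' < ell, a %% 3 = i, a' %% 3 = i & e n (c a) /\ e n (c a')].
Proof.
case=> x [x' [/class_cyc[a [al ai ->]] /class_cyc[b [bl bi ->]] ab na nb_]].
case: (ltngtP a b) => [lt|gt|E]; last by rewrite E eqxx in ab.
- by exists a, b.
by exists b, a.
Qed.

(** The path closes with arcs of lengths [d] and [ell - d] to cycles of lengths [d + 4] and
    [ell - d + 4]. The one that is a multiple of 3 must be at least [ell], which leaves 1 or 4 steps
    from [a] to [b] around the cycle. *)
Lemma near K n n' a b : off K -> lpath K n n' 2 -> a < ell -> b < ell ->
  e n (c a) -> e n' (c b) -> (a + 1) %% 3 = b %% 3 ->
  [\/ a + 1 = b, a + 4 = b, a + 1 = b + ell | a + 4 = b + ell].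
Proof.
move=> oK P al bl na n'b ab.
have: [|| a + 1 == b, a + 4 == b, a + 1 == b + ell | a + 4 == b + ell].
  case: (ltngtP a b) => [lt|gt|E]; last by move: ab; rewrite E; clear; lia.
  - case: (link_ok oK P na n'b lt bl) => _ [_ o].
    by move: o lt al bl ab s0; clear; lia.
  case: (link_ok oK (lp_sym eC P) n'b na gt al) => [[_ o] _].
  by move: o gt al bl ab s0; clear; lia.
by case/or4P => /eqP; [constructor 1|constructor 2|constructor 3|constructor 4].
Qed.

(** By [near], both neighbours of [n'] come 1 or 4 steps after each neighbour of [n]; so the latter
    are 3 steps apart in either direction. *)
Lemma digon_pair K i j n n' : off K -> lpath K n n' 2 -> digon i n -> digon j n' ->
  (i + 1) %% 3 = j -> ell = 6.
Proof.
move=> oK P /digonP[a [a' [aa a'l ai a'i [na na']]]] /digonP[b [b' [bb b'l bi b'i [nb_ nb']]]] ij.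
have al : a < ell by apply: ltn_trans a'l.
have bl : b < ell by apply: ltn_trans b'l.
have N1 := near oK P al bl na nb_ ltac:(by move: ai bi ij; clear; lia).
have N2 := near oK P al b'l na nb' ltac:(by move: ai b'i ij; clear; lia).
have N3 := near oK P a'l bl na' nb_ ltac:(by move: a'i bi ij; clear; lia).
have N4 := near oK P a'l b'l na' nb' ltac:(by move: a'i b'i ij; clear; lia).
move: (size s) al bl a'l b'l s0 N1 N2 N3 N4 aa bb; clear => l al bl a'l b'l l0 N1 N2 N3 N4 aa bb.
by case: N1 => ?; case: N4 => ?; case: N2 => ?; case: N3 => ?; lia.
Qed.

Lemma digon_ell i n : digon i n -> 6 <= ell.
Proof. by case/digonP => a [a' [aa a'l ai a'i _]]; move: aa a'l ai a'i s0; clear; lia. Qed.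

Hypothesis star3 : forall z, deg z = 3 -> (forall u, e z u -> deg u = 2) -> False.
Hypothesis fold : forall v a b z, deg v = 2 -> e v a -> e v b -> a != b -> deg a = 3 ->
  e a z -> z != v -> z != b -> exists y, [/\ e b y, e z y, y != v & y != a].

Lemma cyc_adj a y : a < ell -> e (c a) y -> y \in s ->
  exists b, [/\ b < ell, y = c b &
    [|| a + 1 == b, b + 1 == a, (a == 0) && (b == ell.-1) | (b == 0) && (a == ell.-1)]].
Proof.
move=> al ay ys; exists (index y s).
have yb : y = c (index y s) by rewrite cyc_index.
have bl : index y s < ell by rewrite index_mem.
split=> //; rewrite yb in ay; move: (index y s) bl ay => b bl ab {yb}.
case: (ltngtP a b) => [lt|gt|E]; last by rewrite E eI in ab.
  by case: (chord_free lt bl ab) => [->|[-> ->]]; rewrite ?addn1 ?eqxx ?orbT.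
rewrite eC in ab.
by case: (chord_free gt al ab) => [->|[-> ->]]; rewrite ?addn1 ?eqxx ?orbT.
Qed.

Section YFinal.
Variables (K : {set T}) (z : T) (uu : nat -> T).
Hypotheses (oK : outer K) (zK : z \in K) (zN : ~~ onC z).
Hypothesis uuP : forall k, k < 3 -> [/\ uu k \in K, nb (class k) (uu k) & e z (uu k)].
Hypothesis KE : K = [set z; uu 0; uu 1; uu 2].

Lemma in_y t : t \in K -> t = z \/ exists2 k, k < 3 & t = uu k.
Proof.
rewrite KE !inE -!orbA => /or4P[]/eqP->; first by left.
- by right; exists 0.
- by right; exists 1.
by right; exists 2.
Qed.

Lemma y_neq j k : j < 3 -> k < 3 -> j != k -> uu j != uu k.
Proof.
case/uuP => jK jc _ /uuP[kK kc _]; apply: contraNneq => E; rewrite -E in kc.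
by apply/eqP; apply: class_excl (ou_off oK jK) jc kc.
Qed.

Lemma y_path j k : j < 3 -> k < 3 -> j != k -> lpath K (uu j) (uu k) 2.
Proof.
move=> j3 k3 jk; case: (uuP j3) => jK jc zj; case: (uuP k3) => kK kc zk.
have jz : e (uu j) z by rewrite eC.
by apply: lp_sub (path3 jz zk (y_neq j3 k3 jk)) _; sets.
Qed.

Lemma y_nbz t : e z t -> exists2 k, k < 3 & t = uu k.
Proof.
move=> zt; case: (boolP (t \in K)) => [/in_y[E|//]|tK]; first by rewrite E eI in zt.
by case/negP: zN; apply/nbP; exists t; rewrite // inE (ou_closed oK zK zt tK).
Qed.

Lemma y_degz : deg z = 3.
Proof.
rewrite /deg; suff -> : [set y | e z y] = [set uu 0; uu 1; uu 2].
  by rewrite -setUA cardsU1 cards2 !inE negb_or !y_neq.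
apply/setP => t; rewrite !inE; apply/idP/idP.
  by case/y_nbz => [[|[|[|//]]] _ ->]; rewrite eqxx ?orbT.
by rewrite -!orbA => /or3P[]/eqP->; [case: (uuP (k := 0))|case: (uuP (k := 1))|case: (uuP (k := 2))].
Qed.

Lemma y_nbu k t : k < 3 -> e (uu k) t -> t = z \/ t \in class k.
Proof.
move=> k3 ut; case: (uuP k3) => uK uc zu.
case: (boolP (t \in K)) => [/in_y[->|[j j3 E]]|tK]; first by left.
  subst t; case: (uuP j3) => jK jc zj.
  have [kj|kj] := eqVneq k j; first by rewrite kj eI in ut.
  have P : lpath K (uu k) (uu j) 1 by apply: edge_path.
  by have := link_diff (ou_off oK) P uc jc kj.
right; have ts := ou_closed oK uK ut tK; rewrite inE ts /=.
apply/eqP; apply: class_excl (ou_off oK uK) _ uc; apply/nbP; exists t => //.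
by rewrite inE ts /=.
Qed.

Lemma y_digon k : k < 3 -> digon k (uu k) \/ deg (uu k) = 2.
Proof.
move=> k3; case: (uuP k3) => uK uc zu.
have uz : e (uu k) z by rewrite eC.
case: (eqVneq (deg (uu k)) 2) => [|d2]; [by right|left].
case/nbP: uc => x xk ux.
have [t [ut tx tz]] : exists t, [/\ e (uu k) t, t != x & t != z].
  by apply: deg_gt2; rewrite ltn_neqAle eq_sym d2 deg_ge2 // (ou_sub oK uK).
exists x, t; split=> //; last by rewrite eq_sym.
by case: (y_nbu k3 ut) => // E; rewrite E eqxx in tz.
Qed.

(** By [star3] some [uu l] is a digon, and two digons suffice by [digon_pair]. If [uu i] and [uu j]
    have degree 2, [fold] at [uu i] finds neighbours of [uu j] and [uu l] on either side of the
    neighbour [c p] of [uu i], and [near] closes the cycle after 6 steps. *)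
Lemma y_ell : ell = 6 /\ exists2 k, k < 3 & digon k (uu k).
Proof.
have two i j : i < 3 -> j < 3 -> i != j -> digon i (uu i) -> digon j (uu j) -> ell = 6.
  move=> i3 j3 ij di dj.
  have: ((i + 1) %% 3 == j) || ((j + 1) %% 3 == i) by move: i3 j3 ij; clear; lia.
  case/orP => /eqP E; first exact: digon_pair (ou_off oK) (y_path i3 j3 ij) di dj E.
  rewrite eq_sym in ij; exact: digon_pair (ou_off oK) (y_path j3 i3 ij) dj di E.
have [l l3 dl] : exists2 l, l < 3 & digon l (uu l).
  case: (@y_digon 0) => // d0; first by exists 0.
  case: (@y_digon 1) => // d1; first by exists 1.
  case: (@y_digon 2) => // d2; first by exists 2.
  by case: (star3 y_degz) => u /y_nbz[[|[|[|//]]] _ ->].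
split; last by exists l.
pose i := (l + 1) %% 3; pose j := (l + 2) %% 3.
have [i3 j3] : i < 3 /\ j < 3 by rewrite !ltn_pmod.
have [ij il jl] : [/\ i != j, i != l & j != l].
  by rewrite /i /j; split; move: l3; clear; lia.
case: (y_digon i3) => di; first exact: two i3 l3 il di dl.
case: (y_digon j3) => dj; first exact: two j3 l3 jl dj dl.
have ell6 := digon_ell dl.
case: (uuP i3) => iK ic zi; case: (uuP j3) => jK jc zj; case: (uuP l3) => lK lc zl.
have iz : e (uu i) z by rewrite eC.
have jz : e (uu j) z by rewrite eC.
case: (nb_cyc ic) => p [pl pi ip]; case: (nb_cyc jc) => q [ql qj jq].
have off_z k : k < ell -> z != c k.
  move=> kl; apply: contraTneq (cyc_in kl) => <-; exact: (ou_off oK zK).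
have off_u m k : m < 3 -> k < ell -> uu m != c k.
  move=> m3 kl; apply: contraTneq (cyc_in kl) => <-; case: (uuP m3) => mK _ _; exact: (ou_off oK mK).
have get m m' b : m < 3 -> m' < 3 -> m != m' -> deg (uu m) = 2 -> b < ell -> e (uu m) (c b) ->
    exists r, [/\ r < ell, r %% 3 = m', e (uu m') (c r) &
      [|| b + 1 == r, r + 1 == b, (b == 0) && (r == ell.-1) | (r == 0) && (b == ell.-1)]].
  move=> m3 m'3 mm' dm bl mb; case: (uuP m3) => _ _ zm; case: (uuP m'3) => _ _ zm'.
  have mz : e (uu m) z by rewrite eC.
  have m'm : uu m' != uu m by rewrite eq_sym y_neq.
  case: (fold dm mz mb (off_z _ bl) y_degz zm' m'm (off_u _ _ m'3 bl)) => y [by_ m'y _ yz].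
  case: (y_nbu m'3 m'y) => [E|yc]; first by rewrite E eqxx in yz.
  case: (cyc_adj bl by_ (proj1 (classP yc))) => r [rl yr adj].
  exists r; split=> //; last by rewrite -yr.
  by move/classP: yc => [_]; rewrite yr /col index_cyc.
have li : l != i by rewrite eq_sym.
have lj : l != j by rewrite eq_sym.
case: (get i j p i3 j3 ij di pl ip) => q' [q'l q'j jq' a1].
have qq : q' = q.
  apply: cyc_inj => //; case: (deg2_nb dj jz jq (off_z _ ql) jq') => // E.
  by move: (off_z _ q'l); rewrite E eqxx.
subst q'.
case: (get i l p i3 l3 il di pl ip) => r [rl rl_ lr a2].
have N := near (ou_off oK) (y_path j3 l3 jl) ql rl jq lr.
move: ell6 pl ql rl pi qj rl_ a1 a2 s0 l3 N; rewrite /i /j; move: (size s) => L; clear.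
move=> ell6 pl ql rl pi qj rl_ a1 a2 s0 l3 N.
have {}N : [\/ q + 1 = r, q + 4 = r, q + 1 = r + L | q + 4 = r + L] by apply: N; lia.
by case: N => ?; lia.
Qed.
End YFinal.

(** * Degree sums and the list of components off the cycle *)

Hypothesis dense : 3 * (#|S| - 1) + 3 * ((#|S| - 1) %/ 9) < \sum_(x in S) deg x.

Lemma cyc_S x : x \in s -> x \in S.
Proof.
move=> xs; rewrite -(cyc_index xs); have il : index x s < ell by rewrite index_mem.
case: (ltnP (index x s).+1 ell) => [lt|ge]; first exact: supp (cyc_step lt).
have -> : index x s = ell.-1 by move: il ge; clear; lia.
exact: supp cyc_wrap.
Qed.

Lemma outer_comp u : u \in S -> u \notin s ->
  outer (component (S :\: [set x in s]) u) /\ u \in component (S :\: [set x in s]) u.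
Proof.
move=> uS us_; split; last by apply: component_id; rewrite !inE us_.
split.
- exact: component_conn.
- by move=> w /component_sub; rewrite !inE => /andP[].
- by move=> w /component_sub; rewrite !inE => /andP[].
move=> a w aC aw wC; apply: contraT => ws; case/negP: wC.
have wS : w \in S by move: aw; rewrite eC; apply: supp.
by apply: component_closed aC _ aw; rewrite !inE ws.
Qed.

Lemma outer_eq K K' w : outer K -> outer K' -> w \in K -> w \in K' -> K = K'.
Proof.
have key L L' : outer L -> outer L' -> w \in L -> w \in L' -> L :&: L' = L'.
  move=> oL oL' wL wL'; apply: (conn_closed eC (z := w) (ou_conn oL')).
  - by rewrite inE wL.
  - by move=> t; rewrite inE => /andP[].
  move=> y t; rewrite !inE => /andP[yL _] tL' yt; rewrite tL' andbT.
  by apply: contraT => /(ou_closed oL yL yt); rewrite (negbTE (ou_off oL' tL')).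
by move=> oK oK' wK wK'; rewrite -(key K' K) // setIC (key K K').
Qed.

(** With all attachments at one vertex [y], [cut] would put every vertex of the cycle into [K] or at
    [y]. *)
Lemma outer_two K u : outer K -> u \in K ->
  exists n n' x x', [/\ n \in K, n' \in K, e n x, e n' x' & x != x'] /\ (x \in s /\ x' \in s).
Proof.
move=> oK uK.
have find y : y \in s -> exists n x, [/\ n \in K, e n x, x \in s & x != y].
  move=> ys; case: (boolP [exists n in K, exists x in [set x in s], e n x && (x != y)]).
    case/existsP => n /andP[nK /existsP[x]]; rewrite inE => /and3P[xs nx xy].
    by exists n, x.
  move=> no; have yK : y \notin K by apply/negP => /(ou_off oK); rewrite ys.
  have H := cut uK (ou_sub oK) yK.
  have [t ts ty] : exists2 t, t \in s & t != y.
    have l0 : 0 < ell by apply: ltn_trans s3.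
    have l1 : 1 < ell by apply: ltn_trans s3.
    case: (eqVneq (c 0) y) => [E|]; last by exists (c 0) => //; apply: cyc_in.
    exists (c 1); first exact: cyc_in.
    by rewrite -E; apply/eqP => /(cyc_inj l1 l0).
  have : t \in y |: K.
    apply: H (cyc_S ts) => a w aK aw wK; apply/eqP; apply: contraNT no => wy.
    apply/existsP; exists a; rewrite aK; apply/existsP; exists w.
    by rewrite inE (ou_closed oK aK aw wK) aw.
  by rewrite in_setU1 (negbTE ty) => /(ou_off oK); rewrite ts.
have l0 : 0 < ell by apply: ltn_trans s3.
case: (find (c 0) (cyc_in l0)) => n [x [nK nx xs _]].
case: (find x xs) => n' [x' [n'K n'x' x's xx']].
by exists n, n', x, x'; split=> //; split=> //; rewrite eq_sym.
Qed.

Lemma outer_cases K u : outer K -> u \in K ->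
  [\/ exists2 i, i < 3 & forall t, t \in K -> onC t -> nb (class i) t,
      exists v n n' i j, [/\ i != j, link2 K v n n' i j, K = [set n; v; n'], digon i n & digon j n']
    | exists z uu, [/\ z \in K, ~~ onC z,
       forall k, k < 3 -> [/\ uu k \in K, nb (class k) (uu k) & e z (uu k)]
     & K = [set z; uu 0; uu 1; uu 2]]].
Proof.
move=> oK uK; case: (outer_two oK uK) => n [_ [x [_ [[nK _ nx _ _] [xs _]]]]].
have ni : nb (class (col x)) n by apply/nbP; exists x; rewrite // inE xs /=.
case: (boolP [exists t in K, onC t && ~~ nb (class (col x)) t]) => [/existsP[t /and3P[tK tN tx]]|no].
  case/onCP: tN => j _ tj.
  have ij : col x != j by apply: contraNneq tx => ->.
  by case: (multi_cases oK nK tK ij ni tj) => H; [constructor 2|constructor 3].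
constructor 1; exists (col x); first exact: class_lt3 ni.
by move=> t tK tN; apply: contraNT no => tx; apply/existsP; exists t; rewrite tK tN.
Qed.

Lemma card_sum A m : (forall x, x \in A -> deg x <= m) -> \sum_(x in A) deg x <= m * #|A|.
Proof.
move=> H; rewrite mulnC -sum_nat_const; exact: leq_sum.
Qed.

(** For 10 vertices [dense] asks for more than 30. In the other case three vertices of degree at
    most 2 lower the sum to [3 * (#|S| - 1)]. *)
Lemma count_lt : (forall x, x \in S -> deg x <= 3) -> #|S| <= 10 ->
  #|S| = 10 \/ (exists A, [/\ {subset A <= S}, 3 <= #|A| & forall x, x \in A -> deg x <= 2]) -> False.
Proof.
move=> d3 S10 H.
have le3 := card_sum d3.
case: H => [S10'|[A [AS A3 dA]]].
  by move: dense le3; rewrite S10'; clear; lia.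
have : \sum_(x in S) deg x + #|A| <= 3 * #|S|.
  have -> : #|A| = \sum_(x in S) (x \in A : nat).
    rewrite -sum1_card [RHS]big_mkcond [LHS]big_mkcond; apply: eq_bigr => x _ /=.
    by case: (boolP (x \in A)) => [/AS->|_] //; case: ifP.
  rewrite -big_split /= mulnC -sum_nat_const; apply: leq_sum => x xS.
  by case: (boolP (x \in A)) => [/dA|_]; rewrite ?addn1 // addn0 d3.
have : (#|S| - 1) %/ 9 * 9 <= #|S| - 1 by apply: leq_trunc_div.
by move: dense le3 S10 A3; clear; lia.
Qed.

(** * Cycles of length 6 *)

Section SixCycle.
Hypothesis ell6 : ell = 6.

Lemma adj6 p q : p < 6 -> q < 6 ->
  [|| q == p + 1, p == q + 1, (p == 0) && (q == 5) | (p == 5) && (q == 0)] -> e (c p) (c q).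
Proof.
move=> p6 q6; have w := cyc_wrap; rewrite ell6 /= in w.
have st i : i < 5 -> e (c i) (c i.+1) by move=> i5; apply: cyc_step; rewrite ell6.
case/or4P => [/eqP E|/eqP E|/andP[/eqP-> /eqP->]|/andP[/eqP-> /eqP->]//].
- by rewrite E addn1; apply: st; move: q6; rewrite E addn1.
- by rewrite E addn1 eC; apply: st; move: p6; rewrite E addn1.
by rewrite eC.
Qed.

Lemma class6 i x : x \in class i -> i < 3 /\ (x = c i \/ x = c (i + 3)).
Proof.
case/class_cyc => a [al ai ->]; rewrite ell6 in al.
have i3 : i < 3 by rewrite -ai ltn_pmod.
split=> //; have : (a == i) || (a == i + 3) by move: al ai; clear; lia.
by case/orP => /eqP->; [left|right].
Qed.

Lemma c6_neq p q : p < 6 -> q < 6 -> p != q -> c p != c q.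
Proof. by move=> p6 q6 pq; apply: contra pq => /eqP/cyc_inj E; apply/eqP; apply: E; rewrite ell6. Qed.

Lemma class6_mem p : p < 6 -> c p \in class (p %% 3).
Proof. by move=> p6; apply: cyc_class; rewrite ell6. Qed.

Lemma c6_in p : p < 6 -> c p \in s.
Proof. by move=> p6; apply: cyc_in; rewrite ell6. Qed.

Lemma digon6 i n : digon i n -> [/\ i < 3, e n (c i) & e n (c (i + 3))].
Proof.
case=> x [x' [/class6[i3 xE] /class6[_ x'E] xx' nx nx']]; split=> //.
  by case: xE x'E => [<-//|E] [<-//|E']; rewrite E E' eqxx in xx'.
by case: xE x'E => [E|<-//] [E'|<-//]; rewrite E E' eqxx in xx'.
Qed.

(** The path closes through [n] to a cycle of length [k + 2]. *)
Lemma digon_blocks i n L k : n \notin s -> n \notin L -> digon i n ->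
  lpath L (c i) (c (i + 3)) k -> 0 < k -> k %% 3 <> 2.
Proof.
move=> ns nL /digon6[i3 ni ni3] P k0.
have := lp_good (lp_cons ni nL P); rewrite eC => /(_ ni3 k0); clear; lia.
Qed.

(** A path of length [r] in [K] from a neighbour of [c i] to one of [c (i + 3)] closes with an arc
    and with the path in [L], so neither [r] nor [r + k] is 2 modulo 3. This fixes [r], and
    [branch_single] applies; the single vertex has [r = 0], which leaves [k] congruent to 1. *)
Lemma mono_single i K u L k : outer K -> u \in K -> i < 3 ->
  (forall t, t \in K -> onC t -> nb (class i) t) ->
  lpath L (c i) (c (i + 3)) k -> (forall w, w \in L -> w \in K -> False) -> k %% 3 <> 0 ->
  [/\ k %% 3 = 1 & exists v, [/\ K = [set v], digon i v & deg v = 2]].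
Proof.
move=> oK uK i3 mono P dis k0.
have i6 : i < 6 by apply: leq_trans i3 _.
have i36 : i + 3 < 6 by rewrite -[6]/(3 + 3) ltn_add2r.
have ne : c i != c (i + 3) by apply: c6_neq => //; clear; lia.
have cl t x : t \in K -> e t x -> x \in s -> x = c i \/ x = c (i + 3).
  move=> tK tx xs; have tN : onC t by apply/nbP; exists x; rewrite ?inE.
  have tx' : nb (class (col x)) t by apply/nbP; exists x; rewrite // inE xs /=.
  have E := class_excl (ou_off oK tK) tx' (mono t tK tN).
  by case: (@class6 i x); rewrite // inE xs E /=.
have [[n nK ni] [n' n'K ni']] : (exists2 n, n \in K & e n (c i)) /\ (exists2 n, n \in K & e n (c (i + 3))).
  case: (outer_two oK uK) => n [n' [x [x' [[nK n'K nx n'x' xx'] [xs x's]]]]].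
  case: (cl n x nK nx xs) (cl n' x' n'K n'x' x's) => E [E'|E']; subst.
  - by rewrite eqxx in xx'.
  - by split; [exists n|exists n'].
  - by split; [exists n'|exists n].
  by rewrite eqxx in xx'.
have len a b r : e a (c i) -> e b (c (i + 3)) -> lpath K a b r -> r %% 3 <> 2 /\ (r + k) %% 3 <> 2.
  move=> ai bi R; split.
    case: (link_col (ou_off oK) R (c6_in i6) (c6_in i36) ai bi) => _ H _.
    apply: H => //; rewrite /col !index_cyc ?ell6 //; by clear; lia.
  have ib : e (c (i + 3)) b by rewrite eC.
  have R' := lp_cat P ib (lp_sym eC R) dis.
  have := lp_good R' ai.
  have k1 : 0 < k by move: k0; clear; lia.
  move=> /(_ ltac:(by move: k1; clear; lia)); clear; lia.
have [v Kv] : exists v, K = [set v].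
  apply: (@branch_single K [set c i] [set c (i + 3)]).
  - split.
    + exact: ou_conn oK.
    + exact: ou_sub oK.
    + by move=> w /(ou_off oK) ws; rewrite inE => /eqP E; rewrite E c6_in in ws.
    + by move=> w /(ou_off oK) ws; rewrite inE => /eqP E; rewrite E c6_in in ws.
    + move=> a w aK aw /(ou_closed oK aK aw) ws; rewrite !inE.
      by case: (cl a w aK aw ws) => ->; rewrite eqxx; [left|right].
    + by exists n => //; apply/nbP; exists (c i); rewrite ?inE.
    + by exists n' => //; apply/nbP; exists (c (i + 3)); rewrite ?inE.
    move=> a b r a' b' r' /nbP[x]; rewrite inE => /eqP-> ai /nbP[y]; rewrite inE => /eqP-> bi R.
    move=> /nbP[x']; rewrite inE => /eqP-> a'i /nbP[y']; rewrite inE => /eqP-> b'i R'.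
    have := len _ _ _ ai bi R; have := len _ _ _ a'i b'i R'.
    by move: k0; clear; lia.
  - exact: onenb1.
  - exact: onenb1.
  - exact: hubfree1.
  exact: hubfree1.
have nv : n = v by move: nK; rewrite Kv inE => /eqP.
have nv' : n' = v by move: n'K; rewrite Kv inE => /eqP.
subst n n'; have vs := ou_off oK nK.
have [_ H] := len _ _ _ ni ni' (lp0 e nK); split; first by move: H k0; clear; lia.
exists v; split=> //.
  exists (c i), (c (i + 3)); split=> //.
    by have := class6_mem i6; rewrite modn_small.
  by have := class6_mem i36; rewrite modnDr modn_small.
apply: (deg2_only ni ni' ne) => x vx.
have xK : x \notin K by rewrite Kv inE eq_sym; apply: adj_neq.
exact: cl nK vx (ou_closed oK nK vx xK).
Qed.

Lemma C6_card : #|[set x in s]| = 6.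
Proof. by rewrite cardsE; move/card_uniqP: us => ->. Qed.

Lemma cyc_nb6 p t : p < 6 -> e (c p) t -> t \in s -> t = c ((p + 1) %% 6) \/ t = c ((p + 5) %% 6).
Proof.
move=> p6 pt ts; have pl : p < ell by rewrite ell6.
case: (cyc_adj pl pt ts) => b [bl -> adj]; rewrite ell6 in bl adj.
have : (b == (p + 1) %% 6) || (b == (p + 5) %% 6) by move: p6 bl adj; clear; lia.
by case/orP => /eqP->; [left|right].
Qed.

Lemma deg_c6 p t : p < 6 -> (forall u, e (c p) u -> u \notin s -> u = t) -> deg (c p) <= 3.
Proof.
move=> p6 H; rewrite /deg.
apply: leq_trans (subset_leq_card (_ : _ \subset [set c ((p + 1) %% 6); c ((p + 5) %% 6); t])) _.
  apply/subsetP => u; rewrite !inE => pu; case: (boolP (u \in s)) => us_.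
    by case: (cyc_nb6 p6 pu us_) => ->; rewrite eqxx ?orbT.
  by rewrite (H u pu us_) eqxx orbT.
by rewrite -setUA cardsU1 cards2; case: (_ \notin _); case: (_ != _).
Qed.

Lemma deg_c6_2 p : p < 6 -> (forall u, e (c p) u -> u \in s) -> deg (c p) <= 2.
Proof.
move=> p6 H; rewrite /deg.
apply: leq_trans (subset_leq_card (_ : _ \subset [set c ((p + 1) %% 6); c ((p + 5) %% 6)])) _.
  apply/subsetP => u; rewrite !inE => pu.
  by case: (cyc_nb6 p6 pu (H _ pu)) => ->; rewrite eqxx ?orbT.
by rewrite cards2; case: (_ != _).
Qed.

Lemma nb_cp u p : p < 6 -> e (c p) u -> nb (class (p %% 3)) u.
Proof. by move=> p6 pu; apply/nbP; exists (c p); rewrite ?class6_mem // eC. Qed.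

Lemma s6P x : x \in s -> exists2 p, p < 6 & x = c p.
Proof. by move=> xs; exists (index x s); rewrite ?cyc_index // -ell6 index_mem. Qed.


Lemma off_neq t p : t \notin s -> p < 6 -> t != c p.
Proof. by move=> ts p6; apply: contraNneq ts => ->; apply: c6_in. Qed.

Lemma digon_path i n : n \notin s -> digon i n ->
  lpath [set c i; n; c (i + 3)] (c i) (c (i + 3)) 2.
Proof.
move=> ns /digon6[i3 ni ni3]; rewrite eC in ni; apply: path3 => //.
by apply: c6_neq; move: i3; clear; lia.
Qed.

Section NoY.
Variables (K : {set T}) (z : T) (uu : nat -> T).
Hypotheses (oK : outer K) (zK : z \in K) (zN : ~~ onC z).
Hypothesis uuP : forall k, k < 3 -> [/\ uu k \in K, nb (class k) (uu k) & e z (uu k)].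
Hypothesis KE : K = [set z; uu 0; uu 1; uu 2].

(** The path is [c a], [uu i], [z], [uu j], [c b] and the vertex opposite [c a], which is next to
    one of the two neighbours of [uu j] on the cycle. *)
Lemma y_long i j a : i < 3 -> j < 3 -> i != j -> a < 6 -> a %% 3 = i -> e (uu i) (c a) ->
  digon j (uu j) -> lpath (K :|: [set x in s]) (c a) (c ((a + 3) %% 6)) 5.
Proof.
move=> i3 j3 ij a6 ai ia /digon6[_ jj jj3].
have [b [b6 jb adj]] : exists b, [/\ b < 6, e (uu j) (c b) & e (c b) (c ((a + 3) %% 6))].
  case: (boolP [|| (a + 3) %% 6 == j + 1, j == (a + 3) %% 6 + 1,
       (j == 0) && ((a + 3) %% 6 == 5) | (j == 5) && ((a + 3) %% 6 == 0)]) => H.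
    by exists j; split=> //; [move: j3; clear; lia|apply: adj6 => //; move: j3; clear; lia].
  exists (j + 3); split=> //; first by move: j3; clear; lia.
  by apply: adj6; move: i3 j3 ij a6 ai H; clear; lia.
have a'6 : (a + 3) %% 6 < 6 by rewrite ltn_pmod.
have ba' : b != (a + 3) %% 6 by apply: contraTneq adj => ->; rewrite eI.
have ba : b != a.
  have jbc : nb (class (b %% 3)) (uu j) by apply/nbP; exists (c b); rewrite ?class6_mem.
  case: (uuP j3) => jK jc _; have E := class_excl (ou_off oK jK) jbc jc.
  by move: E ij ai; clear; lia.
have aa' : a != (a + 3) %% 6 by move: a6; clear; lia.
case: (uuP i3) => iK _ zi; case: (uuP j3) => jK _ zj.
have n1 := off_neq (ou_off oK iK) a6; have n2 := off_neq (ou_off oK iK) b6.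
have n3 := off_neq (ou_off oK iK) a'6; have n4 := off_neq (ou_off oK jK) a6.
have n5 := off_neq (ou_off oK jK) b6; have n6 := off_neq (ou_off oK jK) a'6.
have n7 := off_neq (ou_off oK zK) a6; have n8 := off_neq (ou_off oK zK) b6.
have n9 := off_neq (ou_off oK zK) a'6.
have m1 := c6_neq b6 a'6 ba'; have m2 := c6_neq b6 a6 ba; have m3 := c6_neq a6 a'6 aa'.
have m4 := y_neq oK uuP i3 j3 ij; have m5 := adj_neq zi; have m6 := adj_neq zj.
have q1 := c6_in a6; have q2 := c6_in b6; have q3 := c6_in a'6.
exists [:: uu i; z; uu j; c b; c ((a + 3) %% 6)]; split=> //=.
- by rewrite eC ia [e (uu i) z]eC zi zj jb adj.
- by rewrite !inE; nq.
by move=> w; rewrite !inE => H; splith; memg.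
Qed.

(** Length 2 through a digon, or 5 by [y_long]. Through [digon_blocks] and [mono_single] this
    residue excludes every other component. *)
Lemma y_walk i : i < 3 -> exists k, [/\ lpath (K :|: [set x in s]) (c i) (c (i + 3)) k, 0 < k & k %% 3 = 2].
Proof.
move=> i3; case: (uuP i3) => iK ic zi.
have fromdigon : digon i (uu i) -> exists k, [/\ lpath (K :|: [set x in s]) (c i) (c (i + 3)) k, 0 < k & k %% 3 = 2].
  move=> di; exists 2; split=> //; apply: lp_sub (digon_path (ou_off oK iK) di) _.
  have q1 : c i \in s by apply: c6_in; move: i3; clear; lia.
  have q2 : c (i + 3) \in s by apply: c6_in; move: i3; clear; lia.
  by sets.
case: (y_ell oK zK zN uuP KE) => _ [j j3 dj].
case: (eqVneq i j) => [E|ij]; first by apply: fromdigon; rewrite E.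
case: (nb_cyc ic) => a [al ai ia]; rewrite ell6 in al.
have P := y_long i3 j3 ij al ai ia dj.
exists 5; split=> //.
have: (a == i) || (a == i + 3) by move: al ai; clear; lia.
case/orP => /eqP E; move: P; rewrite E.
  by have -> : (i + 3) %% 6 = i + 3 by move: i3; clear; lia.
by have -> : (i + 3 + 3) %% 6 = i by [move: i3; clear; lia]; apply: lp_sym.
Qed.

Lemma y_all u : u \in S -> u \notin s -> u \in K.
Proof.
move=> uS us_; case: (outer_comp uS us_); move: (component _ _) => K' oK' uK'.
apply: contraT => uK.
have dis w : w \in K :|: [set x in s] -> w \in K' -> False.
  rewrite !inE => /orP[wK|ws] wK'; last by move: (ou_off oK' wK'); rewrite ws.
  by move: uK; rewrite (outer_eq oK oK' wK wK') uK'.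
have kill i n : n \in K' -> digon i n -> False.
  move=> nK' di; case/digon6: (di) => i3 _ _; case: (y_walk i3) => k [P k0 k2].
  have nL : n \notin K :|: [set x in s] by apply/negP => /dis; apply.
  exact: (digon_blocks (ou_off oK' nK') nL di P k0 k2).
case: (outer_cases oK' uK') => [[i i3 mono]|[v [n [n' [i [j [_ _ KE' di _]]]]]]|[z' [u' [z'K z'N u'P KE']]]].
- case: (y_walk i3) => k [P k0 k2].
  by case: (mono_single oK' uK' i3 mono P dis) => [|E _]; [rewrite k2|rewrite k2 in E].
- by case: (kill i n _ di); rewrite KE' !inE eqxx.
case: (y_ell oK' z'K z'N u'P KE') => _ [j j3 dj].
by case: (u'P j j3) => jK _ _; case: (kill j _ jK dj).
Qed.

(** The cycle and the star are all of [S]: 10 vertices of degree at most 3, as in the Petersen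
    graph, which does not exceed the bound. *)
Lemma no_Y : False.
Proof.
have SE : S = [set x in s] :|: K.
  apply/setP => x; rewrite in_setU inE; case: (boolP (x \in s)) => xs; first by rewrite cyc_S.
  by apply/idP/idP => [/y_all|/(ou_sub oK)]; [apply|].
have cK : #|K| = 4.
  have zu k : k < 3 -> z != uu k by case/uuP => _ _; apply: adj_neq.
  rewrite KE -!setUA !cardsU1 cards1 !inE !negb_or !zu //.
  by rewrite !(y_neq oK uuP).
have S10 : #|S| = 10.
  rewrite SE cardsU C6_card cK; have -> : [set x in s] :&: K = set0; last by rewrite cards0.
  by apply/setP => x; rewrite !inE; apply/negP => /andP[xs /(ou_off oK)]; rewrite xs.
apply: count_lt; [|by rewrite S10|by left].
move=> x; rewrite SE in_setU inE => /orP[/s6P[p p6 ->]|/(in_y KE)[->|[k k3 ->]]].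
- apply: (deg_c6 (t := uu (p %% 3))) => // u pu us_.
  have uS : u \in S by rewrite eC in pu; apply: supp pu.
  have up := nb_cp p6 pu.
  case/(in_y KE): (y_all uS us_) => [E|[k k3 E]]; subst u.
    by case/negP: zN; apply: class_onC up.
  by case: (uuP k3) => kK kc _; rewrite (class_excl (ou_off oK kK) up kc).
- by rewrite (y_degz oK zK zN uuP KE).
rewrite /deg; apply: leq_trans (subset_leq_card (_ : _ \subset [set z; c k; c (k + 3)])) _.
  apply/subsetP => t; rewrite !inE => /(y_nbu oK uuP KE k3)[->|/class6[_ [->|->]]];
  by rewrite eqxx ?orbT.
by rewrite -setUA cardsU1 cards2; case: (_ \notin _); case: (_ != _).
Qed.
End NoY.

(** * Two digons of different colours at a 6-cycle *)

Section TwoDigons.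
Variables (M A : {set T}) (n n' : T) (i j : nat).
Hypotheses (ij : i != j) (di : digon i n) (dj : digon j n').
Hypotheses (nM : n \in M) (n'M : n' \in M) (oM : off M) (MS : {subset M <= S}).
Hypothesis Mcl : forall u w, u \in M -> e u w -> w \notin M -> w \in s.
Hypothesis Mon : forall t, t \in M -> onC t -> t = n \/ t = n'.
Hypotheses (Md : forall t, t \in M -> deg t <= 3) (AM : {subset A <= M}).
Hypothesis Ad : forall t, t \in A -> deg t <= 2.
(** The two uses: a path component of 3 vertices with its middle in [A], or two single vertices of
    degree 2. *)
Hypothesis MA : #|M| = 3 /\ #|A| = 1 \/ #|M| = 2 /\ #|A| = 2.
Let l := 3 - i - j.

Lemma td_third : [/\ i < 3, j < 3, l < 3, l != i & l != j].
Proof.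
case/digon6: di => i3 _ _; case/digon6: dj => j3 _ _.
by rewrite /l; split=> //; move: i3 j3 ij; clear; lia.
Qed.

(** Through [n], whose neighbours [c i] and [c (i + 3)] are adjacent on the cycle to [c l] and
    [c (l + 3)] in one order or the other. *)
Lemma td_path : lpath (n |: [set x in s]) (c l) (c (l + 3)) 4.
Proof.
case: td_third => i3 j3 l3 li lj; case/digon6: di => _ ni ni3.
have [a [a' [[a6 a'6 aa' la a'l] [na na']]]] : exists a a', [/\ a < 6, a' < 6, a != a', e (c l) (c a) & e (c a') (c (l + 3))]
    /\ [/\ e n (c a) & e n (c a')].
  case: (boolP [|| i == l + 1, l == i + 1, (l == 0) && (i == 5) | (l == 5) && (i == 0)]) => H.
    exists i, (i + 3); split=> //; split=> //; rewrite ?adj6 //; try (by move: i3 j3 l3 li lj H; clear; lia).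
  exists (i + 3), i; split=> //; split=> //; rewrite ?adj6 //; try (by move: i3 j3 l3 li lj H; clear; lia).
have l6 : l < 6 by move: l3; clear; lia.
have l36 : l + 3 < 6 by move: l3; clear; lia.
have ll : l != l + 3 by clear; lia.
have cla a0 : e n (c a0) -> a0 < 6 -> a0 != l /\ a0 != l + 3.
  move=> na0 a06; have nc : nb (class (a0 %% 3)) n by apply/nbP; exists (c a0); rewrite ?class6_mem.
  have nc' : nb (class i) n.
    by apply/nbP; exists (c i) => //; have := @class6_mem i; rewrite modn_small //; apply; move: i3; clear; lia.
  have E := class_excl (oM nM) nc nc'.
  by split; move: E a06 l3 li i3; clear; lia.
case: (cla a na a6) => al al3; case: (cla a' na' a'6) => a'l_ a'l3.
have ns := oM nM.
have h1 := off_neq ns a6; have h2 := off_neq ns a'6; have h3 := off_neq ns l6; have h4 := off_neq ns l36.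
have h5 := c6_neq l6 l36 ll; have h6 := c6_neq a6 a'6 aa'; have h7 := c6_neq a6 l6 al.
have h8 := c6_neq a6 l36 al3; have h9 := c6_neq a'6 l6 a'l_; have h10 := c6_neq a'6 l36 a'l3.
have an : e (c a) n by rewrite eC.
apply: lp_sub (path5 la an na' a'l _) _; first by rewrite /= !inE; nq.
have q1 := c6_in a6; have q2 := c6_in a'6; have q3 := c6_in l6; have q4 := c6_in l36.
by sets.
Qed.

(** Further components meet paths of length 2 through [n] and [n'] in colours [i] and [j], and of
    length 4 through [n] in colour [l]; only a single vertex at colour [l] is compatible with
    them. *)
Lemma td_rest u : u \in S -> u \notin s -> u \notin M -> digon l u /\ deg u = 2.
Proof.
move=> uS us_ uM; case: (outer_comp uS us_); move: (component _ _) => K oK uK.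
case: td_third => i3 j3 l3 li lj.
have disM w : w \in K -> w \in M -> False.
  move=> wK wM; case/negP: uM.
  suff E : K :&: M = K by move: uK; rewrite -E inE => /andP[].
  apply: (conn_closed eC (z := w) (ou_conn oK)); first by rewrite inE wK.
    by move=> t; rewrite inE => /andP[].
  move=> y t; rewrite !inE => /andP[yK yM] tK yt; rewrite tK /=.
  by apply: contraT => /(Mcl yM yt); rewrite (negbTE (ou_off oK tK)).
have dis2 m n0 : m < 3 -> n0 \in M -> forall w, w \in [set c m; n0; c (m + 3)] -> w \in K -> False.
  move=> m3 n0M w; rewrite !inE -orbA => /or3P[]/eqP-> wK.
  - by move: (ou_off oK wK); rewrite c6_in //; move: m3; clear; lia.
  - exact: disM wK n0M.
  by move: (ou_off oK wK); rewrite c6_in //; move: m3; clear; lia.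
have kill n1 m : n1 \in K -> digon m n1 -> m != i /\ m != j.
  move=> n1K dm.
  have gen m' n0 : m' < 3 -> n0 \in M -> digon m' n0 -> m != m'.
    move=> m'3 n0M dm'; apply/eqP => E; subst m'.
    have nL : n1 \notin [set c m; n0; c (m + 3)] by apply/negP => H; apply: (dis2 m n0 m'3 n0M n1 H).
    exact: (digon_blocks (ou_off oK n1K) nL dm (digon_path (oM n0M) dm') isT erefl).
  by split; [apply: (gen _ _ _ _ di)|apply: (gen _ _ _ _ dj)].
case: (outer_cases oK uK) => [[m m3 mono]|[v [n1 [n2 [i' [j' [ij' _ KE di' dj']]]]]]|[z' [u' [z'K z'N u'P KE']]]].
- have gen m' n0 : m' < 3 -> n0 \in M -> digon m' n0 -> m <> m'.
    move=> m'3 n0M dm' E; subst m'.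
    by case: (mono_single oK uK m3 mono (digon_path (oM n0M) dm') (dis2 _ _ m3 n0M)).
  have mi := gen _ _ i3 nM di; have mj := gen _ _ j3 n'M dj.
  have ml : m = l by move: mi mj m3 i3 j3 ij; rewrite /l; clear; lia.
  subst m; case: (mono_single oK uK l3 mono td_path) => //.
    move=> w; rewrite !inE => /orP[/eqP->|ws] wK; first exact: disM wK nM.
    by move: (ou_off oK wK); rewrite ws.
  by move=> _ [v [Kv dv d2]]; move: uK; rewrite Kv inE => /eqP->.
- have [a1 a2] : i' != i /\ i' != j by apply: (kill n1 _ _ di'); rewrite KE !inE eqxx.
  have [b1 b2] : j' != i /\ j' != j by apply: (kill n2 _ _ dj'); rewrite KE !inE eqxx !orbT.
  case/digon6: di' => i'3 _ _; case/digon6: dj' => j'3 _ _.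
  by exfalso; move: ij ij' a1 a2 b1 b2 i'3 j'3 i3 j3; clear; lia.
by case: (no_Y oK z'K z'N u'P KE').
Qed.

Lemma digon_nb m t : digon m t -> nb (class m) t.
Proof. by case=> x [_ [xm _ _ tx _]]; apply/nbP; exists x. Qed.

Lemma td_off p u : p < 6 -> e (c p) u -> u \notin s ->
  [\/ p %% 3 = i /\ u = n, p %% 3 = j /\ u = n' | [/\ p %% 3 = l, u \notin M & u \in S]].
Proof.
move=> p6 pu us_; have up := nb_cp p6 pu.
have uS : u \in S by rewrite eC in pu; apply: supp pu.
case: (boolP (u \in M)) => uM.
  case: (Mon uM (class_onC up)) => E; [constructor 1|constructor 2]; split=> //; rewrite {}E in us_ up.
    exact: class_excl us_ up (digon_nb di).
  exact: class_excl us_ up (digon_nb dj).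
constructor 3; split=> //; case: (td_rest uS us_ uM) => dl _.
exact: class_excl us_ up (digon_nb dl).
Qed.

(** Two such vertices would form a 4-cycle with [c l] and [c (l + 3)]. *)
Lemma td_uniq u u' : u \in S -> u \notin s -> u \notin M -> u' \in S -> u' \notin s -> u' \notin M -> u = u'.
Proof.
move=> uS us_ uM u'S u's u'M; apply/eqP; apply: contraT => uu'.
case: (td_rest uS us_ uM) => /digon6[l3 u1 u2] _; case: (td_rest u'S u's u'M) => /digon6[_ u'1 u'2] _.
case: (@noC4 u (c l) u' (c (l + 3))) => //; rewrite 1?eC //.
by apply: c6_neq; move: l3; clear; lia.
Qed.

(** A further vertex either brings the total to 10 or is a third vertex of degree 2 besides [A];
    without one, [c l] and [c (l + 3)] have degree 2. *)
Lemma two_digons : False.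
Proof.
case: td_third => i3 j3 l3 li lj.
have ne : #|[set x in s] :|: M| = 6 + #|M|.
  rewrite cardsU C6_card; have -> : [set x in s] :&: M = set0; last by rewrite cards0 subn0.
  by apply/setP => x; rewrite !inE; apply/negP => /andP[xs /oM]; rewrite xs.
have cn p t : p < 6 -> (forall u, e (c p) u -> u \notin s -> u \notin M -> u \in S -> u = t) -> deg (c p) <= 3.
  move=> p6 H; case: (eqVneq (p %% 3) i) => [pi|pi]; last case: (eqVneq (p %% 3) j) => [pj|pj].
  - apply: (deg_c6 (t := n)) => // u pu us_; case: (td_off p6 pu us_) => [[_ //]|[E _]|[E _ _]].
    + by move: E ij pi; clear; lia.
    by move: E li pi; clear; lia.
  - apply: (deg_c6 (t := n')) => // u pu us_; case: (td_off p6 pu us_) => [[E _]|[_ //]|[E _ _]].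
    + by move: E pi; clear; lia.
    by move: E lj pj; clear; lia.
  apply: (deg_c6 (t := t)) => // u pu us_; case: (td_off p6 pu us_) => [[E _]|[E _]|[_ uM uS]].
  - by move: E pi; clear; lia.
  - by move: E pj; clear; lia.
  exact: H.
case: (boolP [exists v in S, (v \notin s) && (v \notin M)]) => [/existsP[v /and3P[vS vs vM]]|no].
  case: (td_rest vS vs vM) => _ dv.
  have SE : S = v |: ([set x in s] :|: M).
    apply/setP => x; rewrite !inE; apply/idP/idP.
      move=> xS; case: (boolP (x \in s)) => xs; first by rewrite orbT.
      case: (boolP (x \in M)) => xM; first by rewrite !orbT.
      by rewrite (td_uniq xS xs xM vS vs vM) eqxx.
    by case/or3P => [/eqP->//|/cyc_S|/MS].
  have Sc : #|S| = 7 + #|M| by rewrite SE cardsU1 ne !inE negb_or vs vM.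
  apply: count_lt.
  - move=> x; rewrite SE !inE => /or3P[/eqP->|/s6P[p p6 ->]|/Md//]; first by rewrite dv.
    by apply: (cn p v) => // u pu us_ uM uS; apply: td_uniq.
  - by rewrite Sc; case: MA => -[-> _].
  case: MA => -[cM cA]; [left|right]; first by rewrite Sc cM.
  exists (v |: A); split.
  - by move=> x; rewrite !inE => /orP[/eqP->//|/AM/MS].
  - rewrite cardsU1 cA; have -> // : v \notin A by apply: contra vM; apply: AM.
  by move=> x; rewrite !inE => /orP[/eqP->|/Ad//]; rewrite dv.
have {}no x : x \in S -> x \notin s -> x \in M.
  by move=> xS xs; apply: contraR no => xM; apply/existsP; exists x; rewrite xS xs.
have SE : S = [set x in s] :|: M.
  apply/setP => x; rewrite !inE; apply/idP/idP.
    by move=> xS; case: (boolP (x \in s)) => xs //=; apply: no.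
  by case/orP => [/cyc_S|/MS].
apply: count_lt.
- move=> x; rewrite SE !inE => /orP[/s6P[p p6 ->]|/Md//].
  by apply: (cn p n) => // u pu us_ uM uS; rewrite (no _ uS us_) in uM.
- by rewrite SE ne; case: MA => -[-> _].
right.
have dl p : p < 6 -> p %% 3 = l -> deg (c p) <= 2.
  move=> p6 pl; apply: deg_c6_2 => // u pu; apply: contraT => us_.
  case: (td_off p6 pu us_) => [[E _]|[E _]|[_ uM uS]].
  - by move: E pl li; clear; lia.
  - by move: E pl lj; clear; lia.
  by rewrite (no _ uS us_) in uM.
have l6 : l < 6 by move: l3; clear; lia.
have l36 : l + 3 < 6 by move: l3; clear; lia.
have ll : l != l + 3 by clear; lia.
have inA p : p < 6 -> c p \notin A by move=> p6; apply/negP => /AM/oM; rewrite c6_in.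
exists (c l |: (c (l + 3) |: A)); split.
- by move=> x; rewrite !inE => /or3P[/eqP->|/eqP->|/AM/MS//]; apply: cyc_S; apply: c6_in.
- rewrite !cardsU1 !inE negb_or c6_neq // !inA //=.
  by case: MA => -[_ ->].
move=> x; rewrite !inE => /or3P[/eqP->|/eqP->|/Ad//]; apply: dl => //.
  by rewrite modn_small.
by rewrite modnDr modn_small.
Qed.
End TwoDigons.
End SixCycle.

Lemma no_I K v n n' i j : outer K -> i != j -> link2 K v n n' i j -> K = [set n; v; n'] ->
  digon i n -> digon j n' -> False.
Proof.
move=> oK ij [[vK vN dv vn vn'] [nK n'K ni n'j]] KE di dj.
have nv : e n v by rewrite eC.
have n'v : e n' v by rewrite eC.
have nn' : n != n'.
  apply: contraNneq ij => E; rewrite -E in n'j; apply/eqP.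
  exact: class_excl (ou_off oK nK) ni n'j.
have P : lpath K n n' 2 by apply: lp_sub (path3 nv vn' nn') _; sets.
have i3 := class_lt3 ni; have j3 := class_lt3 n'j.
have ell6 : ell = 6.
  have: ((i + 1) %% 3 == j) || ((j + 1) %% 3 == i) by move: i3 j3 ij; clear; lia.
  case/orP => /eqP E; first exact: digon_pair (ou_off oK) P di dj E.
  exact: digon_pair (ou_off oK) (lp_sym eC P) dj di E.
have degn a b m m' : a \in K -> b \in K -> nb (class m) a -> nb (class m') b -> m != m' ->
    K = [set a; v; b] -> deg a <= 3.
  move=> aK bK am bm' mm' E; rewrite /deg.
  apply: leq_trans (subset_leq_card (_ : _ \subset [set v; c m; c (m + 3)])) _.
    apply/subsetP => t; rewrite !inE => at_; case: (boolP (t \in K)) => tK.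
      move: tK; rewrite E !inE -orbA => /or3P[]/eqP tE; rewrite tE ?eqxx ?orbT //.
        by rewrite tE eI in at_.
      rewrite tE in at_.
      by have := link_diff (ou_off oK) (edge_path at_ aK bK) am bm' mm'.
    have ts := ou_closed oK aK at_ tK.
    have tm : nb (class (col t)) a by apply/nbP; exists t; rewrite // inE ts /=.
    case: (@class6 ell6 m t); last by move=> _ [->|->]; rewrite eqxx ?orbT.
    by rewrite inE ts (class_excl (ou_off oK aK) tm am) /=.
  by rewrite -setUA cardsU1 cards2; case: (_ \notin _); case: (_ != _).
apply: (two_digons ell6 (M := K) (A := [set v]) ij di dj nK n'K (ou_off oK) (ou_sub oK) (ou_closed oK)).
- move=> t; rewrite KE !inE -orbA => /or3P[]/eqP->; [by left| |by right].
  by move=> H; rewrite H in vN.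
- move=> t; rewrite KE !inE -orbA => /or3P[]/eqP->; last 1 first.
  + by apply: (degn n' n _ _ n'K nK n'j ni); rewrite 1?eq_sym // KE -setUA setUC [[set v; n']]setUC.
  + exact: (degn n n' _ _ nK n'K ni n'j).
  by rewrite dv.
- by move=> t; rewrite inE => /eqP->.
- by move=> t; rewrite inE => /eqP->; rewrite dv.
left; rewrite cards1; split=> //.
by rewrite KE -setUA cardsU1 cards2 !inE negb_or nn' (adj_neq nv) (adj_neq vn').
Qed.

Lemma outer_mono K u : outer K -> u \in K ->
  exists2 i, i < 3 & forall t, t \in K -> onC t -> nb (class i) t.
Proof.
move=> oK uK; case: (outer_cases oK uK) => [//|[v [n [n' [i [j [ij l2 KE di dj]]]]]]|[z [uu [zK zN uuP KE]]]].
  by case: (no_I oK ij l2 KE di dj).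
case: (y_ell oK zK zN uuP KE) => ell6 _.
by case: (no_Y ell6 oK zK zN uuP KE).
Qed.

(** * Branches within one colour *)

Lemma branch_sym K X Y : branch K X Y -> branch K Y X.
Proof.
case=> h1 h2 h3 h4 h5 h6 h7 h8; split=> //.
  by move=> u w uK uw wK; case: (h5 u w uK uw wK); [right|left].
by move=> u v k u' v' k' uY vX P u'Y v'X P'; apply: h8 vX uY (lp_sym eC P) v'X u'Y (lp_sym eC P').
Qed.

Lemma zero_single K X Y i : branch K X Y -> off K -> {subset X <= class i} ->
  {subset Y <= class i} -> (forall u v k, nb X u -> nb Y v -> lpath K u v k -> k %% 3 = 0) ->
  exists v, K = [set v].
Proof.
move=> B oK Xi Yi Z.
pose N := [set t in K | nb X t || nb Y t].
have NE t : (t \in N) = (t \in K) && (nb X t || nb Y t) by rewrite inE.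
clearbody N.
have NK : {subset N <= K} by move=> t; rewrite NE => /andP[].
have NXY t : t \in N -> nb X t \/ nb Y t by rewrite NE => /andP[_ /orP].
have toi t : t \in N -> nb (class i) t.
  by case/NXY => /nbP[x xX tx]; apply/nbP; exists x => //; [apply: Xi|apply: Yi].
have ofi t : t \in K -> t \notin N -> ~~ nb (class i) t.
  move=> tK; apply: contra => /nbP[x /classP[xs _] tx]; rewrite NE tK /=.
  have xK : x \notin K by apply/negP => /oK; rewrite xs.
  by case: (br_closed B tK tx xK) => xX; apply/orP; [left|right]; apply/nbP; exists x.
have cov t : t \in K -> nb (class i) t -> nb X t \/ nb Y t.
  by move=> tK ti; apply: NXY; apply: contraTT ti; apply: ofi.
have cnK := br_conn B.
case: (br_attX B) => u0 u0K u0X; case: (br_attY B) => v0 v0K v0Y.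
have ind u1 u2 : u1 \in N -> u2 \in N -> e u1 u2 -> False.
  move=> u1N u2N e12; have u1K := NK _ u1N; have u2K := NK _ u2N.
  case: (NXY _ u1N) (NXY _ u2N) => h1 [h2|h2].
  - exact: (indep cnK (br_const B) v0K v0Y u1K u2K h1 h2).
  - by have := Z _ _ _ h1 h2 (edge_path e12 u1K u2K).
  - by rewrite eC in e12; have := Z _ _ _ h2 h1 (edge_path e12 u2K u1K).
  exact: (indep cnK (br_const (branch_sym B)) u0K u0X u1K u2K h1 h2).
have oneN : onenb (K :\: N) N.
  move=> u x x'; rewrite in_setD => /andP[uN uK] xN x'N ux ux'; apply/eqP; apply: contraT => xx'.
  have xu : e x u by rewrite eC.
  have xK := NK _ xN; have x'K := NK _ x'N.
  have P : lpath K x x' 2 by apply: lp_sub (path3 xu ux' xx') _; sets.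
  by case: (link_same oK P (toi _ xN) (toi _ x'N) xx').
have hubN : hubfree (K :\: N) N.
  move=> u u' m n n'; rewrite !in_setD => /andP[uN uK] /andP[u'N u'K] /andP[mN mK].
  move=> uu' du du' um u'm nN n'N un u'n' nn'.
  have neq a b : a \in N -> b \notin N -> a != b by move=> aN; apply: contraNneq => <-.
  have nK := NK _ nN; have n'K := NK _ n'N.
  have nu : e n u by rewrite eC.
  have mu' : e m u' by rewrite eC.
  have sub : {subset [:: n; u; m; u'; n'] <= K} by sets.
  have U : uniq [:: n; u; m; u'; n'].
    have h1 := neq _ _ nN uN; have h2 := neq _ _ nN u'N; have h0 := neq _ _ nN mN.
    have h3 := neq _ _ n'N uN; have h4 := neq _ _ n'N u'N; have h5 := neq _ _ n'N mN.
    by have h6 := adj_neq um; have h7 := adj_neq mu'; rewrite /= !inE; nq.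
  have P : lpath K n n' 4.
    by apply: lp_sub (path5 nu um mu' u'n' U) _ => w; rewrite inE; apply: sub.
  case: (NXY _ nN) (NXY _ n'N) => h1 [h2|h2].
  - exact: (hub_arms B oK Xi cov sub U h1 h2 (ofi _ uK uN) (ofi _ u'K u'N) du du').
  - by have := Z _ _ _ h1 h2 P.
  - by have := Z _ _ _ h2 h1 (lp_sym eC P).
  have cov' t : t \in K -> nb (class i) t -> nb Y t \/ nb X t.
    by move=> tK /(cov t tK)[]; [right|left].
  exact: (hub_arms (branch_sym B) oK Yi cov' sub U h1 h2 (ofi _ uK uN) (ofi _ u'K u'N) du du').
case: (boolP [exists v in K, v \notin N]) => [/existsP[q /andP[qK qN]]|all_N]; last first.
  have {}all_N w : w \in K -> w \in N.
    by move=> wK; apply: contraR all_N => wN; apply/existsP; exists w; rewrite wK.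
  exists v0; apply/esym; apply: (conn_closed eC (z := v0) cnK); first by rewrite inE.
    by move=> w; rewrite inE => /eqP->.
  move=> y w; rewrite inE => /eqP-> wK yw.
  by case: (ind v0 w) => //; apply: all_N.
exfalso.
have qQ : q \in component (K :\: N) q by apply: component_id; rewrite in_setD qN.
have QKN w : w \in component (K :\: N) q -> w \in K :\: N by apply: component_sub.
have Qcn : conn (component (K :\: N) q) by apply: component_conn.
have Qcl a w : a \in component (K :\: N) q -> e a w -> w \notin component (K :\: N) q -> w \in N.
  move=> aQ aw wQ; move: (QKN _ aQ); rewrite in_setD => /andP[aN aK].
  case: (boolP (w \in K)) => wK.
    apply: contraR wQ => wN; apply: component_closed aQ _ aw; by rewrite in_setD wN.
  case/negP: aN; rewrite NE aK /=.
  by case: (br_closed B aK aw wK) => wX; apply/orP; [left|right]; apply/nbP; exists w.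
move: (component _ q) qQ QKN Qcn Qcl => Q qQ QKN Qcn Qcl.
have QK : {subset Q <= K} by move=> w /QKN; rewrite in_setD => /andP[].
have QN w : w \in Q -> w \notin N by move/QKN; rewrite in_setD => /andP[].
have Nq w : w \in N -> w \notin Q by move=> wN; apply/negP => /QN; rewrite wN.
pose B0 := [set n in N | nb Q n].
have B0E w : (w \in B0) = (w \in N) && nb Q w by rewrite inE.
clearbody B0.
have B0N : {subset B0 <= N} by move=> w; rewrite B0E => /andP[].
have QB0 a w : a \in Q -> e a w -> w \notin Q -> w \in B0.
  move=> aQ aw wQ; rewrite B0E (Qcl a w) //; apply/nbP; exists a => //; by rewrite eC.
(* However the attachments are split, constant lengths make [Q] one vertex with a neighbour in each
   part, against [oneN]. *)
have bisect (P1 P2 : {set T}) n1 n2 : (forall w, w \in B0 -> w \in P1 \/ w \in P2) ->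
    {subset P1 <= B0} -> {subset P2 <= B0} -> n1 \in P1 -> n2 \in P2 -> n1 != n2 ->
    const Q P1 P2 -> False.
  move=> P12 s1 s2 n1P n2P n12 cst.
  have att n0 : n0 \in B0 -> exists2 a, a \in Q & e a n0.
    by rewrite B0E => /andP[_ /nbP[a aQ na]]; exists a; rewrite // eC.
  case: (att _ (s1 _ n1P)) => a1 a1Q a1n; case: (att _ (s2 _ n2P)) => a2 a2Q a2n.
  have one (P0 : {set T}) : {subset P0 <= B0} -> onenb Q P0.
    by move=> sP u x x' uQ /sP/B0N xN /sP/B0N x'N; apply: oneN => //; apply: QKN.
  have hub (P0 : {set T}) : {subset P0 <= B0} -> hubfree Q P0.
    move=> sP u u' m x x' uQ u'Q mQ uu' du du' um u'm /sP/B0N xN /sP/B0N x'N.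
    by apply: (hubN u u' m); rewrite ?QKN.
  have [t Qt] : exists t, Q = [set t].
    apply: (@branch_single Q P1 P2); [|exact: one|exact: one|exact: hub|exact: hub].
    split=> //.
    - by move=> w /QK /(br_sub B).
    - by move=> w /QN /negP wN /s1/B0N.
    - by move=> w /QN /negP wN /s2/B0N.
    - by move=> a w aQ aw wQ; apply: P12; apply: QB0 aQ aw wQ.
    - by exists a1 => //; apply/nbP; exists n1.
    by exists a2 => //; apply/nbP; exists n2.
  move: a1Q a2Q; rewrite Qt !inE => /eqP E1 /eqP E2; subst a1 a2.
  have tQ : t \in K :\: N by apply: QKN; rewrite Qt inE.
  case/eqP: n12; exact: (oneN t _ _ tQ (B0N _ (s1 _ n1P)) (B0N _ (s2 _ n2P))).
have long (P1 P2 : {set T}) a b k : (forall w, w \in P1 -> w \in P2 -> False) ->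
    {subset P1 <= B0} -> {subset P2 <= B0} -> nb P1 a -> nb P2 b -> lpath Q a b k ->
    exists n n', [/\ n \in P1, n' \in P2, lpath (n |: (n' |: Q)) n n' k.+2 & n != n'].
  move=> dis s1 s2 /nbP[n nP an] /nbP[n' n'P bn'] P; exists n, n'.
  have nn' : n != n' by apply/eqP => E; apply: (dis n nP); rewrite E.
  split=> //; rewrite eC in an.
  apply: lp_cons an _ (lp_snoc eC P bn' _); last exact: Nq (B0N _ (s2 _ n'P)).
  by rewrite !inE negb_or nn' Nq // B0N // s1.
(* Fix the attachment [n1] from which a path goes on to [y]; the paths from the other attachments
   through [Q] to [n1] all continue along it. *)
have side X' Y' : branch K X' Y' -> (forall w, w \in B0 -> nb X' w) -> False.
  move=> B' all_X; case: (br_attY B') => y yK yY.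
  case: (@conn_exit _ e eC K (Q :|: B0) q y) => //; first by rewrite !inE qQ.
  move=> n1 [k0 [n1A n1K P0]].
  have y_out : y \notin Q.
    apply: contraTN yY => yQ; apply/negP => yY'; have /negP[] := ofi _ (QK _ yQ) (QN _ yQ).
    case/nbP: yY' => x xY yx.
    have xK : x \notin K by apply/negP => /(br_dY B'); apply.
    apply: toi; rewrite NE (QK _ yQ) /=.
    by case: (br_closed B (QK _ yQ) yx xK) => H; apply/orP; [left|right]; apply/nbP; exists x.
  have n1B : n1 \in B0.
    move: n1A; rewrite in_setU => /orP[aQ|//]; case: k0 P0 => [|k0] P0.
      by move/lp_eq0: P0 => /esym; rewrite eqxx => /eqP an; rewrite -an aQ in y_out.
    case/lp_step: P0 => b [ab]; rewrite in_setU1 in_setD in_setU negb_or => bA bna _.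
    rewrite (negbTE bna) /= in bA; case/andP: bA => /andP[bQ bB] bK.
    by rewrite (QB0 n1 b) in bB.
  have [n2 n2B n21] : exists2 n2, n2 \in B0 & n2 != n1.
    apply/exists_inP; apply: contraT => no.
    have /cut : {subset Q <= S} by move=> w /QK /(br_sub B).
    move=> /(_ n1 q qQ (Nq _ (B0N _ n1B))) SQ.
    case/nbP: u0X => x xX ux.
    have xS : x \in S by rewrite eC in ux; apply: supp ux.
    have: x \in n1 |: Q.
      apply: SQ xS => a w aQ aw wQ; apply/eqP; apply: contraNT no => wn.
      by apply/exists_inP; exists w => //; apply: QB0 aQ aw wQ.
    rewrite in_setU1 => /orP[/eqP xn|/QK xK]; last by case: (br_dX B xK).
    by case: (br_dX B _ xX); rewrite xn.
  apply: (bisect (B0 :\ n1) [set n1] n2 n1) => //.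
  - by move=> w wB; rewrite !inE wB andbT; case: eqP => _; [right|left].
  - by move=> w; rewrite !inE => /andP[].
  - by move=> w; rewrite !inE => /eqP->.
  - by rewrite !inE n21.
  - by rewrite inE.
  have ext a b k : nb (B0 :\ n1) a -> nb [set n1] b -> lpath Q a b k ->
      exists2 n, nb X' n & lpath K n y (k.+2 + k0).
    move=> aP bP P.
    case: (long (B0 :\ n1) [set n1] a b k) => //.
    + by move=> w; rewrite !inE => /andP[/negbTE->].
    + by move=> w; rewrite !inE => /andP[].
    + by move=> w; rewrite !inE => /eqP->.
    move=> n [n' [nB]]; rewrite inE => /eqP-> R nn1.
    move: nB; rewrite in_setD1 => /andP[_ nB]; exists n; first exact: all_X.
    apply: lp_sub (lp_join R P0 _) _.
      move=> w; rewrite in_setU1 in_setU1 in_setU1 in_setD in_setU => H1 /orP[/eqP//|/andP[H2 _]]; move: H2.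
      by case/or3P: H1 => [/eqP->|/eqP->|->//]; rewrite ?nB ?n1B ?orbT.
    have nK := NK _ (B0N _ nB).
    by move=> w; rewrite !inE => H; splith; memg.
  move=> a b k a' b' k' aP bP P a'P b'P P'.
  case: (ext _ _ _ aP bP P) => n nX R; case: (ext _ _ _ a'P b'P P') => n' n'X R'.
  have := br_const B' nX yY R n'X yY R'; clear; lia.
case: (boolP [exists w in B0, ~~ nb X w]) => [/existsP[w1 /andP[w1B w1X]]|allX]; last first.
  apply: (side X Y B) => w wB; apply: contraR allX => wX; apply/existsP; exists w; by rewrite wB.
case: (boolP [exists w in B0, nb X w]) => [/existsP[w2 /andP[w2B w2X]]|noX]; last first.
  apply: (side Y X (branch_sym B)) => w wB; case: (NXY _ (B0N _ wB)) => // wX.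
  by case/existsP: noX; exists w; rewrite wB.
apply: (bisect [set w in B0 | nb X w] [set w in B0 | ~~ nb X w] w2 w1).
- by move=> w wB; rewrite !inE wB /=; case: (nb X w); [left|right].
- by move=> w; rewrite inE => /andP[].
- by move=> w; rewrite inE => /andP[].
- by rewrite inE w2B.
- by rewrite inE w1B.
- by apply: contraNneq w1X => <-.
(* An attachment that does not see [X] sees [Y], so the extended path runs from [X] to [Y] and
   [k + 2] is 0 modulo 3. *)
have ext a b k : nb [set w in B0 | nb X w] a -> nb [set w in B0 | ~~ nb X w] b -> lpath Q a b k ->
    k %% 3 = 1.
  move=> aP bP P; case: (long _ _ _ _ _ _ _ _ aP bP P).
  - by move=> w; rewrite !inE => /andP[_ ->]; rewrite andbF.
  - by move=> w; rewrite inE => /andP[].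
  - by move=> w; rewrite inE => /andP[].
  move=> n [n' []]; rewrite !inE => /andP[nB nX] /andP[n'B n'X] R _.
  have nK := NK _ (B0N _ nB); have n'K := NK _ (B0N _ n'B).
  have {}R : lpath K n n' k.+2 by apply: lp_sub R _; sets.
  case: (NXY _ (B0N _ n'B)) => H; first by rewrite H in n'X.
  by have := Z _ _ _ nX H R; clear; lia.
move=> a b k a' b' k' aP bP P a'P b'P P'.
by rewrite (ext _ _ _ aP bP P) (ext _ _ _ a'P b'P P').
Qed.

(** * Crossing components *)

Definition linked x y := exists K n n', [/\ outer K, n \in K, n' \in K, e n x & e n' y].

Lemma linked_col x y : linked x y -> x \in s -> y \in s -> col x = col y.
Proof.
move=> [K [n [n' [oK nK n'K nx n'y]]]] xs ys; case: (outer_mono oK nK) => i _ mono.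
have get t z : t \in K -> e t z -> z \in s -> col z = i.
  move=> tK tz zs; have tC : onC t by apply/nbP; exists z; rewrite ?inE.
  apply: class_excl (ou_off oK tK) _ (mono _ tK tC).
  by apply/nbP; exists z; rewrite // inE zs /=.
by rewrite (get n x) // (get n' y).
Qed.

(** With [d] the difference of the two colours, the crossing cycles forbid [k + k'] to be [d] or
    [-d] modulo 3, so it is 0; as neither [k] nor [k'] is 2 modulo 3, both are 0. *)
Lemma crossing_len K K' u v m m' k k' x y p q : off K -> off K' ->
  (forall w, w \in K -> w \in K' -> False) -> lpath K u v k -> lpath K' m m' k' ->
  e m (c x) -> e m' (c y) -> e u (c p) -> e v (c q) -> x < p < y -> y < ell ->
  (q < x) || (y < q) -> q < ell -> x %% 3 = y %% 3 -> p %% 3 = q %% 3 -> x %% 3 != p %% 3 ->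
  k %% 3 = 0.
Proof.
move=> oK oK' dis P P' mx m'y up vq /andP[xp py] yl qo ql xy pq xp'.
have xl : x < ell by apply: ltn_trans xp (ltn_trans py yl).
have pl : p < ell by apply: ltn_trans py yl.
have nk : k %% 3 <> 2.
  case: (link_col oK P (cyc_in pl) (cyc_in ql) up vq) => _ H _; apply: H.
    by rewrite /col !index_cyc.
  by apply/eqP => /(cyc_inj pl ql); move: xp py qo; clear; lia.
have nk' : k' %% 3 <> 2.
  case: (link_col oK' P' (cyc_in xl) (cyc_in yl) mx m'y) => _ H _; apply: H.
    by rewrite /col !index_cyc.
  by apply/eqP => /(cyc_inj xl yl); move: xp py; clear; lia.
case/orP: qo => qo.
  case: (cross_ok oK oK' dis (lp_sym eC P) P' vq mx up m'y qo xp py yl) => -[o1 _] [o2 _].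
  by move: o1 o2 nk nk' s0 xy pq xp' qo xp py yl; clear; lia.
have dis' w : w \in K' -> w \in K -> False by move=> a b; apply: dis b a.
case: (cross_ok oK' oK dis' P' P mx up m'y vq xp py qo ql) => -[o1 _] [o2 _].
by move: o1 o2 nk nk' s0 xy pq xp' qo xp py ql; clear; lia.
Qed.

(** The sides for [zero_single] are the attachments of [K] strictly between [x] and [y] and the
    others; [crossing_len] supplies residue 0. *)
Lemma crossing K K' n n0 m m' x y p q : outer K -> outer K' ->
  (forall w, w \in K -> w \in K' -> False) -> m \in K' -> m' \in K' -> n \in K -> n0 \in K ->
  e m (c x) -> e m' (c y) -> e n (c p) -> e n0 (c q) -> x < p < y -> y < ell ->
  (q < x) || (y < q) -> q < ell -> x %% 3 != p %% 3 -> exists v, K = [set v].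
Proof.
move=> oK oK' dis mK m'K nK n0K mx m'y np n0q xpy yl qo ql xp.
have xl : x < ell by move: xpy yl; clear; lia.
have pl : p < ell by move: xpy yl; clear; lia.
have lk a b a' b' L : outer L -> a \in L -> b \in L -> e a (c a') -> e b (c b') -> a' < ell ->
    b' < ell -> a' %% 3 = b' %% 3.
  move=> oL aL bL aa bb a'l b'l; have := @linked_col (c a') (c b').
  rewrite /col !index_cyc // !cyc_in //; apply=> //; by exists L, a, b.
have xy := lk m m' x y _ oK' mK m'K mx m'y xl yl.
pose X := [set t in class (p %% 3) | x < index t s < y].
pose Y := [set t in class (p %% 3) | ~~ (x < index t s < y)].
case: (ou_conn oK' mK m'K) => k' P'.
have at_ t z : t \in K -> e t z -> z \in s -> z \in class (p %% 3).
  move=> tK tz zs; rewrite inE zs /= /col; apply/eqP.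
  have zl : index z s < ell by rewrite index_mem.
  by apply: (lk t n _ _ K) => //; rewrite cyc_index.
have Z u v k : nb X u -> nb Y v -> lpath K u v k -> k %% 3 = 0.
  case/nbP => t; rewrite inE => /andP[/classP[ts tp] ti] ut.
  case/nbP => r; rewrite inE => /andP[/classP[rs rp] ri] vr P.
  rewrite -(cyc_index ts) in ut; rewrite -(cyc_index rs) in vr.
  have rl : index r s < ell by rewrite index_mem.
  rewrite /col in tp rp.
  apply: (crossing_len (ou_off oK) (ou_off oK') dis P P' mx m'y ut vr ti yl _ rl xy).
  - by move: ri rp xp xy; clear; lia.
  - by rewrite tp rp.
  by rewrite tp.
apply: (zero_single (X := X) (Y := Y) (i := p %% 3) _ _ _ _ Z).
- split.
  + exact: ou_conn oK.
  + exact: ou_sub oK.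
  + by move=> w /(ou_off oK) ws; rewrite !inE (negbTE ws).
  + by move=> w /(ou_off oK) ws; rewrite !inE (negbTE ws).
  + move=> t z tK tz zK; have zs := ou_closed oK tK tz zK.
    have zp := at_ t z tK tz zs; rewrite !inE in zp *; rewrite zp /=.
    by case: (x < _ < _); [left|right].
  + exists n => //; apply/nbP; exists (c p) => //.
    by rewrite inE cyc_class // index_cyc.
  + exists n0 => //; apply/nbP; exists (c q) => //.
    rewrite inE index_cyc //; apply/andP; split; last by move: qo; clear; lia.
    exact: at_ n0K n0q (cyc_in ql).
  by move=> u v k u' v' l ux vy P u'x v'y R; rewrite (Z u v k) // (Z u' v' l).
- exact: ou_off oK.
- by move=> w; rewrite inE => /andP[].
by move=> w; rewrite inE => /andP[].
Qed.

(** * A shortest arc spanned by a component *)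

Section MinimalArc.
Variable j : nat.
Hypotheses (j0 : 0 < j) (jl : j < ell) (L0 : linked (c 0) (c j)).
Hypothesis jmin : forall p q, p < q -> q < ell -> linked (c p) (c q) ->
  j <= q - p /\ j <= ell - (q - p).

Lemma linked_mod p q : linked (c p) (c q) -> p < ell -> q < ell -> p %% 3 = q %% 3.
Proof. by move=> L pl ql; have := linked_col L (cyc_in pl) (cyc_in ql); rewrite /col !index_cyc. Qed.

Lemma arc_dim : [/\ j %% 3 = 0, 3 <= j & j + j <= ell].
Proof.
have l0 : 0 < ell by apply: ltn_trans jl.
have j3 := linked_mod L0 l0 jl; case: (jmin j0 jl L0) => _ h.
by split; move: j0 jl j3 h; clear; lia.
Qed.

(** The component of [u] has a second attachment [c r], at least [j] away from [c p] by minimality.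
    So it crosses the component that spans the arc, and both are single vertices. The crossing cycle
    whose length is a multiple of 3 is no shorter than [ell]: this leaves [r = ell - 2] and [j = 3]
    for [p = 1], and [r = j + 2] for [p = 2]. *)
Lemma arc_att p u : 0 < p < 3 -> e (c p) u -> u \notin s ->
  let q := if p == 1 then ell - 2 else j + 2 in
  [/\ outer [set u], deg u = 2, e u (c q), p = 1 -> j = 3
    & exists v, [/\ outer [set v], e v (c 0), e v (c j) & v != u]].
Proof.
move=> /andP[p0 p3] pu us_ q; case: arc_dim => j3 j3' jj.
have l0 : 0 < ell by apply: ltn_trans jl.
have pj : p < j by apply: leq_trans p3 j3'.
have pl : p < ell by apply: ltn_trans jl.
have up : e u (c p) by rewrite eC.
have uS : u \in S by apply: supp up.
case: (outer_comp uS us_); move: (component _ _) => K' oK' uK'.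
case: (L0) => K [n [n' [oK nK n'K n0 n'j]]].
have neK : K <> K'.
  move=> E; have L : linked (c 0) (c p) by exists K', n, u; split; rewrite // -E.
  by have := linked_mod L l0 pl; move: p0 p3; clear; lia.
have dis w : w \in K -> w \in K' -> False.
  by move=> wK wK'; apply: neK; exact: (outer_eq oK oK' wK wK').
have dis' w : w \in K' -> w \in K -> False by move=> a b; apply: dis b a.
have K'2 t r : t \in K' -> r < ell -> e t (c r) -> r != p ->
    [/\ r = q, p = 1 -> j = 3, K' = [set u] & exists v, K = [set v]].
  move=> tK' rl tr rp.
  have Lr : linked (c p) (c r) by exists K', u, t.
  have rp3 := linked_mod Lr pl rl.
  have pr : p < r by move: rp rp3 p3; clear; lia.
  have [jr _] := jmin pr rl Lr.
  have [u' K'E] : exists u', K' = [set u'].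
    apply: (crossing oK' oK dis' nK n'K uK' tK' n0 n'j up tr); rewrite ?p0 //.
    - by move: jr p0 pj; clear; lia.
    by move: p0 p3; clear; lia.
  have uu' : u = u' by move: uK'; rewrite K'E inE => /eqP.
  subst u'; have tu : t = u by move: tK'; rewrite K'E inE => /eqP.
  subst t; have [v KE] : exists v, K = [set v].
    apply: (crossing oK oK' dis uK' uK' n'K nK up tr n'j n0); rewrite ?p0 //.
    - by move: jr p0 pj; clear; lia.
    by move: p0 p3 j3; clear; lia.
  have nv : n = v by move: nK; rewrite KE inE => /eqP.
  have n'v : n' = v by move: n'K; rewrite KE inE => /eqP.
  subst n n'.
  have jr' : j < r by move: jr p0 pr; clear; lia.
  case: (cross_ok (ou_off oK) (ou_off oK') dis (lp0 e nK) (lp0 e uK') n0 up n'j tr p0 pj jr' rl).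
  move=> [_ o1] [_ o2].
  have [E1 E2] : r = q /\ (p = 1 -> j = 3).
    rewrite /q; move: o1 o2 rp3 pr jr p0 p3 j3 j3' jj s0 rl; clear; case: (eqVneq p 1) => p1; lia.
  by split=> //; exists v.
have [t [r [[tK' rl tr rp]]]] : exists t r, [/\ t \in K', r < ell, e t (c r) & r != p].
  case: (outer_two oK' uK') => a [b [x [y [[aK bK ax by_ xy] [xs ys]]]]].
  have il z : z \in s -> index z s < ell by rewrite index_mem.
  case: (eqVneq (index x s) p) => [E|E].
    exists b, (index y s); rewrite il // cyc_index //; split=> //.
    by apply: contraNneq xy => E'; rewrite -(cyc_index xs) -(cyc_index ys) E E'.
  by exists a, (index x s); rewrite il // cyc_index.
case: (K'2 t r tK' rl tr rp) => rq pj3 K'E [v KE].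
have tu : t = u by move: tK'; rewrite K'E inE => /eqP.
subst t; rewrite rq in tr rl rp.
split=> //.
- by rewrite -K'E.
- apply: (deg2_only up tr); first by apply: contraNneq rp => /(cyc_inj pl rl)->.
  move=> x ux; have xs : x \in s.
    by apply: (ou_closed oK' uK' ux); rewrite K'E inE eq_sym; apply: adj_neq.
  case: (eqVneq (index x s) p) => [E|E]; first by left; rewrite -E cyc_index.
  right; have xl : index x s < ell by rewrite index_mem.
  case: (K'2 u (index x s) uK' xl _ E) => [|E' _ _ _]; first by rewrite cyc_index.
  by rewrite -E' cyc_index.
have nv : n = v by move: nK; rewrite KE inE => /eqP.
have n'v : n' = v by move: n'K; rewrite KE inE => /eqP.
subst n n'; exists v; split=> //; first by rewrite -KE.
by apply/eqP => E; apply: (dis u); rewrite // -E.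
Qed.

(** By [arc_att] a second neighbour off the cycle would share [c p] and [c q] with [u]: a
    4-cycle. *)
Lemma arc_deg3 p u : 0 < p < 3 -> e (c p) u -> u \notin s -> deg (c p) = 3.
Proof.
move=> p03 pu us_; have /andP[p0 p3] := p03; case: arc_dim => j3 j3' jj.
have pl : p < ell by move: p3 j3' jl; clear; lia.
have pl' : p.+1 < ell by move: p3 j3' jl jj; clear; lia.
have pl'' : p.-1 < ell by move: pl; clear; lia.
have up : e u (c p) by rewrite eC.
have off_ r : r < ell -> c r != u by move=> rl; apply: contraNneq us_ => <-; apply: cyc_in.
have n1 : c p.-1 != c p.+1 by apply/eqP => /(cyc_inj pl'' pl'); move: p0; clear; lia.
rewrite /deg; suff -> : [set y | e (c p) y] = [set c p.-1; c p.+1; u].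
  by rewrite -setUA cardsU1 cards2 !inE negb_or n1 !off_.
apply/setP => t; rewrite !inE; apply/idP/idP; last first.
  case/orP => [/orP[]|]/eqP->//; last exact: cyc_step.
  by rewrite eC; have := @cyc_step p.-1; rewrite prednK //; apply.
move=> pt; case: (boolP (t \in s)) => ts.
  case: (cyc_adj pl pt ts) => b [bl -> adj].
  have : (b == p.-1) || (b == p.+1) by move: adj p0 pl' bl; clear; lia.
  by case/orP => /eqP->; rewrite eqxx ?orbT.
case: (eqVneq t u) => [//|tu]; first by rewrite orbT.
case: (arc_att p03 pu us_) => _ _ uq _ _; case: (arc_att p03 pt ts) => _ _ tq _ _.
case: (@noC4 u (c p) t (c (if p == 1 then ell - 2 else j + 2))) => //; rewrite 1?eC //.
  by rewrite eq_sym.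
by apply/eqP => /cyc_inj; move: p3 p0 j3' jj pl; case: (eqVneq p 1); clear; lia.
Qed.

(** By [nadj2] one of [c 1], [c 2] has a neighbour [u] off the cycle. Then [fold] at [u] gives [c q]
    and the other of the two a common neighbour, which forces length 6, and [u] with the vertex
    spanning the arc are digons of different colours. *)
Lemma minimal_arc : False.
Proof.
case: arc_dim => j3 j3' jj.
have l1 : 1 < ell by move: jl j3'; clear; lia.
have l2 : 2 < ell by move: jl j3'; clear; lia.
have l0 : 0 < ell by move: jl j3'; clear; lia.
have [p [u [p03 pu us_]]] : exists p u, [/\ 0 < p < 3, e (c p) u & u \notin s].
  have key p : 0 < p < 3 -> deg (c p) <> 2 -> exists p u, [/\ 0 < p < 3, e (c p) u & u \notin s].
    move=> p03 d2; have /andP[p0 p3] := p03.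
    have pl : p < ell by move: p3 j3' jl; clear; lia.
    have d3 : 2 < deg (c p).
      by rewrite ltn_neqAle eq_sym deg_ge2 ?andbT; [apply/eqP|apply: cyc_S; apply: cyc_in].
    case: (deg_gt2 (c p.-1) (c p.+1) d3) => u [pu u1 u2]; exists p, u; split=> //.
    apply/negP => us_; case: (cyc_adj pl pu us_) => b [bl E adj].
    have : (b == p.-1) || (b == p.+1) by move: adj p0 p3 pl jj j3' bl; clear; lia.
    by case/orP => /eqP E'; move: u1 u2; rewrite E E' eqxx.
  case: (eqVneq (deg (c 1)) 2) => [d1|/eqP d1]; last exact: (key 1).
  case: (eqVneq (deg (c 2)) 2) => [d2|/eqP d2]; last exact: (key 2).
  by case: (nadj2 (cyc_step l2) d1 d2).
have /andP[p0 p3] := p03.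
have d3 := arc_deg3 p03 pu us_.
case: (arc_att p03 pu us_); set q := if _ then _ else _ => ou du uq pj [v [ov v0 vj vu]].
have pl : p < ell by move: p3 j3' jl; clear; lia.
have ql : q < ell by rewrite /q; case: ifP; move: l2 jj j3'; clear; lia.
have up : e u (c p) by rewrite eC.
(* [3 - p] is the other one of the positions 1 and 2. *)
have [z [pz zl zp]] : exists z, [/\ e (c p) (c z), z < ell & z = 3 - p].
  exists (3 - p); have : (p == 1) || (p == 2) by move: p0 p3; clear; lia.
  case/orP => /eqP->; split=> //; first exact: cyc_step.
  by rewrite eC; apply: cyc_step.
have pq : c p != c q.
  apply/eqP => /(cyc_inj pl ql); rewrite /q; move: p0 p3 jj j3'; clear; case: (eqVneq p 1); lia.
have zu : c z != u by apply: contraNneq us_ => <-; apply: cyc_in.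
have zq : c z != c q.
  apply/eqP => /(cyc_inj zl ql); rewrite zp /q; move: p0 p3 jj j3'; clear; case: (eqVneq p 1); lia.
have ell6 : ell = 6 /\ j = 3.
  case: (fold du up uq pq d3 pz zu zq) => y [qy zy yu yp].
  case: (boolP (y \in s)) => ys; last first.
    have yz : nb (class (z %% 3)) y by apply/nbP; exists (c z); rewrite ?cyc_class // eC.
    have yq : nb (class (q %% 3)) y by apply/nbP; exists (c q); rewrite ?cyc_class // eC.
    have := class_excl ys yz yq; rewrite zp /q.
    by move: p0 p3 j3 s0 jj j3'; clear; case: (eqVneq p 1); lia.
  case: (cyc_adj ql qy ys) => b [bl yb adj]; case: (cyc_adj zl zy ys) => b' [b'l yb' adj'].
  have E : b = b' by apply: cyc_inj => //; rewrite -yb -yb'.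
  subst b'; have bp : b != p by apply: contraNneq yp => E; rewrite yb E.
  move: adj adj' bp pj bl jj j3' p0 p3 s0; rewrite zp /q; clear; case: (eqVneq p 1); lia.
case: ell6 => ell6 j3E; rewrite j3E in vj.
have qE : q = p + 3 by rewrite /q ell6 j3E; move: p0 p3; clear; case: (eqVneq p 1); lia.
rewrite qE in uq.
have uK : u \in [set u] by rewrite inE.
have vK : v \in [set v] by rewrite inE.
have p6 : p < 6 by rewrite -ell6.
have p36 : p + 3 < 6 by rewrite -ell6 -qE.
have cn a b : a < 6 -> b < 6 -> a != b -> c a != c b by apply: c6_neq.
have dv : deg v = 2.
  apply: (deg2_only v0 vj); first exact: cn.
  move=> x vx; have xs : x \in s by apply: (ou_closed ov vK vx); rewrite inE eq_sym; apply: adj_neq.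
  have L : linked (c 0) x by exists [set v], v, v.
  have /esym := linked_col L (cyc_in l0) xs; rewrite /col index_cyc // => x3.
  have xl : index x s < ell by rewrite index_mem.
  rewrite ell6 in xl; have : (index x s == 0) || (index x s == 3) by move: xl x3; clear; lia.
  by case/orP => /eqP E; [left|right]; rewrite -E cyc_index.
have d0 : digon 0 v.
  exists (c 0), (c 3); split; [exact: (cyc_class l0)| |exact: cn|by []|by []].
  by have := @cyc_class 3; rewrite ell6; apply.
have dp : digon p u.
  exists (c p), (c (p + 3)); split=> //.
  - by have := cyc_class pl; rewrite modn_small.
  - by have := @cyc_class (p + 3); rewrite ell6 modnDr modn_small //; apply.
  by apply: cn => //; clear; lia.
have np : 0 != p by move: p0; clear; lia.
apply: (two_digons ell6 (M := [set v; u]) (A := [set v; u]) np d0 dp).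
- by rewrite !inE eqxx.
- by rewrite !inE eqxx orbT.
- by move=> w; rewrite !inE => /orP[]/eqP->; [apply: (ou_off ov)|].
- by move=> w; rewrite !inE => /orP[]/eqP->; [apply: (ou_sub ov)|apply: (ou_sub ou)].
- move=> a w; rewrite !inE negb_or => /orP[]/eqP-> aw /andP[wv wu].
    by apply: (ou_closed ov vK aw); rewrite inE.
  by apply: (ou_closed ou uK aw); rewrite inE.
- by move=> t; rewrite !inE => /orP[]/eqP->; [left|right].
- by move=> t; rewrite !inE => /orP[]/eqP->; rewrite ?dv ?du.
- by [].
- by move=> t; rewrite !inE => /orP[]/eqP->; rewrite ?dv ?du.
by right; rewrite cards2 vu.
Qed.
End MinimalArc.

Lemma deg_cyc2 p : p < ell -> (forall u, e (c p) u -> u \in s) -> deg (c p) = 2.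
Proof.
move=> pl H; apply/eqP; rewrite eqn_leq deg_ge2 ?andbT; last by apply: cyc_S; apply: cyc_in.
rewrite /deg; apply: leq_trans (subset_leq_card (_ : _ \subset [set c ((p + 1) %% ell); c ((p + ell.-1) %% ell)])) _.
  apply/subsetP => u; rewrite !inE => pu; case: (cyc_adj pl pu (H _ pu)) => b [bl -> adj].
  have: (b == (p + 1) %% ell) || (b == (p + ell.-1) %% ell).
    case/or4P: adj => [/eqP E|/eqP E|/andP[/eqP-> /eqP->]|/andP[/eqP-> /eqP->]].
    - by rewrite E modn_small // eqxx.
    - have -> : p + ell.-1 = b + ell by move: E s3; clear; lia.
      by rewrite modnDr (modn_small bl) eqxx orbT.
    - by rewrite add0n (modn_small (m := ell.-1)) ?eqxx ?orbT //; move: s3; clear; lia.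
    have -> : ell.-1 + 1 = ell by move: s3; clear; lia.
    by rewrite modnn.
  by case/orP => /eqP->; rewrite eqxx ?orbT.
by rewrite cards2; case: (_ != _).
Qed.

(** If no vertex of the cycle had a neighbour off it, all would have degree 2, against [nadj2]. *)
Lemma linked_ex : exists p q, [/\ p < q, q < ell & linked (c p) (c q)].
Proof.
have l0 : 0 < ell by apply: ltn_trans s3.
have l1 : 1 < ell by apply: ltn_trans s3.
have [p [u [pl pu us_]]] : exists p u, [/\ p < ell, e (c p) u & u \notin s].
  case: (boolP [exists p : 'I_ell, exists u, e (c p) u && (u \notin s)]).
    by case/existsP => p /existsP[u /andP[pu us_]]; exists p, u.
  move=> no; have d2 p : p < ell -> deg (c p) = 2.
    move=> pl; apply: deg_cyc2 => // u pu; apply: contraR no => us_.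
    by apply/existsP; exists (Ordinal pl); apply/existsP; exists u; rewrite pu.
  by case: (nadj2 (cyc_step l1) (d2 0 l0) (d2 1 l1)).
have uS : u \in S by rewrite eC in pu; apply: supp pu.
case: (outer_comp uS us_); move: (component _ _) => K oK uK.
case: (outer_two oK uK) => n [n' [x [x' [[nK n'K nx n'x' xx'] [xs x's]]]]].
have il z : z \in s -> index z s < ell by rewrite index_mem.
case: (ltngtP (index x s) (index x' s)) => [lt|gt|E].
- exists (index x s), (index x' s); split; rewrite ?il // !cyc_index //.
  by exists K, n, n'.
- exists (index x' s), (index x s); split; rewrite ?il // !cyc_index //.
  by exists K, n', n.
by rewrite -(cyc_index xs) -(cyc_index x's) E eqxx in xx'.
Qed.

End Critical.

(** * No critical graph exists *)

Section Conclusion.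
Variables (T : finType) (e : rel T).
Hypothesis eC : symmetric e.
Hypothesis eI : irreflexive e.
Variable S : {set T}.
Hypothesis supp : forall x y, e x y -> x \in S.
Hypothesis good : forall s, uniq s -> 2 < size s -> cycle e s -> size s %% 3 <> 1.
Hypothesis deg_ge2 : forall x, x \in S -> 1 < deg e x.
Hypothesis nadj2 : forall x y, e x y -> deg e x = 2 -> deg e y = 2 -> False.
Hypothesis cut : forall (K : {set T}) z u, u \in K -> {subset K <= S} -> z \notin K ->
  (forall u v, u \in K -> e u v -> v \notin K -> v = z) -> {subset S <= z |: K}.
Hypothesis star3 : forall z, deg e z = 3 -> (forall u, e z u -> deg e u = 2) -> False.
Hypothesis fold : forall v a b z, deg e v = 2 -> e v a -> e v b -> a != b -> deg e a = 3 ->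
  e a z -> z != v -> z != b -> exists y, [/\ e b y, e z y, y != v & y != a].
Hypothesis dense : 3 * (#|S| - 1) + 3 * ((#|S| - 1) %/ 9) < \sum_(x in S) deg e x.

Lemma nth_rot_mod (x0 : T) (s : seq T) k i : k < size s -> i < size s ->
  nth x0 (rot k s) i = nth x0 s ((k + i) %% size s).
Proof.
move=> kl il; rewrite /rot nth_cat size_drop nth_drop.
case: ltnP => h; first by rewrite modn_small // -ltn_subRL.
rewrite nth_take; last by rewrite ltn_subLR // subnK // ltnW.
congr nth; have -> : k + i = i - (size s - k) + size s by move: h kl; clear; lia.
by rewrite modnDr modn_small //; apply: leq_ltn_trans (leq_subr _ _) il.
Qed.

Lemma linked_rot k s x y : linked e S s x y -> linked e S (rot k s) x y.
Proof.
case=> K [n [n' [[h1 h2 h3 h4] nK n'K nx n'y]]]; exists K, n, n'; split=> //; split=> //.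
  by move=> w wK; rewrite mem_rot; apply: h3.
by move=> u w uK uw wK; rewrite mem_rot; apply: (h4 u).
Qed.

Lemma linked_sym s x y : linked e S s x y -> linked e S s y x.
Proof. by case=> K [n [n' [oK nK n'K nx n'y]]]; exists K, n', n. Qed.

(** [minimal_arc] wants a closest linked pair that starts at position 0; rotating the cycle to any
    closer pair, with induction on [d], provides it. *)
Lemma no_link x0 d s : uniq s -> 2 < size s -> cycle e s -> size s %% 3 = 0 ->
  (forall t, uniq t -> 2 < size t -> cycle e t -> size t %% 3 = 0 -> size s <= size t) ->
  0 < d < size s -> linked e S s (cyc s x0 0) (cyc s x0 d) -> False.
Proof.
elim/ltn_ind: d s => d IH s us s3 cs s0 smin /andP[d0 ds] L.
have l0 : 0 < size s by apply: ltn_trans ds.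
have step p r : p < size s -> 0 < r < size s -> r < d ->
    linked e S s (cyc s x0 p) (cyc s x0 ((p + r) %% size s)) -> False.
  move=> pl rl rd Lpr; apply: (IH r rd (rot p s)); rewrite ?rot_uniq ?size_rot ?rot_cycle //.
  have /andP[_ rl'] := rl; rewrite /cyc !nth_rot_mod // addn0 modn_small //.
  exact: linked_rot.
apply: (minimal_arc eC eI supp good deg_ge2 nadj2 cut us s3 cs s0 smin star3 fold dense d0 ds L).
move=> p q pq ql Lpq; have ql' : q < size s := ql; have pl := ltn_trans pq ql'.
split; rewrite leqNgt; apply/negP => lt.
  apply: (step p (q - p) pl _ lt); first by move: pq ql'; clear; lia.
  by rewrite subnKC ?modn_small // ltnW.
apply: (step q (size s - (q - p)) ql _ lt); first by move: pq ql'; clear; lia.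
have -> : q + (size s - (q - p)) = p + size s by move: pq ql'; clear; lia.
by rewrite modnDr modn_small //; apply: linked_sym.
Qed.

Lemma no_zero_cycle n s : size s <= n -> uniq s -> 2 < size s -> cycle e s -> size s %% 3 = 0 -> False.
Proof.
elim: n s => [|n IH] s sn us s3 cs s0; first by move: s3 sn; clear; lia.
have smin t : uniq t -> 2 < size t -> cycle e t -> size t %% 3 = 0 -> size s <= size t.
  move=> ut t3 ct t0; rewrite leqNgt; apply/negP => lt.
  by apply: (IH t) => //; rewrite -ltnS; apply: leq_trans lt sn.
have x0 : T by case: s s3 {sn us cs s0 smin} => // x0.
case: (linked_ex eC eI supp good deg_ge2 nadj2 cut us s3 cs s0 smin x0) => p [q [pq ql0 L]].
have ql : q < size s := ql0; have pl := ltn_trans pq ql.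
apply: (@no_link x0 (q - p) (rot p s)); rewrite ?rot_uniq ?size_rot ?rot_cycle //.
  by move: pq ql; clear; lia.
have ql' : q - p < size s by apply: leq_ltn_trans (leq_subr _ _) ql.
have l0 : 0 < size s by apply: leq_ltn_trans ql.
rewrite /cyc !nth_rot_mod // addn0 subnKC ?(ltnW pq) // !modn_small //.
exact: linked_rot.
Qed.

(** Both sides of the branch are [[set x]]; if it is a single vertex, that neighbour of [x] has
    degree 1. *)
Lemma no_critical x : x \in S -> False.
Proof.
move=> xS; have [a xa _] := @deg_gt1 T e x x (deg_ge2 xS).
have ax : a != x by rewrite eq_sym; apply: adj_neq xa.
have aS : a \in S by rewrite eC in xa; apply: supp xa.
pose K := component e (S :\ x) a.
have aK : a \in K by apply: component_id; rewrite !inE ax.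
have KS w : w \in K -> w != x /\ w \in S by move/component_sub; rewrite !inE => /andP.
have Kcl u w : u \in K -> e u w -> w \notin K -> w = x.
  move=> uK uw wK; have wS : w \in S by move: uw; rewrite eC; apply: supp.
  by apply/eqP; apply: contraR wK => wx; apply: component_closed uK _ uw; rewrite !inE wx.
have K0 u v k : nb e [set x] u -> nb e [set x] v -> lpath e K u v k -> k %% 3 = 0.
  case/nbP => t; rewrite inE => /eqP-> ux /nbP[t']; rewrite inE => /eqP-> vx.
  case: k => [//|k] P.
  have xK : x \notin K by apply/negP => /KS[]; rewrite eqxx.
  rewrite eC in ux; case: (lp_cycle (lp_cons ux xK P) vx isT) => s [us ss cs].
  have ss' : 2 < size s by rewrite ss.
  have := good us ss' cs.
  have := @no_zero_cycle (size s) s (leqnn _) us ss' cs.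
  by rewrite ss; clear; lia.
have [v Kv] : exists v, K = [set v].
  apply: (branch_single eC eI supp good deg_ge2 nadj2 cut (X := [set x]) (Y := [set x])).
  - split.
    + exact: component_conn.
    + by move=> w /KS[].
    + by move=> w /KS[wx _]; rewrite inE (negbTE wx).
    + by move=> w /KS[wx _]; rewrite inE (negbTE wx).
    + by move=> u w uK uw /(Kcl _ _ uK uw)->; left; rewrite inE.
    + by exists a => //; apply/nbP; exists x; rewrite ?inE // eC.
    + by exists a => //; apply/nbP; exists x; rewrite ?inE // eC.
    by move=> u w k u' w' k' h1 h2 P h3 h4 P'; rewrite (K0 u w k) // (K0 u' w' k').
  - exact: onenb1.
  - exact: onenb1.
  - exact: hubfree1.
  exact: hubfree1.
have [b ab bx] := @deg_gt1 T e a x (deg_ge2 aS).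
case: (boolP (b \in K)) => [|/(Kcl _ _ aK ab) E]; last by rewrite E eqxx in bx.
have := adj_neq eI ab; move: aK; rewrite Kv !inE => /eqP-> vb /eqP E.
by rewrite E eqxx in vb.
Qed.
End Conclusion.

(** * Deletions, identifications and the induction *)

Section Counting.
Variable T : finType.
Implicit Types (e : rel T) (A K S : {set T}).

Definition total e := \sum_x deg e x.

Lemma degE e x : deg e x = \sum_y (e x y : nat).
Proof. by rewrite /deg -sum1dep_card big_mkcond. Qed.

Lemma total_supp e S : (forall x y, e x y -> x \in S) -> \sum_(x in S) deg e x = total e.
Proof.
move=> supp; rewrite /total [RHS](bigID (mem S)) /= [X in _ + X]big1 ?addn0 // => x xS.
by rewrite degE big1 // => y _; case: (boolP (e x y)) => // /supp; rewrite (negbTE xS).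
Qed.

Lemma total_add e e1 e2 : (forall x y, (e x y : nat) = e1 x y + e2 x y) ->
  total e = total e1 + total e2.
Proof.
move=> H; rewrite /total -big_split; apply: eq_bigr => x _.
by rewrite !degE -big_split; apply: eq_bigr.
Qed.

Lemma total_arcs e : total e = #|[set p : T * T | e p.1 p.2]|.
Proof.
rewrite /total -sum1dep_card; under eq_bigr do rewrite degE.
by rewrite pair_bigA [RHS]big_mkcond; apply: eq_bigr => p _ /=; case: (e _ _).
Qed.

Definition del e A : rel T := fun x y => [&& x \notin A, y \notin A & e x y].

(** Inclusion and exclusion over ordered pairs: those with first entry in [A] and those with second
    entry in [A] are equally many, and pairs inside [A] are counted twice. *)
Lemma total_del e A : symmetric e ->
  total e + \sum_(x in A) #|[set y in A | e x y]| = total (del e A) + 2 * \sum_(x in A) deg e x.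
Proof.
move=> eC; pose out x y := (x \in A) && e x y; pose ins x y := (y \in A) && e x y.
pose both x y := [&& x \in A, y \in A & e x y].
have outE : total out = \sum_(x in A) deg e x.
  rewrite /total [RHS]big_mkcond; apply: eq_bigr => x _; rewrite !degE.
  rewrite /out; case: (x \in A) => //=; exact: big1.
have insE : total ins = \sum_(x in A) deg e x.
  rewrite -outE /total; under eq_bigr do rewrite degE; rewrite exchange_big /=.
  apply: eq_bigr => x _; rewrite degE; apply: eq_bigr => y _; by rewrite /ins /out eC.
have bothE : total both = \sum_(x in A) #|[set y in A | e x y]|.
  rewrite /total [RHS]big_mkcond; apply: eq_bigr => x _.
  rewrite /deg /both; case: (x \in A) => /=; first by apply: eq_card => y; rewrite !inE.
  by apply: eq_card0 => y; rewrite inE.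
rewrite mul2n -addnn -{1}outE -insE -bothE /total addnA -!big_split; apply: eq_bigr => x _ /=.
rewrite !degE -!big_split; apply: eq_bigr => y _ /=.
by rewrite /del /out /ins /both; case: (x \in A); case: (y \in A); case: (e x y).
Qed.

Lemma del_sym e A : symmetric e -> symmetric (del e A).
Proof. by move=> eC x y; rewrite /del eC andbCA. Qed.

Lemma del_irr e A : irreflexive e -> irreflexive (del e A).
Proof. by move=> eI x; rewrite /del eI !andbF. Qed.

Lemma edges_total e : symmetric e -> irreflexive e -> 2 * num_edges e <= total e.
Proof.
move=> eC eI; rewrite total_arcs mulnC /num_edges -sum_nat_const -sum1_card.
rewrite (partition_big (fun p : T * T => [set p.1; p.2]) (mem (edges e))) /=; last first.
  by case=> x y; rewrite inE /= => xy; apply/imset2P; exists x y; rewrite ?inE.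
apply: leq_sum => E /imset2P[x y _]; rewrite inE => /andP[_ xy] ->.
rewrite sum1dep_card; apply: leq_trans (subset_leq_card (_ : [set (x, y); (y, x)] \subset _)).
  by rewrite cards2; case: eqP => // -[E' _]; rewrite E' eI in xy.
apply/subsetP => p; rewrite !inE => /orP[]/eqP-> /=; rewrite ?xy ?eqxx //.
by rewrite eC xy setUC eqxx.
Qed.

Definition nice e := forall s, uniq s -> 2 < size s -> cycle e s -> size s %% 3 <> 1.

Lemma nice_sub e e' : subrel e' e -> nice e -> nice e'.
Proof. by move=> sub ne s us s3 cs; apply: ne => //; apply: sub_cycle cs. Qed.

(** At [9 * q + r] with [r <= 8] this is [30 * q + 3 * r], twice the bound on edges up to the
    rounding of [3 * r / 2]. *)
Definition bound m := 3 * m + 3 * (m %/ 9).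

Lemma bound_add a b d : a + b <= d -> bound a + bound b <= bound d.
Proof. by rewrite /bound; lia. Qed.

(** * Identifying the ends of a path of length 3 *)

Section Fold.
Variables (e : rel T) (v a b z : T).
Hypotheses (eC : symmetric e) (eI : irreflexive e) (ne : nice e).
Hypotheses (va : e v a) (vb : e v b) (ab : a != b) (az : e a z) (zv : z != v) (zb : z != b).

(** [b] takes over the edges of [z], while [v], [a] and [z] lose all theirs. *)
Definition fuse : rel T := fun x y =>
  [&& x \notin [set v; a; z], y \notin [set v; a; z]
    & [|| e x y, (x == b) && e z y | (y == b) && e x z]].

Lemma fuse_bz : ~~ e b z.
Proof.
apply/negP => bz; apply: (noC4 eI ne (a := v) (b := a) (c := z) (d := b)) => //.
- by rewrite eC.
- by rewrite eC.
by rewrite eq_sym.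
Qed.

Lemma fuse_sym : symmetric fuse.
Proof.
move=> x y; rewrite /fuse andbCA; congr [&& _, _ & _].
by rewrite [e y x]eC [e z y]eC [e y z]eC; congr (_ || _); rewrite orbC; congr (_ || _); rewrite eC.
Qed.

Lemma fuse_irr : irreflexive fuse.
Proof.
move=> x; rewrite /fuse eI /=; case: (eqVneq x b) => [->|_]; last by rewrite !andbF.
by rewrite [e z b]eC (negbTE fuse_bz) !andbF.
Qed.

(* A cycle through [b] that uses an old edge of [z] is rerouted along [b - v - a - z], which
   lengthens it by 3. *)
Lemma fuse_nice : nice fuse.
Proof.
move=> s us s3 cs; case: (boolP (b \in s)) => bs; last first.
  apply: ne => //; apply: (sub_in_cycle (P := [pred x in s])) cs; last by apply/allP.
  move=> x y; rewrite !inE => xs ys /and3P[_ _ /or3P[//|/andP[/eqP E _]|/andP[/eqP E _]]].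
    by rewrite E (negbTE bs) in xs.
  by rewrite E (negbTE bs) in ys.
have D w : w \in s -> w \notin [set v; a; z] by move/(next_cycle cs) => /andP[].
case: (rot_to bs) => k t E; rewrite -(size_rot k) E.
have {}D w : w \in b :: t -> w \notin [set v; a; z] by rewrite -E mem_rot => /D.
have ut : uniq (b :: t) by rewrite -E rot_uniq.
have ct : cycle fuse (b :: t) by rewrite -E rot_cycle.
have st : 1 < size t by move: s3; rewrite -(size_rot k) E.
case: t ut ct st D {E} => // p t /andP[bpt upt] /=.
rewrite rcons_path => /and3P[mbp mpt mqb] st D.
have pt : path e p t.
  apply: (sub_in_path (P := [pred x in p :: t])) mpt; last by apply/allP.
  move=> x y; rewrite !inE => xs ys /and3P[_ _ /or3P[//|/andP[/eqP F _]|/andP[/eqP F _]]].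
    by move: bpt; rewrite -F inE xs.
  by move: bpt; rewrite -F inE ys.
pose L := [set x in p :: t].
have LE w : (w \in L) = (w \in p :: t) by rewrite inE.
have P : lpath e L p (last p t) (size t) by exists t; split=> // w wt; rewrite LE.
have qL := lp_lst P; have pL := lp_fst P; clearbody L.
have bL : b \notin L by rewrite LE.
have DL w : w \in L -> [/\ w != v, w != a & w != z].
  rewrite LE => wt; have := D w; rewrite in_cons wt orbT => /(_ isT).
  by rewrite !inE !negb_or -andbA => /and3P[].
have [bv ba] : b != v /\ b != a by split; rewrite eq_sym // (adj_neq eI vb).
have [vL aL zL] : [/\ v \notin L, a \notin L & z \notin L].
  by split; apply/negP => /DL[]; rewrite eqxx.
have av := adj_neq eI va; have azn := adj_neq eI az.
have zbp : e b p \/ e z p.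
  case/and3P: mbp => _ _ /or3P[|/andP[_]|/andP[/eqP F _]]; [by left|by right|].
  by rewrite F (negbTE bL) in pL.
have zbq : e (last p t) b \/ e (last p t) z.
  case/and3P: mqb => _ _ /or3P[|/andP[/eqP F _]|/andP[_]]; [by left| |by right].
  by rewrite F (negbTE bL) in qL.
have za : e z a by rewrite eC.
have av' : e a v by rewrite eC.
have bv' : e b v by rewrite eC.
have good := @lp_good T e ne.
(* The mixed cases take the detour; in the pure ones [b], or [z] in its place, closes the path. *)
case: zbp zbq => [bp|zp] [qb|qz].
- exact: (good _ _ _ _ (lp_cons bp bL P) qb).
- have Q := lp_snoc eC (lp_cons bp bL P) qz.
  have {}Q := fun h => lp_snoc eC (Q h) za.
  have {}Q := fun h h' => lp_snoc eC (Q h h') av'.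
  have {}Q := fun h h' h'' => good _ _ _ _ (Q h h' h'') vb.
  have : (size t).+4.+1 %% 3 <> 1 by apply: Q; memg.
  by rewrite /=; move: (size t) => m; clear; lia.
- have Q := lp_snoc eC (lp_cons zp zL P) qb.
  have {}Q := fun h => lp_snoc eC (Q h) bv'.
  have {}Q := fun h h' => lp_snoc eC (Q h h') va.
  have {}Q := fun h h' h'' => good _ _ _ _ (Q h h' h'') az.
  have : (size t).+4.+1 %% 3 <> 1 by apply: Q; memg.
  by rewrite /=; move: (size t) => m; clear; lia.
exact: (good _ _ _ _ (lp_cons zp zL P) qz).
Qed.

(** Moving ends from [z] to [b] is injective on ordered pairs, since [b] and [z] share no neighbour
    other than [v] and [a]. *)
Lemma fuse_total : (forall y, e b y -> e z y -> y != v -> y != a -> False) ->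
  total (del e [set v; a]) <= total fuse.
Proof.
move=> noy; rewrite !total_arcs; pose f x := if x == z then b else x.
have fE x : f x = x \/ x = z /\ f x = b by rewrite /f; case: eqP; [right|left].
have fD x : x \notin [set v; a] -> f x \notin [set v; a; z].
  rewrite /f; case: (eqVneq x z) => [_ _|xz]; last by rewrite !inE (negbTE xz) orbF.
  by rewrite !inE !negb_or eq_sym (adj_neq eI vb) eq_sym ab eq_sym zb.
have bz := fuse_bz.
pose g (p : T * T) := (f p.1, f p.2).
rewrite -(card_in_imset (f := g)).
  apply/subset_leq_card/subsetP => q /imsetP[[x y]]; rewrite inE /= => /and3P[xA yA xy] ->.
  rewrite inE /fuse /= !fD //=.
  case: (fE x) => [->|[xz ->]]; case: (fE y) => [->|[yz ->]]; rewrite ?eqxx.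
  - by rewrite xy.
  - by rewrite -yz xy !orbT.
  - by rewrite -xz xy !orbT.
  by rewrite xz yz eI in xy.
have fib x x' : f x = f x' -> x = x' \/ (x = z /\ x' = b) \/ (x = b /\ x' = z).
  rewrite /f; case: eqP => [->|_]; case: eqP => [->|_]; [by left|by right; left| |by left].
  by right; right.
have half x x' y : e x y -> e x' y -> y \notin [set v; a] -> f x = f x' -> x = x'.
  move=> xy x'y; rewrite !inE negb_or => /andP[yv ya] /fib[//|[[E E']|[E E']]]; subst.
    by case: (noy y).
  by case: (noy y).
move=> [x y] [x' y']; rewrite !inE /= => /and3P[xA yA xy] /and3P[x'A y'A x'y'] [fx fy].
case: (fib _ _ fy) => [E|yz].
  by subst y'; rewrite (half x x' y).
have xx' : x = x'.
  case: (fib _ _ fx) => // xz; exfalso.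
  case: xz yz => [] [E1 E2] [] [E3 E4]; subst.
  - by rewrite eI in xy.
  - by rewrite eC (negbTE bz) in xy.
  - by rewrite (negbTE bz) in xy.
  by rewrite eI in xy.
subst x'; congr (_, _); apply: (half y y' x) => //; by rewrite eC.
Qed.

End Fold.
Lemma extremal n e S : #|S| <= n -> 0 < #|S| -> symmetric e -> irreflexive e ->
  (forall x y, e x y -> x \in S) -> nice e -> total e <= bound (#|S| - 1).
Proof.
elim: n e S => [|n IH] e S Sn S0 eC eI supp ne; first by move: S0 Sn; clear; lia.
rewrite leqNgt; apply/negP => dn.
have supp' x y : e x y -> y \in S by rewrite eC; apply: supp.
have {}IH e' S' : #|S'| < #|S| -> 0 < #|S'| -> symmetric e' -> irreflexive e' ->
    (forall x y, e' x y -> x \in S') -> nice e' -> total e' <= bound (#|S'| - 1).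
  by move=> lt; apply: IH; rewrite -ltnS; apply: leq_trans lt Sn.
have del_le A : {subset A <= S} -> 0 < #|A| < #|S| -> total (del e A) <= bound (#|S| - #|A| - 1).
  move=> AS /andP[A0 AS'].
  have cD : #|S :\: A| = #|S| - #|A| by rewrite cardsD (setIidPr _) //; apply/subsetP.
  rewrite -cD; apply: IH.
  - by rewrite cD; move: A0 S0; clear; lia.
  - by rewrite cD subn_gt0.
  - exact: del_sym.
  - exact: del_irr.
  - by move=> x y /and3P[xA _ /supp xS]; rewrite inE xA.
  by apply: nice_sub ne => x y /and3P[].
have sumA A : total e + \sum_(x in A) #|[set y in A | e x y]| =
    total (del e A) + 2 * \sum_(x in A) deg e x by apply: total_del.
have dense : 3 * (#|S| - 1) + 3 * ((#|S| - 1) %/ 9) < \sum_(x in S) deg e x.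
  by rewrite (total_supp supp).
have in2 x y : e x y -> 2 <= \sum_(t in [set x; y]) #|[set r in [set x; y] | e t r]|.
  move=> xy; apply: leq_trans (_ : \sum_(t in [set x; y]) 1 <= _).
    by rewrite sum1_card cards2 (adj_neq eI xy).
  apply: leq_sum => t; rewrite !inE => /orP[]/eqP->; apply/card_gt0P.
    by exists y; rewrite !inE eqxx orbT.
  by exists x; rewrite !inE eqxx eC.
have sum2 x y : x != y -> \sum_(t in [set x; y]) deg e t = deg e x + deg e y.
  by move=> xy; rewrite big_setU1 ?inE // big_set1.
have deg_ge2 x : x \in S -> 1 < deg e x.
  move=> xS; rewrite ltnNge; apply/negP => d1.
  have := sumA [set x]; rewrite big_set1.
  have xS' : {subset [set x] <= S} by move=> w; rewrite inE => /eqP->.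
  have := del_le [set x] xS'; rewrite cards1 /=.
  case: (ltnP 1 #|S|) => [lt /(_ isT) | S1 _].
    by rewrite big_set1; move: dn d1 lt; rewrite /bound; clear; lia.
  (* Nothing is left for the induction hypothesis here, but a single vertex carries no edge. *)
  move=> _; have Sx : S = [set x].
    by apply/esym/eqP; rewrite eqEcard cards1 S1 andbT; apply/subsetP.
  have d0 : deg e x = 0.
    apply: eq_card0 => y; rewrite inE; apply/negP => xy.
    by have := supp' _ _ xy; rewrite Sx inE => /eqP E; rewrite E eI in xy.
  by move: dense; rewrite Sx big_set1 d0 cards1.
(* With the edge inside the pair, deleting it costs at most [2 * 4 - 2 = 6]. *)
have nadj2 x y : e x y -> deg e x = 2 -> deg e y = 2 -> False.
  move=> xy dx dy; have xny := adj_neq eI xy.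
  have AS : {subset [set x; y] <= S}.
    by move=> w; rewrite !inE => /orP[]/eqP->; [apply: supp xy|apply: supp' xy].
  have c2 : #|[set x; y]| = 2 by rewrite cards2 xny.
  have S2 : 2 < #|S|.
    have [r xr ry] := deg_gt1 y (deg_ge2 _ (supp _ _ xy)).
    have : #|[set r; x; y]| <= #|S|.
      apply/subset_leq_card/subsetP => w; rewrite -setUA in_setU1 => /orP[/eqP->|/AS//].
      exact: supp' xr.
    by rewrite -setUA cardsU1 c2 !inE negb_or eq_sym (adj_neq eI xr) ry.
  have := sumA [set x; y]; rewrite sum2 // dx dy; have := in2 _ _ xy.
  have := del_le [set x; y] AS; rewrite c2 S2 => /(_ isT).
  by move: dn S2; rewrite /bound; clear; lia.
(* The graphs on [z |: K] and on the complement of [K] share at most [z], so their orders minus 1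
   add up to at most [#|S| - 1], and [bound] is superadditive. *)
have cut (K : {set T}) z u : u \in K -> {subset K <= S} -> z \notin K ->
    (forall u v, u \in K -> e u v -> v \notin K -> v = z) -> {subset S <= z |: K}.
  move=> uK KS zK cl w wS; apply: contraT => wK; exfalso.
  move: wK; rewrite in_setU1 negb_or => /andP[wz wK].
  pose e1 : rel T := fun x y => [&& x \in z |: K, y \in z |: K & e x y].
  have tE : total e = total e1 + total (del e K).
    apply: total_add => x y; rewrite /e1 /del !in_setU1.
    case: (boolP (e x y)) => xy; last by rewrite !andbF.
    rewrite !andbT; case: (boolP (x \in K)) => xK; case: (boolP (y \in K)) => yK;
      rewrite ?orbT ?orbF //=.
    - by rewrite (cl x y) ?eqxx.
    - by rewrite andbT (cl y x) ?eqxx // eC.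
    case: (eqVneq x z) => [xz|_] //=; case: (eqVneq y z) => [yz|//].
    by rewrite xz yz eI in xy.
  pose S1 := (z |: K) :&: S.
  have S1K : #|S1| <= #|K|.+1.
    by apply: leq_trans (subset_leq_card (subsetIl _ _)) _; rewrite cardsU1 zK.
  have S1S : #|S1| < #|S|.
    apply: proper_card; apply/properP; split; first exact: subsetIr.
    by exists w => //; rewrite !inE negb_and negb_or wz wK.
  have S10 : 0 < #|S1| by apply/card_gt0P; exists u; rewrite !inE uK orbT KS.
  have K0 : 0 < #|K| by apply/card_gt0P; exists u.
  have KS' : #|K| < #|S|.
    apply: proper_card; apply/properP; split; first exact/subsetP.
    by exists w.
  have h2 : total (del e K) <= bound (#|S| - #|K| - 1) by apply: del_le; rewrite // K0.
  have h1 : total e1 <= bound (#|S1| - 1).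
    apply: IH => //.
    - by move=> x y; rewrite /e1 eC andbCA.
    - by move=> x; rewrite /e1 eI !andbF.
    - by move=> x y /and3P[xK _ /supp xS]; rewrite inE xK.
    by apply: nice_sub ne => x y /and3P[].
  have h3 : bound (#|S1| - 1) + bound (#|S| - #|K| - 1) <= bound (#|S| - 1).
    by apply: bound_add; move: S1K S10 K0 KS'; clear; lia.
  by move: dn h1 h2 h3; rewrite tE; clear; lia.
(* The four vertices have degree sum 9 and at least 6 ordered pairs inside, so deleting them costs
   at most [2 * 9 - 6 = 12]. *)
have star3 z : deg e z = 3 -> (forall u, e z u -> deg e u = 2) -> False.
  move=> dz du; pose A := z |: [set y | e z y].
  have zA : z \notin [set y | e z y] by rewrite inE eI.
  have c4 : #|A| = 4 by rewrite cardsU1 zA -/(deg e z) dz.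
  have AS : {subset A <= S}.
    have /card_gt0P[y] : 0 < deg e z by rewrite dz.
    rewrite inE => zy; move=> w; rewrite !inE => /orP[/eqP->|]; [exact: supp zy|exact: supp'].
  have sA : \sum_(x in A) deg e x = 9.
    rewrite big_setU1 //= dz (eq_bigr (fun=> 2)); last by move=> x; rewrite inE; apply: du.
    by rewrite sum_nat_const -/(deg e z) dz.
  have iA : 6 <= \sum_(x in A) #|[set y in A | e x y]|.
    rewrite big_setU1 //=; apply: (@leq_add 3 3).
      rewrite -dz; apply/subset_leq_card/subsetP => y; rewrite !inE => ->; by rewrite orbT.
    apply: leq_trans (_ : \sum_(x in [set y | e z y]) 1 <= _); first by rewrite sum1_card -dz.
    apply: leq_sum => y; rewrite inE => zy; apply/card_gt0P; exists z.
    by rewrite !inE eqxx eC.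
  have := sumA A; rewrite sA.
  have := del_le A AS; rewrite c4 /=.
  case: (ltnP 4 #|S|) => [lt /(_ isT)|S4 _ _].
    by move: dn iA lt; rewrite /bound; clear; lia.
  have SA : S = A by apply/esym/eqP; rewrite eqEcard c4 S4 andbT; apply/subsetP.
  by move: dense; rewrite SA sA c4.
(* Deleting [v] and [a] costs at most [2 * 5 - 2 = 8], the identification costs nothing more, and
   three vertices disappear. *)
have fold v a b z : deg e v = 2 -> e v a -> e v b -> a != b -> deg e a = 3 ->
    e a z -> z != v -> z != b -> exists y, [/\ e b y, e z y, y != v & y != a].
  move=> dv va vb ab da az zv zb.
  case: (boolP [exists y, [&& e b y, e z y, y != v & y != a]]) => [/existsP[y /and4P[]]|no].
    by exists y.
  exfalso; have noy y : e b y -> e z y -> y != v -> y != a -> False.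
    by move=> h1 h2 h3 h4; case/existsP: no; exists y; rewrite h1 h2 h3.
  have h1 := fuse_total eC eI ne va vb ab az zv zb noy.
  have AS : {subset [set v; a; z] <= S}.
    by move=> w; rewrite !inE -orbA => /or3P[]/eqP->; [apply: supp va|apply: supp' va|apply: supp' az].
  have c3 : #|[set v; a; z]| = 3.
    by rewrite -setUA cardsU1 cards2 !inE negb_or (adj_neq eI va) (adj_neq eI az) eq_sym zv.
  have cD : #|S :\: [set v; a; z]| = #|S| - 3 by rewrite cardsD (setIidPr _) ?c3 //; apply/subsetP.
  have bD : b \in S :\: [set v; a; z].
    by rewrite !inE !negb_or eq_sym (adj_neq eI vb) eq_sym ab eq_sym zb (supp' _ _ vb).
  have D0 : 0 < #|S :\: [set v; a; z]| by apply/card_gt0P; exists b.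
  have h2 : total (fuse e v a b z) <= bound (#|S| - 3 - 1).
    rewrite -cD; apply: IH => //.
    - by rewrite cD; move: S0; clear; lia.
    - exact: fuse_sym.
    - exact: fuse_irr.
    - move=> x y /and3P[xD _ H]; rewrite in_setD xD /=.
      by case/or3P: H => [/supp//|/andP[/eqP-> _]|/andP[_ /supp//]]; apply: supp' vb.
    exact: fuse_nice.
  have := sumA [set v; a]; rewrite sum2 ?(adj_neq eI va) // dv da; have := in2 _ _ va.
  by move: dn h1 h2 D0; rewrite cD /bound; clear; lia.
have [x xS] : exists x, x \in S by apply/card_gt0P.
exact: (no_critical eC eI supp ne deg_ge2 nadj2 cut star3 fold dense xS).
Qed.
End Counting.

Theorem theorem1p2 (T : finType) (e : rel T) (n q r : nat) :
  symmetric e -> irreflexive e ->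
  #|T| = n -> 1 <= n ->
  n - 1 = 9 * q + r -> r <= 8 ->
  15 * q + (3 * r) %/ 2 < num_edges e ->
  exists k : nat, k %% 3 = 1 /\ has_cycle_of_length e k.
Proof.
move=> eC eI Tn n1 nqr r8 many.
(* Cycle lengths are at most [#|T|], so the existence of the cycle is a finite and hence decidable
   question. *)
case: (boolP [exists k : 'I_#|T|.+1, exists t : k.-tuple T,
    [&& uniq t, 2 < k, cycle e t & k %% 3 == 1]]).
  case/existsP => k /existsP[t /and4P[ut k3 ct /eqP k1]].
  by exists k; split=> //; exists t; rewrite size_tuple.
move=> no; exfalso.
have ne : nice e.
  move=> s us s3 cs s1; case/negP: no.
  have sT : size s < #|T|.+1 by rewrite ltnS -(card_uniqP us) max_card.
  apply/existsP; exists (Ordinal sT); apply/existsP; exists (in_tuple s).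
  by rewrite /= us s3 cs s1.
have cT : #|[set: T]| = n by rewrite cardsT.
have := @extremal T n e [set: T]; rewrite cT => /(_ (leqnn n) n1 eC eI (fun x _ _ => in_setT x) ne).
have := edges_total eC eI; move: many; rewrite nqr /bound; move: r8; clear; lia.
Qed.
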